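(* For $n\ge0$ let $$p_n=\sum_{k=0}^n\binom{n+\frac14}{k}\binom{n-\frac14}{n-k}\Bigl(\frac14\Bigr)_{n+k},\qquad q_n=\sum_{k=0}^n\binom{n-\frac14}{k}\binom{n+\frac14}{n-k}\Bigl(\frac12\Bigr)_{n+k}.$$ Then both sequences $f_n=p_n$ and $f_n=q_n$ satisfy, for all $n\ge1$, the third-order linear recurrence $$\begin{aligned} &2048(n+2)(n+1)(2048n^4-1024n^3-304n^2+416n-117)f_{n+2}\\ &=32(4n+5)(n+1)(262144n^6+753664n^5+331776n^4-365824n^3+17168n^2\\ &\quad+76032n-32229)f_{n+1}\\ &\quad-2(4n+3)(4n+5)(4n+1)(524288n^7+1572864n^6+1486848n^5+389120n^4\\ &\quad-245824n^3-117296n^2-604n-537)f_n\\ &\quad+(4n+3)(4n-1)(2n-1)(4n+5)(4n+1)(4n-3)(2048n^4+7168n^3\\ &\quad+8912n^2+4928n+1019)f_{n-1} \end{aligned}$$ with the initial values $p_0=1$, $p_1=37/64$, $p_2=50685/8192$ and $q_0=1$, $q_1=19/16$, $q_2=6525/512$, and $$\frac{\Gamma(1/2)}{\Gamma(1/4)}-\frac{p_n}{q_n}=e^{-2\sqrt{2n}}\Bigl(\frac{\sqrt{2\pi}}{\Gamma(1/4)}+O(n^{-1/2})\Bigr)\qquad\text{as } n\to\infty.$$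
   Context: $(a)_0=1$ and $(a)_m=a(a+1)\cdots(a+m-1)$ for $m\ge1$ is the Pochhammer symbol. For real $\alpha$ and an integer $k\ge 0$, $\binom{\alpha}{k}=\alpha(\alpha-1)\cdots(\alpha-k+1)/k!$. *)

(* Defs.v *)
From HB Require Import structures.
From mathcomp Require Import all_boot all_order all_algebra.
From mathcomp Require Import all_classical all_reals all_analysis.

Set Implicit Arguments.
Unset Strict Implicit.
Unset Printing Implicit Defensive.

Import Order.TTheory GRing.Theory Num.Theory.
Import numFieldNormedType.Exports.

Local Open Scope classical_set_scope.
Local Open Scope ring_scope.

(* Numerals above 5000 in nat parse to [Nat.of_num_uint]; they must not be
   expanded to unary form by simplification. *)
Arguments Nat.of_num_uint : simpl never.

Definition poch (R : realType) (a : R) (m : nat) : R :=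
  \prod_(i < m) (a + i%:R).

Definition gbinom (R : realType) (alpha : R) (k : nat) : R :=
  (\prod_(i < k) (alpha - i%:R)) / k`!%:R.

(* Euler's integral, a Lebesgue integral over the open half-line; meaningful
   only for s > 0 ([Rintegral] returns 0 when the integral is infinite). *)
Definition EulerGamma (R : realType) (s : R) : R :=
  \int[@lebesgue_measure R]_(t in `]0, +oo[) (t `^ (s - 1) * expR (- t)).

Definition p (R : realType) (n : nat) : R :=
  \sum_(0 <= k < n.+1) gbinom (n%:R + 1 / 4) k *
    gbinom (n%:R - 1 / 4) (n - k) * poch (1 / 4) (n + k).

Definition q (R : realType) (n : nat) : R :=
  \sum_(0 <= k < n.+1) gbinom (n%:R - 1 / 4) k *
    gbinom (n%:R + 1 / 4) (n - k) * poch (1 / 2) (n + k).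

Definition satisfies_recurrence (R : realType) (f : nat -> R) : Prop :=
  forall m : nat, (1 <= m)%N ->
  let n : R := m%:R in
  2048 * (n + 2) * (n + 1)
    * (2048 * n ^+ 4 - 1024 * n ^+ 3 - 304 * n ^+ 2 + 416 * n - 117)
    * f (m + 2)%N
  = 32 * (4 * n + 5) * (n + 1)
      * (262144%:R * n ^+ 6 + 753664%:R * n ^+ 5 + 331776%:R * n ^+ 4
         - 365824%:R * n ^+ 3 + 17168%:R * n ^+ 2 + 76032%:R * n - 32229%:R)
      * f (m + 1)%N
    - 2 * (4 * n + 3) * (4 * n + 5) * (4 * n + 1)
      * (524288%:R * n ^+ 7 + 1572864%:R * n ^+ 6 + 1486848%:R * n ^+ 5
         + 389120%:R * n ^+ 4 - 245824%:R * n ^+ 3 - 117296%:R * n ^+ 2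
         - 604 * n - 537)
      * f m
    + (4 * n + 3) * (4 * n - 1) * (2 * n - 1) * (4 * n + 5) * (4 * n + 1)
      * (4 * n - 3)
      * (2048 * n ^+ 4 + 7168%:R * n ^+ 3 + 8912%:R * n ^+ 2 + 4928 * n + 1019)
      * f (m - 1)%N.

(* Main.v *)
Require Import Defs.
From HB Require Import structures.
From mathcomp Require Import all_boot all_order all_algebra.
From mathcomp Require Import all_classical all_reals all_analysis.
From mathcomp Require Import measurable_realfun.
From mathcomp Require Import ring lra zify.

Set Implicit Arguments.
Unset Strict Implicit.
Unset Printing Implicit Defensive.

Import Order.TTheory GRing.Theory Num.Theory.
Import numFieldNormedType.Exports.

Local Open Scope classical_set_scope.
Local Open Scope ring_scope.

(* The recurrences come from creative telescoping.  For the error, put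
   P(t) = sum_k C(n+1/4,k) C(n-1/4,n-k) t^k and
   Q(t) = sum_k C(n-1/4,k) C(n+1/4,n-k) t^k: these form a Pade approximation of
   t^(1/4) at t = 1, with
     t^(1/4) Q(t) - P(t) = c_n int_1^t (t-x)^n (x-1)^n x^(-n-3/4) dx.
   Integrating against t^(n-3/4) exp(-t) over t > 0 yields
     Gamma(1/2) q_n - Gamma(1/4) p_n = c_n J_n + O(4^n),
   where J_n is an integral over 1 < x < t.  Let X = sqrt(2n).  The inner integral
   over t concentrates at t - x/2 = 2n and leaves the density
   x^(-1/2) exp(-x/2 - X^2/(2x)), which concentrates at x = X, has an elementary
   primitive in terms of the Gauss error function, and total mass
   sqrt(2 pi) exp(-X).  On the other side q_n is a sum over odd M = 2j+1 of the
   Poisson weights X^M/M! times a slowly varying factor.  In each case the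
   remaining factor, divided by its value at the point of concentration, equals 1
   there up to a quadratic error, so exact second moments bound the relative
   error by O(1/X). *)

(** * The recurrences *)

(** The outer integral and the sum for q_n concentrate with relative width X^(-1/2) only. A
    first-order bound on the remaining factor would therefore give an error n^(-1/4); its logarithm
    has to be critical at the point of concentration, and it is so in both cases, with the same
    value exp(-3/8), which cancels in the quotient. The inner integral has relative width 1/X, so
    there a first-order error is affordable. No Stirling formula is used. The factor c_n (2n)! of
    the remainder and the factor in front of the sum for q_n agree exactly up to an explicit
    algebraic function of n, by [pade_const_fact]; a crude lower bound for c_n (2n)! is needed only
    to discard the O(4^n) terms. The error bounds are combinations of powers of the concentrating
    variables, chosen so that their integrals or sums are factorials, Bessel moments or Poisson
    moments known in closed form. The numerical constants are merely large enough for these closed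
    forms. *)

Definition rec_coef (R : realType) (n : R) (i : nat) : R :=
  match i with
  | 0 => - ((4 * n + 3) * (4 * n - 1) * (2 * n - 1) * (4 * n + 5) * (4 * n + 1)
      * (4 * n - 3)
      * (2048 * n ^+ 4 + 7168%:R * n ^+ 3 + 8912%:R * n ^+ 2 + 4928 * n + 1019))
  | 1 => 2 * (4 * n + 3) * (4 * n + 5) * (4 * n + 1)
      * (524288%:R * n ^+ 7 + 1572864%:R * n ^+ 6 + 1486848%:R * n ^+ 5
         + 389120%:R * n ^+ 4 - 245824%:R * n ^+ 3 - 117296%:R * n ^+ 2
         - 604 * n - 537)
  | 2 => - (32 * (4 * n + 5) * (n + 1)
      * (262144%:R * n ^+ 6 + 753664%:R * n ^+ 5 + 331776%:R * n ^+ 4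
         - 365824%:R * n ^+ 3 + 17168%:R * n ^+ 2 + 76032%:R * n - 32229%:R))
  | _ => 2048 * (n + 2) * (n + 1)
    * (2048 * n ^+ 4 - 1024 * n ^+ 3 - 304 * n ^+ 2 + 416 * n - 117)
  end.

(** From row [n] to row [n + 1] the summand gains (n+1+a)(n+1-a)(b+n+k) and loses (n+1-k)(n+1+a-k).
    Relative to a base common to the rows [m], ..., [m + 3], row [m + i] gets the gains up to it and
    the losses after it, so the result is a polynomial in [k], also where a lost factor is zero. *)
Definition shift_factor (R : realType) (a b m k : R) (i : nat) : R :=
  \prod_(j < i) ((m + a + 1 + j%:R) * (m - a + 1 + j%:R) * (b + m + k + j%:R)) *
  \prod_(i.+1 <= j < 4) ((m + j%:R - k) * (m + a + j%:R - k)).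

(** The polynomial part, cubic in [k], of a Zeilberger certificate; any polynomial satisfying
    [cert_pE] would do. The variable N = 4m makes the coefficients integers up to the factor in
    front. *)
Definition cert_p (R : realType) (m k : R) : R :=
  let N := 4 * m in
  (N + 3) * (N + 5) * (N + 7) * (N + 9) / 128 * (
    (32 * N ^+ 10 + 2168 * N ^+ 9 + 64796%:R * N ^+ 8 + 1125635%:R * N ^+ 7
      + 12588715%:R * N ^+ 6 + 94642954%:R * N ^+ 5 + 483563666%:R * N ^+ 4
      + 1653284435%:R * N ^+ 3 + 3607041323%:R * N ^+ 2 + 4518917768%:R * N
      + 2461872828%:R) +
    (- 256 * N ^+ 9 - 14816%:R * N ^+ 8 - 372864%:R * N ^+ 7 - 5353228%:R *
      N ^+ 6 - 48253988%:R * N ^+ 5 - 282515972%:R * N ^+ 4 - 1070864520%:R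
      * N ^+ 3 - 2525090212%:R * N ^+ 2 - 3350980308%:R * N - 1903852908%:R) * k +
    (512 * N ^+ 8 + 23680%:R * N ^+ 7 + 470720%:R * N ^+ 6 + 5244240%:R * N
      ^+ 5 + 35683344%:R * N ^+ 4 + 151029920%:R * N ^+ 3 + 385633568%:R *
      N ^+ 2 + 539230224%:R * N + 315672720%:R) * k ^+ 2 +
    (- 512 * N ^+ 6 - 16896%:R * N ^+ 5 - 217920%:R * N ^+ 4 - 1382336%:R *
      N ^+ 3 - 4399936%:R * N ^+ 2 - 6300736%:R * N - 3081600%:R) * k ^+ 3).

Lemma cert_pE (R : realType) (m k : R) :
  \sum_(i < 4) rec_coef (m + 1) i * shift_factor (1 / 4) (1 / 4) m k i =
  ((1 / 4 + m + k) * (m + 3 - k) * (m + 3 + 1 / 4 - k) * cert_p m (k + 1)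
    - k * (k - (1 / 4)) * cert_p m k).
Proof.
rewrite !big_ord_recr big_ord0 /shift_factor /=.
rewrite !big_ord_recr !big_ord0 /= !(@big_ltn _ _ _ 1) // !(@big_ltn _ _ _ 2) //.
rewrite !(@big_ltn _ _ _ 3) // !big_geq // /cert_p /=.
by field.
Qed.

Definition cert_q (R : realType) (m k : R) : R :=
  let N := 4 * m in
  (N + 3) * (N + 5) * (N + 7) * (N + 9) / 128 * (
    (32 * N ^+ 10 + 2104 * N ^+ 9 + 61124%:R * N ^+ 8 + 1033899%:R * N ^+ 7
      + 11279820%:R * N ^+ 6 + 82906958%:R * N ^+ 5 + 415161477%:R * N ^+ 4
      + 1394986076%:R * N ^+ 3 + 2999802119%:R * N ^+ 2 + 3714776131%:R * N
      + 2005590996%:R) +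
    (- 256 * N ^+ 9 - 14560%:R * N ^+ 8 - 361024%:R * N ^+ 7 - 5117964%:R *
      N ^+ 6 - 45635036%:R * N ^+ 5 - 264715160%:R * N ^+ 4 - 995608748%:R
      * N ^+ 3 - 2333098416%:R * N ^+ 2 - 3082546584%:R * N - 1746594348%:R) * k +
    (512 * N ^+ 8 + 23680%:R * N ^+ 7 + 470336%:R * N ^+ 6 + 5231568%:R * N
      ^+ 5 + 35519904%:R * N ^+ 4 + 149993168%:R * N ^+ 3 + 382333616%:R *
      N ^+ 2 + 534504672%:R * N + 313361520%:R) * k ^+ 2 +
    (- 512 * N ^+ 6 - 16896%:R * N ^+ 5 - 217920%:R * N ^+ 4 - 1382336%:R *
      N ^+ 3 - 4399936%:R * N ^+ 2 - 6300736%:R * N - 3081600%:R) * k ^+ 3).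

Lemma cert_qE (R : realType) (m k : R) :
  \sum_(i < 4) rec_coef (m + 1) i * shift_factor (- (1 / 4)) (1 / 2) m k i =
  ((1 / 2 + m + k) * (m + 3 - k) * (m + 3 + (- (1 / 4)) - k) * cert_q m (k + 1)
    - k * (k - (- (1 / 4))) * cert_q m k).
Proof.
rewrite !big_ord_recr big_ord0 /shift_factor /=.
rewrite !big_ord_recr !big_ord0 /= !(@big_ltn _ _ _ 1) // !(@big_ltn _ _ _ 2) //.
rewrite !(@big_ltn _ _ _ 3) // !big_geq // /cert_q /=.
by field.
Qed.

Lemma gbinomS (R : realType) (x : R) k :
  gbinom x k.+1 * k.+1%:R = gbinom x k * (x - k%:R).
Proof.
rewrite /gbinom big_ord_recr /= factS natrM.
have h1 : (k`!)%:R != 0 :> R by rewrite pnatr_eq0 -lt0n fact_gt0.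
have h2 : k.+1%:R != 0 :> R by rewrite pnatr_eq0.
by field; rewrite h1 -?(natr1 _ k) -?natrD ?add1n ?addn1 ?nat1r h2.
Qed.

Lemma gbinomD1 (R : realType) (x : R) k :
  gbinom (x + 1) k * (x + 1 - k%:R) = gbinom x k * (x + 1).
Proof.
elim: k => [|k ih]; first by rewrite /gbinom !big_ord0; ring.
have k0 : k.+1%:R != 0 :> R by rewrite pnatr_eq0.
apply: (mulIf k0); rewrite mulrAC gbinomS.
rewrite [RHS]mulrAC gbinomS ih -[k.+1]addn1 natrD; ring.
Qed.

Lemma pochS (R : realType) (b : R) k : poch b k.+1 = poch b k * (b + k%:R).
Proof. by rewrite /poch big_ord_recr. Qed.

(** One two-parameter summand serves both sequences, so that telescoping is done once and only the
    certificates differ. *)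
Definition hterm (R : realType) (a b : R) (n k : nat) : R :=
  gbinom (n%:R + a) k * gbinom (n%:R - a) (n - k) * poch b (n + k).

Lemma pE (R : realType) n :
  p R n = \sum_(k < n.+1) hterm (1 / 4) (1 / 4) n k.
Proof. by rewrite /p big_mkord. Qed.

Lemma qE (R : realType) n :
  q R n = \sum_(k < n.+1) hterm (- (1 / 4)) (1 / 2) n k.
Proof. by rewrite /q big_mkord; apply: eq_bigr => k _; rewrite /hterm opprK. Qed.

Lemma htermSn (R : realType) (a b : R) n k : (k <= n)%N ->
  hterm a b n k * ((n%:R + 1 + a) * (n%:R + 1 - a) * (b + n%:R + k%:R)) =
  hterm a b n.+1 k * ((n%:R + 1 - k%:R) * (n%:R + 1 + a - k%:R)).
Proof.
move=> kn; rewrite /hterm addSn pochS natrD addrA subSn //.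
have -> : n.+1%:R + a = (n%:R + a) + 1 :> R by rewrite -natr1; ring.
have -> : n.+1%:R - a = (n%:R - a) + 1 :> R by rewrite -natr1; ring.
have e1 := gbinomD1 (n%:R + a) k.
have e2 := gbinomS (n%:R - a + 1) (n - k).
have e3 := gbinomD1 (n%:R - a) (n - k).
have nk : (n - k)%:R = n%:R - k%:R :> R by rewrite natrB.
rewrite -natr1 nk in e2; rewrite nk in e3.
transitivity ((gbinom (n%:R + a) k * (n%:R + a + 1)) *
  (gbinom (n%:R - a) (n - k) * (n%:R - a + 1)) *
  (poch b (n + k) * (b + n%:R + k%:R))); first by ring.
rewrite -e1 -e3 -e2.
by ring.
Qed.

Lemma htermSk (R : realType) (a b : R) n k : (k < n)%N ->
  hterm a b n k.+1 * (k.+1%:R * (k%:R + 1 - a)) =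
  hterm a b n k * ((n%:R - k%:R) * (n%:R + a - k%:R) * (b + n%:R + k%:R)).
Proof.
move=> kn; rewrite /hterm addnS pochS natrD addrA.
have e1 := gbinomS (n%:R + a) k.
have := gbinomS (n%:R - a) (n - k.+1); rewrite -subSn // subSS => e2.
rewrite [X in _ * X = _]natrB 1?ltnW // in e2.
rewrite natrB // in e2.
transitivity ((gbinom (n%:R + a) k.+1 * k.+1%:R) *
  (gbinom (n%:R - a) (n - k.+1) * (n%:R - a - (n%:R - k.+1%:R))) *
  (poch b (n + k) * (b + n%:R + k%:R))); first by rewrite -natr1; ring.
by rewrite e1 -e2; ring.
Qed.

Lemma prod_nat_neq0 (R : idomainType) (i j : nat) (F : nat -> R) :
  (forall k, F k != 0) -> \prod_(i <= k < j) F k != 0.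
Proof.
by move=> F0; elim/big_ind: _ => [|x y x0 y0|k _];
  rewrite ?oner_neq0 ?mulf_neq0 ?F0.
Qed.

Section Telescope.
Variables (R : realType) (a b : R).
Hypotheses (a_lt1 : -1 < a < 1) (b_gt0 : 0 < b).

Let base (m k : nat) : R := hterm a b m.+3 k /
  \prod_(j < 3) ((m%:R + a + 1 + j%:R) * (m%:R - a + 1 + j%:R) *
                 (b + m%:R + k%:R + j%:R)).

Let fac_neq0 m k (i : nat) : (m%:R + a + 1 + i%:R) * (m%:R - a + 1 + i%:R) *
  (b + m%:R + k%:R + i%:R) != 0.
Proof.
case/andP: a_lt1 => al au.
have m0 := ler0n R m; have k0 := ler0n R k; have i0 := ler0n R i.
by have b0 := b_gt0; rewrite !mulf_neq0 //; apply: lt0r_neq0; lra.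
Qed.

Lemma hterm_shift m k i : (i <= 3)%N -> (k <= m + i)%N ->
  hterm a b (m + i) k = base m k * shift_factor a b m%:R k%:R i.
Proof.
move=> i3.
(* The gains of the rows up to [m + i] cancel against [base]. What is left involves only later rows,
   which suits an induction downwards from [i = 3]. *)
have -> : base m k * shift_factor a b m%:R k%:R i = hterm a b m.+3 k *
   \prod_(i.+1 <= j < 4) ((m%:R + j%:R - k%:R) * (m%:R + a + j%:R - k%:R)) /
   \prod_(i.+1 <= j < 4) ((m%:R + a + j%:R) * (m%:R - a + j%:R) *
                 (b + m%:R + k%:R + j%:R - 1)).
  rewrite /base /shift_factor.
  have -> : \prod_(i.+1 <= j < 4) ((m%:R + a + j%:R) * (m%:R - a + j%:R) *
                 (b + m%:R + k%:R + j%:R - 1)) =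
     \prod_(i <= j < 3) ((m%:R + a + 1 + j%:R) * (m%:R - a + 1 + j%:R) *
                 (b + m%:R + k%:R + j%:R)).
    by rewrite big_add1; apply: eq_big_nat => j _; rewrite -natr1; ring.
  rewrite -(big_mkord xpredT (fun j => (m%:R + a + 1 + j%:R) * (m%:R - a + 1 + j%:R) *
                 (b + m%:R + k%:R + j%:R))).
  rewrite -[X in _ * (X * _)](big_mkord xpredT (fun j => (m%:R + a + 1 + j%:R) * (m%:R - a + 1 + j%:R) *
                 (b + m%:R + k%:R + j%:R))).
  rewrite (big_cat_nat (leq0n i) i3) /=.
  set A := \prod_(0 <= j < i) _; set B := \prod_(i <= j < 3) _.
  have A0 : A != 0 by apply: prod_nat_neq0 => j; exact: fac_neq0.
  have B0 : B != 0 by apply: prod_nat_neq0 => j; exact: fac_neq0.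
  by field; rewrite A0 B0.
elim: (3 - i)%N {-2}i (erefl (3 - i)%N) i3 => [|d ih] {}i hd i3 km.
  have -> : i = 3 by apply/eqP; rewrite eqn_leq i3 -subn_eq0 hd.
  by rewrite !big_geq // divr1 mulr1 addn3.
have i3' : (i < 3)%N by rewrite -subn_gt0 hd.
have hd' : (3 - i.+1)%N = d by rewrite subnS hd.
have := ih i.+1 hd' i3'; rewrite addnS => /(_ (leq_trans km (leqnSn _))) ihS.
have := htermSn a b km; rewrite ihS.
have i4 : (i.+1 < 4)%N by [].
rewrite [X in _ = _ * X / _](big_ltn i4) [X in _ = _ / X](big_ltn i4).
set P := \prod_(i.+2 <= j < 4) _; set Q := \prod_(i.+2 <= j < 4) _.
rewrite natrD => e.
have f0 := fac_neq0 m k i.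
rewrite -[i.+1%:R]natr1.
have Q0 : Q != 0.
  rewrite /Q big_add1; apply: prod_nat_neq0 => j.
  rewrite (_ : (_ * _) = (m%:R + a + 1 + j%:R) * (m%:R - a + 1 + j%:R) *
                 (b + m%:R + k%:R + j%:R)) ?fac_neq0 // -natr1; ring.
apply: (mulIf f0).
transitivity (hterm a b (m + i) k * ((m%:R + i%:R + 1 + a) * (m%:R + i%:R + 1 - a) *
   (b + (m%:R + i%:R) + k%:R))); first by ring.
rewrite e; field; rewrite Q0 /=.
move: f0; rewrite !mulf_eq0 !negb_or => /andP[/andP[h1 h2] h3].
by apply/and3P; split; [move: h3|move: h2|move: h1];
  apply: contra_neq => h; rewrite -[RHS]h; ring.
Qed.

Lemma baseS m k : (k < m.+3)%N ->
  base m k.+1 * (k.+1%:R * (k%:R + 1 - a)) =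
  base m k * ((b + m%:R + k%:R) * (m%:R + 3 - k%:R) * (m%:R + 3 + a - k%:R)).
Proof.
move=> km; have := htermSk a b km.
rewrite /base; set h1 := hterm _ _ _ _; set h0 := hterm _ _ _ _ => e.
rewrite !big_ord_recr !big_ord0 /=.
have g0 := fac_neq0 m k 0; have g1 := fac_neq0 m k 1.
have g2 := fac_neq0 m k 2; have g3 := fac_neq0 m k 3.
rewrite mulrAC e -[k.+1%:R]natr1.
have -> : m.+3%:R = m%:R + 3 :> R by rewrite -addn3 natrD.
move: g0 g1 g2 g3; rewrite !mulf_eq0 !negb_or.
move=> /andP[/andP[n1 n2] n3] /andP[/andP[n4 n5] n6].
move=> /andP[/andP[n7 n8] n9] /andP[/andP[n10 n11] n12].
rewrite !addr0 in n1 n2 n3 *.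
have h3 : b + m%:R + (k%:R + 1) + 2 != 0 by rewrite (_ : _ + 2 = b + m%:R + k%:R + 3) //; ring.
by field; do !(apply/andP; split).
Qed.

(** The factor m + j - k with j = k - m is among the losses after row [m + i]. This lets all four
    rows be summed over the common range k <= m + 3. *)
Lemma shift_factor_eq0 m k i : (m + i < k <= m.+3)%N ->
  shift_factor a b m%:R k%:R i = 0.
Proof.
case/andP=> ik km; apply/eqP; rewrite mulf_eq0; apply/orP; right.
have mk : (m <= k)%N by apply: leq_trans (ltnW ik); exact: leq_addr.
have [j jE] : exists j, k = (m + j)%N by exists (k - m)%N; rewrite subnKC.
subst k; rewrite -addnS leq_add2l in ik; rewrite -addn3 leq_add2l in km.
have j4 : (j < 4)%N by [].
rewrite (big_cat_nat ik (ltnW j4)) /= [X in _ * X](big_ltn j4) natrD.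
by rewrite subrr mul0r mul0r mulr0.
Qed.

(* Zeilberger's creative telescoping with [S] as certificate. *)
Lemma hterm_sum_rec (c : nat -> R) (S : R -> R) m :
  (forall k, \sum_(i < 4) c i * shift_factor a b m%:R k i =
     (b + m%:R + k) * (m%:R + 3 - k) * (m%:R + 3 + a - k) * S (k + 1)
     - k * (k - a) * S k) ->
  \sum_(i < 4) c i * (\sum_(k < (m + i).+1) hterm a b (m + i) k) = 0.
Proof.
move=> cE.
transitivity (\sum_(k < m.+4) base m k *
    \sum_(i < 4) c i * shift_factor a b m%:R k%:R i).
  under [RHS]eq_bigr do rewrite mulr_sumr.
  rewrite exchange_big; apply: eq_bigr => i _.
  have i3 : (i <= 3)%N by rewrite -ltnS.
  rewrite mulr_sumr.
  have iw : ((m + i).+1 <= m.+4)%N by rewrite ltnS -(addn3 m) leq_add2l.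
  rewrite (big_ord_widen m.+4 (fun k => c i * hterm a b (m + i) k) iw) big_mkcond /=.
  apply: eq_bigr => k _; rewrite ltnS.
  case: leqP => ki; first by rewrite hterm_shift //; ring.
  by rewrite shift_factor_eq0 ?mulr0 // ki -ltnS ltn_ord.
(* By [baseS] the first term of the certificate identity at [k], times [base m k], is G (k + 1), and
   the factor [k] gives G 0 = 0. *)
pose G k := base m k * (k%:R * (k%:R - a) * S k%:R).
rewrite (eq_bigr (fun k : 'I_m.+4 => base m k * ((b + m%:R + k%:R) *
   (m%:R + 3 - k%:R) * (m%:R + 3 + a - k%:R)) * S (k%:R + 1) - G k)); last first.
  by move=> k _; rewrite cE /G; ring.
(* At the last index k = m + 3 the forward term contains m + 3 - k = 0, so no value outside the
   range enters. *)
rewrite big_ord_recr /=.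
have -> : m.+3%:R = m%:R + 3 :> R by rewrite -addn3 natrD.
rewrite subrr mulr0 !mul0r mulr0 mul0r sub0r.
rewrite (eq_bigr (fun k : 'I_m.+3 => G k.+1 - G k)); last first.
  move=> k _; rewrite -baseS // /G -[k.+1%:R]natr1; ring.
rewrite -(big_mkord xpredT (fun k => G k.+1 - G k)) telescope_sumr //.
by rewrite /G mul0r mul0r mulr0 subr0 subrr.
Qed.

End Telescope.

Lemma p_rec (R : realType) : satisfies_recurrence (@p R).
Proof.
case=> // m _ n; rewrite /n addn2 addn1 subn1 /=.
have a1 : -1 < (1 / 4 : R) < 1 by apply/andP; split; lra.
have b0 : 0 < (1 / 4 : R) by lra.
have := hterm_sum_rec a1 b0 (cert_pE m%:R).
under eq_bigr do rewrite -pE.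
rewrite !big_ord_recr big_ord0 /= addn0 addn1 addn2 addn3 -natr1 => h.
by apply/eqP; rewrite -subr_eq0 -[X in _ == X]h /=; apply/eqP; ring.
Qed.

Lemma q_rec (R : realType) : satisfies_recurrence (@q R).
Proof.
case=> // m _ n; rewrite /n addn2 addn1 subn1 /=.
have a1 : -1 < (- (1 / 4) : R) < 1 by apply/andP; split; lra.
have b0 : 0 < (1 / 2 : R) by lra.
have := hterm_sum_rec a1 b0 (cert_qE m%:R).
under eq_bigr do rewrite -qE.
rewrite !big_ord_recr big_ord0 /= addn0 addn1 addn2 addn3 -natr1 => h.
by apply/eqP; rewrite -subr_eq0 -[X in _ == X]h /=; apply/eqP; ring.
Qed.

Lemma p_init (R : realType) :
  [/\ p R 0 = 1, p R 1 = 37 / 64 & p R 2 = 50685%:R / 8192%:R].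
Proof.
rewrite !pE /hterm /gbinom /poch; split; rewrite !big_ord_recr !big_ord0 /=;
  rewrite ?subn0 ?subnn ?addn0 ?add0n /= ?big_ord0 ?factS ?fact0 ?muln1; by field.
Qed.

Lemma q_init (R : realType) :
  [/\ q R 0 = 1, q R 1 = 19 / 16 & q R 2 = 6525%:R / 512].
Proof.
rewrite !qE /hterm /gbinom /poch; split; rewrite !big_ord_recr !big_ord0 /=;
  rewrite ?subn0 ?subnn ?addn0 ?add0n /= ?big_ord0 ?factS ?fact0 ?muln1;
  by field.
Qed.

(** * Integrals over half-lines and the Gamma function *)

Section HalfLine.
Variable R : realType.
Notation mu := (@lebesgue_measure R).
Local Open Scope ereal_scope.

Lemma measurable_itvoy (a : R) (f : R -> R) :
  (forall x, (a < x)%R -> {for x, continuous f}) ->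
  measurable_fun `]a, +oo[ f.
Proof.
move=> cf; apply: open_continuous_measurable_fun; first exact: rray_open.
by move=> x; rewrite inE /= in_itv /= andbT; exact: cf.
Qed.

(** Monotone convergence along compact intervals that exhaust the half-line; nonnegativity makes it
    valid for infinite integrals too. *)
Lemma cvg_integral_itvoy (a : R) (f : R -> R) :
  (forall x, (a < x)%R -> (0 <= f x)%R) ->
  (forall x, (a < x)%R -> {for x, continuous f}) ->
  \int[mu]_(x in `[(a + n.+1%:R^-1)%R, (a + n.+1%:R)%R]) (f x)%:E @[n --> \oo]
    --> \int[mu]_(x in `]a, +oo[) (f x)%:E.
Proof.
move=> f0 cf.
have UE : `]a, +oo[%classic =
    \bigcup_n `[(a + n.+1%:R^-1)%R, (a + n.+1%:R)%R]%classic :> set R.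
  apply/seteqP; split => x /=; last first.
    move=> [n _] /=; rewrite !in_itv /= andbT => /andP[+ _].
    by apply: lt_le_trans; rewrite ltrDl invr_gt0 ltr0n.
  rewrite in_itv /= andbT => ax.
  have xa : (0 < x - a)%R by rewrite subr_gt0.
  exists (maxn (Num.truncn (x - a)) (Num.truncn (x - a)^-1)) => //=.
  rewrite in_itv /=; apply/andP; split.
    rewrite -lerBrDl.
    rewrite -[leRHS]invrK lef_pV2 ?posrE ?invr_gt0 ?ltr0n //.
    apply: ltW; apply: lt_le_trans (truncnS_gt _) _.
    by rewrite ler_nat ltnS leq_maxr.
  rewrite -lerBlDl; apply: ltW; apply: lt_le_trans (truncnS_gt _) _.
  by rewrite ler_nat ltnS leq_maxl.
rewrite UE.
apply: (@ge0_nondecreasing_set_cvg_integral _ (measurableTypeR R) R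
  (fun n => `[(a + n.+1%:R^-1)%R, (a + n.+1%:R)%R]%classic) (EFin \o f) mu).
- apply/nondecreasing_seqP => n; rewrite subsetEset => x /=; rewrite !in_itv /=.
  move=> /andP[h1 h2]; apply/andP; split.
    apply: le_trans h1; rewrite lerD2l lef_pV2 ?posrE ?ltr0n // ler_nat //.
  by apply: le_trans h2 _; rewrite lerD2l ler_nat.
- by move=> i; exact: measurable_itv.
- move=> n; apply/measurable_EFinP; apply: measurable_funS (measurable_itvoy cf).
    exact: measurable_itv.
  move=> x /=; rewrite !in_itv /= andbT => /andP[+ _].
  by apply: lt_le_trans; rewrite ltrDl invr_gt0 ltr0n.
- move=> n x /=; rewrite in_itv /= => /andP[h _]; rewrite lee_fin f0 //.
  by apply: lt_le_trans h; rewrite ltrDl invr_gt0 ltr0n.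
Qed.

(** Written with sums instead of a difference of integrals, because in the limit both integrals may
    be infinite. *)
Lemma integral_itvcc_sub (f g F : R -> R) (u v : R) : (u < v)%R ->
  (forall x, (u <= x <= v)%R -> {for x, continuous f}) ->
  (forall x, (u <= x <= v)%R -> {for x, continuous g}) ->
  (forall x, (u <= x <= v)%R -> is_derive x (1:R)%R F (f x - g x)%R) ->
  \int[mu]_(x in `[u, v]) (f x)%:E + (F u)%:E =
  \int[mu]_(x in `[u, v]) (g x)%:E + (F v)%:E.
Proof.
move=> uv cf cg dF.
have wc h : (forall x, (u <= x <= v)%R -> {for x, continuous h}) ->
    {within `[u, v], continuous (h : R -> R)}.
  move=> ch; apply: continuous_in_subspaceT => x; rewrite inE /= in_itv /=.
  exact: ch.
have fi h : (forall x, (u <= x <= v)%R -> {for x, continuous h}) ->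
    mu.-integrable `[u, v] (EFin \o (h : R -> R)).
  by move=> ch; apply: continuous_compact_integrable;
    [exact: segment_compact|exact: wc].
have cF x : (u <= x <= v)%R -> {for x, continuous F}.
  move=> xuv; have [d _] := dF _ xuv.
  by apply: differentiable_continuous; exact/derivable1_diffP.
have := @continuous_FTC2 R (f \- g)%R F u v uv.
have -> : \int[mu]_(x in `[u, v]) ((f \- g)%R x)%:E =
    \int[mu]_(x in `[u, v]) (f x)%:E - \int[mu]_(x in `[u, v]) (g x)%:E.
  under eq_integral do rewrite EFinB.
  by rewrite integralB_EFin //; exact: fi.
move=> h; have {h} : \int[mu]_(x in `[u, v]) (f x)%:E -
     \int[mu]_(x in `[u, v]) (g x)%:E = (F v)%:E - (F u)%:E.
  apply: h.
  - by apply: wc => x xuv; apply: continuousB; [exact: cf|exact: cg].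
  - split.
    + move=> x; rewrite in_itv /= => /andP[h1 h2].
      by have [|? _] := dF x; rewrite ?(ltW h1) ?(ltW h2).
    + by apply: cvg_at_right_filter; apply: cF; rewrite lexx ltW.
    + by apply: cvg_at_left_filter; apply: cF; rewrite lexx ltW.
  - move=> x; rewrite in_itv /= => /andP[h1 h2].
    rewrite derive1E; have [|? ->] := dF x; by rewrite ?(ltW h1) ?(ltW h2).
have If h : (forall x, (u <= x <= v)%R -> {for x, continuous h}) ->
    \int[mu]_(x in `[u, v]) (h x)%:E \is a fin_num.
  by move=> ch; apply: integrable_fin_num => //; exact: fi.
move: (If f cf) (If g cg).
case: (integral _ _ _) => [r| |] // _; case: (integral _ _ _) => [s| |] // _.
by rewrite -!EFinB -!EFinD => -[e]; congr EFin; lra.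
Qed.

(* The common form of the fundamental theorem of calculus and of integration by
   parts for nonnegative, possibly non-integrable functions. *)
Lemma integral_itvoy_sub (f g F : R -> R) (a l0 l : R) :
  (forall x, (a < x)%R -> (0 <= f x)%R) ->
  (forall x, (a < x)%R -> (0 <= g x)%R) ->
  (forall x, (a < x)%R -> {for x, continuous f}) ->
  (forall x, (a < x)%R -> {for x, continuous g}) ->
  (forall x, (a < x)%R -> is_derive x (1:R)%R F (f x - g x)%R) ->
  F x @[x --> a^'+] --> l0 -> F x @[x --> +oo%R] --> l ->
  \int[mu]_(x in `]a, +oo[) (f x)%:E + l0%:E =
  \int[mu]_(x in `]a, +oo[) (g x)%:E + l%:E.
Proof.
move=> f0 g0 cf cg dF F0 Fy.
pose u n := (a + n.+1%:R^-1)%R; pose v n := (a + n.+1%:R)%R.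
have au n : (a < u n)%R by rewrite ltrDl invr_gt0 ltr0n.
have h1 : (\int[mu]_(x in `[u n, v n]) (f x)%:E + (F (u n))%:E) @[n --> \oo] -->
   \int[mu]_(x in `]a, +oo[) (f x)%:E + l0%:E.
  apply: cvgeD; first by rewrite fin_num_adde_defl.
    exact: cvg_integral_itvoy.
  apply: cvg_EFin; first by near=> n.
  move/cvg_at_rightP : F0; apply; split=> //.
  rewrite -[X in _ --> X]addr0; apply: cvgD; first exact: cvg_cst.
  exact: cvg_harmonic.
have h2 : (\int[mu]_(x in `[u n, v n]) (g x)%:E + (F (v n))%:E) @[n --> \oo] -->
   \int[mu]_(x in `]a, +oo[) (g x)%:E + l%:E.
  apply: cvgeD; first by rewrite fin_num_adde_defl.
    exact: cvg_integral_itvoy.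
  apply: cvg_EFin; first by near=> n.
  move/cvg_pinftyP : Fy; apply.
  apply/cvgryPge => A; near=> n.
  rewrite /v -lerBlDl; apply: le_trans (_ : n%:R <= _)%R.
    near: n; exact: nbhs_infty_ger.
  by rewrite ler_nat.
apply: (cvg_unique _ _ h2) => //.
apply: cvg_trans h1; apply: near_eq_cvg; near=> n => /=.
have uv : (u n < v n)%R.
  rewrite /u /v ltrD2l; apply: (@le_lt_trans _ _ 1%R).
    by rewrite invf_le1 ?ltr0n // ler1n.
  rewrite ltr1n ltnS; near: n; exact: nbhs_infty_gt.
apply: (@integral_itvcc_sub f g F) => // x /andP[xu _].
- by apply: cf; exact: lt_le_trans xu.
- by apply: cg; exact: lt_le_trans xu.
- by apply: dF; exact: lt_le_trans xu.
Unshelve. all: by end_near. Qed.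

Lemma integral_itvoy_FTC (f F : R -> R) (a l0 l : R) :
  (forall x, (a < x)%R -> (0 <= f x)%R) ->
  (forall x, (a < x)%R -> {for x, continuous f}) ->
  (forall x, (a < x)%R -> is_derive x (1:R)%R F (f x)) ->
  F x @[x --> a^'+] --> l0 -> F x @[x --> +oo%R] --> l ->
  \int[mu]_(x in `]a, +oo[) (f x)%:E = (l - l0)%:E.
Proof.
move=> f0 cf dF F0 Fy.
have : \int[mu]_(x in `]a, +oo[) (f x)%:E + l0%:E =
    \int[mu]_(x in `]a, +oo[) ((cst 0 x)%R)%:E + l%:E.
  apply: (integral_itvoy_sub f0 _ cf _ _ F0 Fy) => // x ax.
    exact: cst_continuous.
  by rewrite subr0; exact: dF.
rewrite [X in _ = X + _]integral0_eq // add0e => h.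
by move: h; case: (integral _ _ _) => [r| |] // [<-]; rewrite addrK.
Qed.

End HalfLine.

(** * Decay of powers against exponentials *)

Section PowerExp.
Variable R : realType.
Implicit Types (s c x : R).

Lemma is_derive_continuous (F : R -> R) x d :
  is_derive x (1 : R) F d -> {for x, continuous F}.
Proof. by move=> [dF _]; apply/differentiable_continuous/derivable1_diffP. Qed.

Lemma expRN_le_fact (x : R) m : 0 < x -> expR (- x) * x ^+ m.+1 <= m.+1`!%:R.
Proof.
move=> x0; rewrite expRN mulrC ler_pdivrMr ?expR_gt0 // mulrC.
have f0 : 0 < m.+1`!%:R :> R by rewrite ltr0n fact_gt0.
rewrite -ler_pdivrMr //.
by apply: le_trans (expR_ge1Dxn m (ltW x0)); rewrite lerDr.
Qed.

(** The exponent is rounded up to an integer, and the exponential is compared with the term of its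
    series one degree higher; the spare degree is the factor 1/x. *)
Lemma powR_expR_le s c x : 0 < c -> 1 <= x ->
  x `^ s * expR (- (c * x)) <=
    (Num.truncn s).+2`!%:R / c ^+ (Num.truncn s).+2 / x.
Proof.
move=> c0 x1; have x0 : 0 < x by apply: lt_le_trans x1.
have xs : x `^ s <= x ^+ (Num.truncn s).+1.
  rewrite -powR_mulrn ?(ltW x0) //; apply: ler_powR => //.
  by rewrite ltW // truncnS_gt.
apply: le_trans (ler_wpM2r (expR_ge0 _) xs) _.
rewrite ler_pdivlMr // ler_pdivlMr ?exprn_gt0 //.
apply: le_trans (expRN_le_fact (Num.truncn s).+1 (mulr_gt0 c0 x0)).
by rewrite exprMn [x ^+ (Num.truncn s).+2]exprS le_eqVlt; apply/orP; left; apply/eqP; ring.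
Qed.

Lemma cvgy_powR_expR s c : 0 < c ->
  x `^ s * expR (- (c * x)) @[x --> +oo] --> (0 : R).
Proof.
move=> c0; pose K := (Num.truncn s).+2`!%:R / c ^+ (Num.truncn s).+2.
have K0 : 0 < K by rewrite divr_gt0 ?exprn_gt0 // ltr0n fact_gt0.
apply/cvgrPdist_le => e e0; near=> x.
have x1 : 1 <= x by near: x; apply: nbhs_pinfty_ge; exact: num_real.
have x0 : 0 < x by apply: lt_le_trans x1.
rewrite sub0r normrN ger0_norm; last by rewrite mulr_ge0 ?powR_ge0 ?expR_ge0.
apply: le_trans (powR_expR_le s c0 x1) _.
by rewrite ler_pdivrMr // [e * x]mulrC -ler_pdivrMr.
Unshelve. all: by end_near. Qed.

Lemma cvg0_powR_expR s c : 0 < c ->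
  x `^ s * expR (- (c / x)) @[x --> 0^'+] --> (0 : R).
Proof.
move=> c0; pose K := (Num.truncn (- s)).+2`!%:R / c ^+ (Num.truncn (- s)).+2.
have K0 : 0 < K by rewrite divr_gt0 ?exprn_gt0 // ltr0n fact_gt0.
apply/cvgrPdist_le => e e0; near=> x.
have x0 : 0 < x by [].
have x1 : 1 <= x^-1.
  by rewrite invf_ge1 //; near: x; exact: nbhs_right_le.
rewrite sub0r normrN ger0_norm; last by rewrite mulr_ge0 ?powR_ge0 ?expR_ge0.
(* Inversion turns the behaviour at 0 into the bound at infinity, with exponent -s. *)
have -> : x `^ s = x^-1 `^ (- s).
  by rewrite -powR_inv1 ?ltW // -powRrM mulN1r opprK.
apply: le_trans (powR_expR_le (- s) c0 x1) _.
rewrite invrK -/K [K * x]mulrC -ler_pdivlMr //.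
by near: x; apply: nbhs_right_le; rewrite divr_gt0.
Unshelve. all: by end_near. Qed.

Lemma is_derive_powR_expR s x : 0 < x ->
  is_derive x (1 : R) (fun t => t `^ s * expR (- t))
    (s * x `^ (s - 1) * expR (- x) - x `^ s * expR (- x)).
Proof.
move=> x0; have d1 := is_derive1_powR s x0.
have d2 : is_derive x (1 : R) (fun t : R => expR (- t)) (- expR (- x)).
  by apply: is_derive_eq; rewrite mulrN1.
apply: is_derive_eq; rewrite /GRing.scale /=; ring.
Qed.

End PowerExp.

(** * Euler's integral: functional equation, positivity and finiteness *)

Section EulerGamma.
Variable R : realType.
Notation mu := (@lebesgue_measure R).
Local Open Scope ereal_scope.

(** With values in the extended reals the functional equation can be proved before finiteness, and
    finiteness is then deduced from it. *)
Definition eGamma (s : R) : \bar R :=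
  \int[mu]_(t in `]0%R, +oo[) (t `^ (s - 1) * expR (- t))%:E.

Lemma eGammaS (s : R) : (0 < s)%R -> eGamma (s + 1) = s%:E * eGamma s.
Proof.
move=> s0.
have cf r x : (0 < x)%R -> {for x, continuous (fun t : R => t `^ r * expR (- t))%R}.
  by move=> x0; apply: is_derive_continuous; exact: is_derive_powR_expR.
have -> : eGamma (s + 1) = \int[mu]_(t in `]0%R, +oo[) (t `^ s * expR (- t))%:E.
  by rewrite /eGamma addrK.
transitivity (\int[mu]_(t in `]0%R, +oo[) (s * (t `^ (s - 1) * expR (- t)))%:E);
    last first.
  rewrite /eGamma -ge0_integralZl_EFin //.
  - by move=> t _; rewrite lee_fin mulr_ge0 ?powR_ge0 ?expR_ge0.
  - by apply/measurable_EFinP; exact: measurable_itvoy (cf _).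
  - exact: ltW.
rewrite -[LHS]adde0 -[RHS]adde0.
apply: (@integral_itvoy_sub R _ _ (fun t => - (t `^ s * expR (- t)))%R).
- by move=> x _; rewrite mulr_ge0 ?powR_ge0 ?expR_ge0.
- by move=> x _; rewrite !mulr_ge0 ?powR_ge0 ?expR_ge0 // ltW.
- exact: cf.
- by move=> x x0; apply: continuousM; [exact: cst_continuous|exact: cf].
- move=> x x0; have d := is_derive_powR_expR s x0.
  by apply: is_derive_eq; ring.
- rewrite -[X in _ --> X]oppr0; apply: cvgN; rewrite -[X in _ --> X](mul0r (expR (- 0))).
  apply: cvgM; first exact: powR_cvg0.
  apply: cvg_at_right_filter.
  by apply: (is_derive_continuous (F := fun t : R => expR (- t)) (d := (- expR (- 0))%R));
     apply: is_derive_eq; rewrite mulrN1.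
- rewrite -[X in _ --> X]oppr0; apply: cvgN.
  under eq_fun do rewrite -[X in expR (- X)]mul1r.
  exact: cvgy_powR_expR.
Qed.

Lemma integral_expRN (c : R) : (0 < c)%R ->
  \int[mu]_(t in `]0%R, +oo[) (expR (- (c * t)))%:E = (c^-1)%:E.
Proof.
move=> c0.
have d x : is_derive x (1 : R)%R (fun t : R => - (c^-1 * expR (- (c * t))))%R (expR (- (c * x))).
  apply: is_derive_eq; rewrite /GRing.scale /=.
  by field; rewrite gt_eqF.
rewrite -[(c^-1)%R]opprK -[X in X%:E]add0r.
apply: (@integral_itvoy_FTC R _ (fun t => - (c^-1 * expR (- (c * t))))%R).
- by move=> x _; rewrite expR_ge0.
- move=> x _; apply: (is_derive_continuous (d := (- (c * expR (- (c * x))))%R)).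
  by apply: is_derive_eq; rewrite /GRing.scale /=; ring.
- apply: cvg_at_right_filter.
  rewrite [X in _ --> X](_ : _ = - (c^-1 * expR (- (c * 0))))%R.
    exact: (is_derive_continuous (d 0%R)).
  by rewrite mulr0 oppr0 expR0 mulr1.
- rewrite -[X in _ --> X]oppr0; apply: cvgN; rewrite -[X in _ --> X](mulr0 (c^-1)%R); apply: cvgM; first exact: cvg_cst.
  have := @cvgy_powR_expR R 0%R c c0.
  by under eq_fun do rewrite powRr0 mul1r.
Qed.

Lemma powR_le1D (s t : R) : (0 <= s <= 1)%R -> (0 < t)%R -> (t `^ s <= 1 + t)%R.
Proof.
move=> /andP[s0 s1] t0; have [t1|t1] := leP t 1%R.
  have : (t `^ s <= t `^ 0)%R by rewrite ger_powR ?t0.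
  by rewrite powRr0 => h; apply: le_trans h _; rewrite lerDl ltW.
have : (t `^ s <= t `^ 1)%R by rewrite ler_powR // ltW.
by rewrite powRr1 ?(ltW t0) // => h; apply: le_trans h _; rewrite lerDr.
Qed.

Lemma eGamma1 : eGamma 1 = 1.
Proof.
rewrite /eGamma -[RHS]/(1%:E) -[X in X%:E]invr1 -integral_expRN //.
by apply: eq_integral => t _; rewrite subrr powRr0 !mul1r.
Qed.

(** From t^(1-s) <= 1 + t <= exp(t) the integrand is at least exp(-2t), whose integral is 1/2. *)
Lemma eGamma_gt0 (s : R) : (0 < s <= 1)%R -> 0 < eGamma s.
Proof.
move=> /andP[s0 s1]; apply: (@lt_le_trans _ _ (2^-1)%:E); first by rewrite lte_fin invr_gt0.
rewrite -integral_expRN //; apply: ge0_le_integral => //.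
- apply/measurable_EFinP; apply: measurable_itvoy => x x0.
  apply: (is_derive_continuous (d := (- (2 * expR (- (2 * x))))%R)).
  by apply: is_derive_eq; rewrite /GRing.scale /=; ring.
- apply/measurable_EFinP; apply: measurable_itvoy => x x0.
  by apply: is_derive_continuous; exact: is_derive_powR_expR.
- move=> t /=; rewrite in_itv /= andbT => t0; rewrite lee_fin.
  have -> : expR (- (2 * t)) = (expR (- t) * expR (- t))%R.
    by rewrite -expRD; congr expR; ring.
  rewrite ler_pM2r ?expR_gt0 // -opprB powRN expRN lef_pV2 ?posrE ?expR_gt0 ?powR_gt0 //.
  apply: le_trans (expR_ge1Dx t); apply: powR_le1D => //.
  by rewrite subr_ge0 s1 lerBlDr lerDl ltW.
Qed.

(** Since t^s <= 1 + t, one has s Gamma(s) = Gamma(s+1) <= Gamma(1) + Gamma(2) = 2; the singularity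
    at 0 is never estimated directly. *)
Lemma eGamma_fin_num (s : R) : (0 < s <= 1)%R -> eGamma s \is a fin_num.
Proof.
move=> s01; have /andP[s0 s1] := s01.
have eG0 r : 0 <= eGamma r.
  by apply: integral_ge0 => t _; rewrite lee_fin mulr_ge0 ?powR_ge0 ?expR_ge0.
rewrite ge0_fin_numE //.
have : s%:E * eGamma s <= 2%:E.
  rewrite -eGammaS //; apply: (@le_trans _ _ (eGamma 1 + eGamma (1 + 1))); last first.
    by rewrite eGammaS // eGamma1 mule1 -EFinD.
  have me r : measurable_fun (`]0%R, +oo[%classic : set (measurableTypeR R))
      (fun t : R => (t `^ r * expR (- t))%:E).
    apply/measurable_EFinP; apply: measurable_itvoy => x x0.
    by apply: is_derive_continuous; exact: is_derive_powR_expR.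
  rewrite /eGamma -ge0_integralD //.
  + apply: ge0_le_integral => //.
    * by move=> t _; rewrite lee_fin mulr_ge0 ?powR_ge0 ?expR_ge0.
    * by apply: emeasurable_funD; exact: me.
    * move=> t /=; rewrite in_itv /= andbT => t0.
      rewrite -EFinD lee_fin !addrK subrr powRr0 powRr1 ?(ltW t0) // -mulrDl.
      by rewrite ler_pM2r ?expR_gt0 // powR_le1D // s1 ltW.
  + by move=> t _; rewrite lee_fin mulr_ge0 ?powR_ge0 ?expR_ge0.
  + by move=> t _; rewrite lee_fin mulr_ge0 ?powR_ge0 ?expR_ge0.
case: (eGamma s) => [r _| |] //; first exact: ltry.
by rewrite mulry gtr0_sg // mul1e.
Qed.

Lemma eGammaE (s : R) : (0 < s <= 1)%R -> eGamma s = (EulerGamma s)%:E.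
Proof.
move=> s01; rewrite /EulerGamma /Rintegral -/(eGamma s) fineK //.
exact: eGamma_fin_num.
Qed.

Lemma EulerGamma_gt0 (s : R) : (0 < s <= 1)%R -> (0 < EulerGamma s)%R.
Proof. by move=> s01; rewrite -lte_fin -eGammaE // eGamma_gt0. Qed.

Lemma eGammaD (s : R) k : (0 < s <= 1)%R ->
  eGamma (s + k%:R) = (poch s k * EulerGamma s)%:E.
Proof.
move=> s01; have /andP[s0 _] := s01.
elim: k => [|k ih]; first by rewrite addr0 eGammaE // /poch big_ord0 mul1r.
rewrite -natr1 addrA eGammaS ?ltr_pwDl // ih -EFinM pochS; congr EFin; ring.
Qed.

End EulerGamma.

(** * The Pade remainder *)

Lemma continuous_exprn (R : realType) (f : R -> R) n (x : R) :
  {for x, continuous f} -> {for x, continuous (fun y => f y ^+ n)}.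
Proof.
by move=> cf; apply: (@continuous_comp _ _ _ f (fun y => y ^+ n)) => //;
  exact: exprn_continuous.
Qed.

(** The partial fractions of the reciprocal of z(z-1)...(z-n). Pascal's rule reduces [n + 1] to the
    case [n] at z and at z - 1. *)
Lemma alt_binom_partial_fraction (F : fieldType) n (z : F) :
  (forall i, (i <= n)%N -> z - i%:R != 0) ->
  \sum_(k < n.+1) (-1) ^+ k * 'C(n, k)%:R / (z - k%:R) =
  (-1) ^+ n * n`!%:R / \prod_(i < n.+1) (z - i%:R).
Proof.
elim: n z => [|n ih] z z0.
  by rewrite !big_ord_recl !big_ord0 /= bin0 addr0 mulr1 fact0.
have ih1 := ih z (fun i hi => z0 i (leqW hi)).
have ih2 : \sum_(k < n.+1) (-1) ^+ k * 'C(n, k)%:R / (z - k.+1%:R) =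
    (-1) ^+ n * n`!%:R / \prod_(i < n.+1) (z - i.+1%:R).
  have := ih (z - 1); rewrite (eq_bigr (fun k : 'I_n.+1 =>
    (-1) ^+ k * 'C(n, k)%:R / (z - k.+1%:R))); last first.
    by move=> k _; rewrite -natr1; congr (_ / _); ring.
  have -> : \prod_(i < n.+1) (z - 1 - i%:R) = \prod_(i < n.+1) (z - i.+1%:R).
    by apply: eq_bigr => k _; rewrite -natr1; ring.
  by apply=> i hi; have := z0 i.+1 hi; rewrite -natr1 opprD addrA addrAC.
have -> : \sum_(k < n.+2) (-1) ^+ k * 'C(n.+1, k)%:R / (z - k%:R) =
   \sum_(k < n.+1) (-1) ^+ k * 'C(n, k)%:R / (z - k%:R) -
   \sum_(k < n.+1) (-1) ^+ k * 'C(n, k)%:R / (z - k.+1%:R).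
  rewrite big_ord_recl [X in _ = X - _]big_ord_recl /= !bin0 -addrA; congr (_ + _).
  have -> : \sum_(i < n) (-1) ^+ bump 0 i * 'C(n, bump 0 i)%:R / (z - (bump 0 i)%:R)
     = \sum_(i < n.+1) (-1) ^+ i.+1 * 'C(n, i.+1)%:R / (z - i.+1%:R).
    by rewrite [RHS]big_ord_recr /= bin_small // mulr0 mul0r addr0.
  rewrite -sumrB; apply: eq_bigr => i _; rewrite /bump /= add1n binS natrD exprS.
  ring.
rewrite ih1 ih2.
have -> : \prod_(i < n.+2) (z - i%:R) = z * \prod_(i < n.+1) (z - i.+1%:R).
  by rewrite big_ord_recl subr0; congr (_ * _); apply: eq_bigr.
have E : \prod_(i < n.+1) (z - i%:R) * (z - n.+1%:R) = z * \prod_(i < n.+1) (z - i.+1%:R).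
  rewrite -(big_ord_recr n.+1 (fun i => z - i%:R)) big_ord_recl subr0.
  by congr (_ * _); apply: eq_bigr.
set P := \prod_(i < n.+1) (z - i%:R) in E *.
set Q := \prod_(i < n.+1) (z - i.+1%:R) in E *.
have P0 : P != 0 by apply/prodf_neq0 => i _; apply: z0; rewrite ltnW.
have Q0 : Q != 0 by apply/prodf_neq0 => i _; apply: z0.
have z00 : z != 0 by have := z0 0 isT; rewrite subr0.
have zn : z - n.+1%:R != 0 by apply: z0.
have -> : P = z * Q / (z - n.+1%:R) by rewrite -E mulfK.
rewrite factS natrM -natr1 exprS; field.
by rewrite Q0 z00 /= natr1 zn.
Qed.

Definition pade (R : realType) (a : R) (n : nat) (t : R) : R :=
  \sum_(k < n.+1) gbinom (n%:R + a) k * gbinom (n%:R - a) (n - k) * t ^+ k.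

(** For a = 1/4 this is the c_n of the overview; it is the n-th partial product of Euler's product
    for sin(pi a)/pi. *)
Definition pade_const (R : realType) (a : R) (n : nat) : R :=
  a * \prod_(i < n) (i.+1%:R ^+ 2 - a ^+ 2) / n`!%:R ^+ 2.

Lemma pade_constN (R : realType) (a : R) n : pade_const (- a) n = - pade_const a n.
Proof.
rewrite /pade_const sqrrN !mulNr //.
Qed.

Section PadeRemainder.
Variables (R : realType) (a : R).
Hypothesis a_itv : 0 < `|a| < 1.

Lemma pade_shift_neq0 (l : nat) k : l%:R + a - k%:R != 0 :> R.
Proof.
case/andP: a_itv => a0 a1; rewrite addrAC; apply/eqP => h.
have {}h : a = (k%:Z - l%:Z)%:~R by rewrite intrB; lra.
move: a0 a1; rewrite h -intr_norm ltr0z ltrz1; lia.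
Qed.

Lemma pade_const_neq0 n : pade_const a n != 0.
Proof.
case/andP: a_itv => a0 _; rewrite normr_gt0 in a0.
apply: mulf_neq0; last by rewrite invr_neq0 // expf_neq0 // pnatr_eq0 -lt0n fact_gt0.
apply: mulf_neq0 => //; apply/prodf_neq0 => i _; rewrite subr_sqr mulf_neq0 //.
  have := pade_shift_neq0 0 i.+1; rewrite add0r => h.
  by rewrite -opprB oppr_eq0.
by have := pade_shift_neq0 i.+1 0; rewrite subr0.
Qed.

(** The last factor on the left is the value of a partial fraction sum at z = l + a. The identity
    thus recognises the coefficients found by termwise integration as those of the Pade polynomials.
    By induction: both sides change by the same rational factor when [l] increases. *)
Lemma pade_coefE n l : (l <= n)%N ->
  pade_const a n * (-1) ^+ l * 'C(n, l)%:R *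
    ((-1) ^+ n * n`!%:R / \prod_(i < n.+1) (l%:R + a - i%:R)) =
  gbinom (n%:R - a) l * gbinom (n%:R + a) (n - l).
Proof.
have f0 m : m`!%:R != 0 :> R by rewrite pnatr_eq0 -lt0n fact_gt0.
elim: l => [_|l ih ln].
  have P0 : \prod_(i < n.+1) (a - i%:R) != 0.
    by apply/prodf_neq0 => i _; have := pade_shift_neq0 0 i; rewrite add0r.
  rewrite subn0 bin0 /gbinom !big_ord0 /= fact0 expr0 !mulr1 add0r divr1 mul1r.
  have -> : \prod_(i < n) (n%:R + a - i%:R) = \prod_(i < n) (i.+1%:R + a).
    rewrite -(big_mkord xpredT (fun i => n%:R + a - i%:R)) big_nat_rev /= add0n.
    rewrite big_mkord; apply: eq_bigr => i _.
    by rewrite natrB // -natr1; ring.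
  move: P0; rewrite big_ord_recl /= subr0 /pade_const => P0.
  have -> : \prod_(i < n) (i.+1%:R ^+ 2 - a ^+ 2) =
     \prod_(i < n) (i.+1%:R + a) * ((-1) ^+ n * \prod_(i < n) (a - (lift ord0 i)%:R)).
    rewrite -[X in (-1) ^+ X]card_ord -prodrN -big_split /=.
    by apply: eq_bigr => i _; rewrite /bump add1n; ring.
  move: P0; set P := \prod_(i < n) (a - _); set Q := \prod_(i < n) _.
  rewrite mulf_eq0 negb_or => /andP[a0 P0].
  have s : (-1) ^+ n * (-1) ^+ n = 1 :> R by rewrite -exprMn mulrNN mulr1 expr1n.
  transitivity (((-1) ^+ n * (-1) ^+ n) * Q / n`!%:R).
    by field; rewrite f0 P0 a0.
  by rewrite s mul1r.
have e := ih (ltnW ln).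
have l0 : l.+1%:R != 0 :> R by rewrite pnatr_eq0.
have la : l.+1%:R + a != 0 by have := pade_shift_neq0 l.+1 0; rewrite subr0.
apply: (mulIf l0); apply: (mulIf la).
transitivity ((pade_const a n * (-1) ^+ l * 'C(n, l)%:R *
    ((-1) ^+ n * n`!%:R / \prod_(i < n.+1) (l%:R + a - i%:R))) *
    ((n%:R - l%:R) * (n%:R - a - l%:R))).
  have -> : \prod_(i < n.+1) (l.+1%:R + a - i%:R) = (l.+1%:R + a) *
      \prod_(i < n) (l%:R + a - i%:R).
    rewrite big_ord_recl /= subr0; congr (_ * _).
    by apply: eq_bigr => i _; rewrite /bump add1n -!natr1; ring.
  rewrite [in RHS]big_ord_recr /=.
  have P0 : \prod_(i < n) (l%:R + a - i%:R) != 0.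
    by apply/prodf_neq0 => i _; exact: pade_shift_neq0.
  have c : 'C(n, l.+1)%:R * l.+1%:R = 'C(n, l)%:R * (n%:R - l%:R) :> R.
    by rewrite -natrB ?(ltnW ln) // -!natrM mulnC mul_bin_left mulnC.
  have n0 := pade_shift_neq0 l n.
  transitivity (pade_const a n * (-1) ^+ l.+1 * ('C(n, l.+1)%:R * l.+1%:R) *
    ((-1) ^+ n * n`!%:R / \prod_(i < n) (l%:R + a - i%:R))).
    by field; rewrite P0 /= nat1r.
  by rewrite c exprS; field; rewrite P0 n0.
rewrite e.
have g1 := gbinomS (n%:R - a) l.
have g2 := gbinomS (n%:R + a) (n - l.+1).
have nl : (n - l.+1)%:R = n%:R - l.+1%:R :> R by rewrite natrB.
move: g2; rewrite -subSn // subSS nl natrB 1?ltnW // => g2.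
transitivity ((gbinom (n%:R - a) l * (n%:R - a - l%:R)) *
  (gbinom (n%:R + a) (n - l) * (n%:R - l%:R))); first by ring.
by rewrite -g1 g2; ring.
Qed.

End PadeRemainder.

Section PadeIntegral.
Variables (R : realType) (a : R).
Hypothesis a_itv : 0 < `|a| < 1.

(** Both n-th powers of the kernel are expanded and integrated termwise; as [a] is not an integer,
    no exponent l + a - k is zero and no logarithm appears. *)
Let pade_primitive (n : nat) (t x : R) : R :=
  \sum_(k < n.+1) \sum_(l < n.+1)
    (-1) ^+ (k + l) * 'C(n, k)%:R * 'C(n, l)%:R * t ^+ k
    / (l%:R + a - k%:R) * x `^ (l%:R + a - k%:R).

Lemma pade_kernelE n (t x : R) : 0 < x ->
  (t - x) ^+ n * (x - 1) ^+ n * x `^ (a - n%:R - 1) =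
  \sum_(k < n.+1) \sum_(l < n.+1)
    (-1) ^+ (k + l) * 'C(n, k)%:R * 'C(n, l)%:R * t ^+ k
    * x `^ (l%:R + a - k%:R - 1).
Proof.
move=> x0.
have -> : (t - x) ^+ n * (x - 1) ^+ n = (x - t) ^+ n * (1 - x) ^+ n.
  by rewrite -!exprMn; congr (_ ^+ n); ring.
rewrite (exprBn x) exprBn mulr_suml mulr_suml; apply: eq_bigr => k _.
rewrite mulr_sumr mulr_suml; apply: eq_bigr => l _.
rewrite expr1n exprD -[_ *+ 'C(n, k)]mulr_natr -[_ *+ 'C(n, l)]mulr_natr.
have -> : l%:R + a - k%:R - 1 = (n - k)%:R + (l%:R + (a - n%:R - 1)) :> R.
  by rewrite natrB ?leq_ord //; ring.
have xn : x != 0 by rewrite gt_eqF.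
rewrite [x `^ (_%:R + _)]powRD ?xn ?implybT // [x `^ (_%:R + _)]powRD ?xn ?implybT //.
rewrite !powR_mulrn ?(ltW x0) //; ring.
Qed.

Lemma is_derive_pade_primitive n (t x : R) : 0 < x ->
  is_derive x (1 : R) (pade_primitive n t)
    ((t - x) ^+ n * (x - 1) ^+ n * x `^ (a - n%:R - 1)).
Proof.
move=> x0; rewrite pade_kernelE //.
have -> : pade_primitive n t = \sum_(k < n.+1) \sum_(l < n.+1) (fun x =>
    (-1) ^+ (k + l) * 'C(n, k)%:R * 'C(n, l)%:R * t ^+ k
    / (l%:R + a - k%:R) * x `^ (l%:R + a - k%:R)).
  by apply/funext => y; rewrite fct_sumE; apply: eq_bigr => k _; rewrite fct_sumE.
apply: is_derive_sum => k; apply: is_derive_sum => l.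
have d := is_derive1_powR (l%:R + a - k%:R) x0.
apply: is_derive_eq; rewrite /GRing.scale /=.
by field; exact: pade_shift_neq0.
Qed.

Lemma pade_remainder n (t : R) : 1 < t ->
  (\int[@lebesgue_measure R]_(x in `[1%R, t])
     ((t - x) ^+ n * (x - 1) ^+ n * x `^ (a - n%:R - 1))%:E =
   ((t `^ a * pade (- a) n t - pade a n t) / pade_const a n)%:E)%E.
Proof.
move=> t1; have t0 : 0 < t by apply: lt_trans t1.
have aN : 0 < `|- a| < 1 by rewrite normrN.
have c0 : pade_const a n != 0 by exact: pade_const_neq0.
have dP x : (1 <= x <= t) -> is_derive x (1 : R) (pade_primitive n t)
    ((t - x) ^+ n * (x - 1) ^+ n * x `^ (a - n%:R - 1) - cst (0 : R) x).
  move=> /andP[x1 _]; rewrite subr0; apply: is_derive_pade_primitive.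
  exact: lt_le_trans x1.
have := integral_itvcc_sub t1 _ _ dP.
rewrite [X in _ = (X + _)%E]integral0_eq // add0e => h.
have {}h : (\int[@lebesgue_measure R]_(x in `[1%R, t])
     ((t - x) ^+ n * (x - 1) ^+ n * x `^ (a - n%:R - 1))%:E +
   (pade_primitive n t 1)%:E = (pade_primitive n t t)%:E)%E.
  apply: h => x /andP[x1 _]; last exact: cst_continuous.
  have x0 : 0 < x by apply: lt_le_trans x1.
  have d := is_derive1_powR (a - n%:R - 1) x0.
  apply: continuousM; last exact: is_derive_continuous d.
  apply: continuousM; apply: continuous_exprn.
    by apply: continuousB; [exact: cst_continuous|exact: cvg_id].
  by apply: continuousB; [exact: cvg_id|exact: cst_continuous].
(* At x = t the terms combine to t^(l+a), and the sum over [k] is the partial fraction at l + a. *)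
have Pt : pade_primitive n t t = t `^ a * pade (- a) n t / pade_const a n.
  rewrite /pade_primitive exchange_big /= /pade mulr_sumr mulr_suml.
  apply: eq_bigr => l _.
  have ln : (l <= n)%N by rewrite leq_ord.
  rewrite opprK -(pade_coefE a_itv ln) -alt_binom_partial_fraction; last first.
    by move=> i _; exact: pade_shift_neq0.
  rewrite mulr_sumr mulr_suml mulr_sumr mulr_suml; apply: eq_bigr => k _.
  have tn : t != 0 by rewrite gt_eqF.
  have -> : t `^ (l%:R + a - k%:R) = t ^+ l * t `^ a / t ^+ k.
    rewrite powRB ?tn ?implybT // powRD ?tn ?implybT // !powR_mulrn ?(ltW t0) //.
  have l0 := pade_shift_neq0 a_itv l k.
  by rewrite exprD; field; rewrite c0 l0 /= expf_neq0.
(* At x = 1 it is the sum over [l] that becomes a partial fraction, at k - a; the change of sign is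
   absorbed by the oddness of [pade_const]. *)
have P1 : pade_primitive n t 1 = pade a n t / pade_const a n.
  rewrite /pade_primitive /pade mulr_suml; apply: eq_bigr => k _.
  have kn : (k <= n)%N by rewrite leq_ord.
  have := pade_coefE aN kn; rewrite opprK => <-.
  rewrite -alt_binom_partial_fraction; last by move=> i _; exact: pade_shift_neq0.
  rewrite pade_constN mulr_sumr mulr_suml mulr_suml; apply: eq_bigr => l _.
  have l0 := pade_shift_neq0 a_itv l k.
  have l1 := pade_shift_neq0 aN k l.
  by rewrite exprD powR1 mulr1; field; rewrite c0 l0 l1.
move: h; rewrite Pt P1; case: (integral _ _ _) => [r| |] //.
by rewrite -EFinD => -[h]; congr EFin; rewrite mulrBl -h; ring.
Qed.

End PadeIntegral.

Lemma continuous_sumr (R : realType) (I : Type) (r : seq I) (f : I -> R -> R) (x : R) :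
  (forall i, {for x, continuous (f i)}) ->
  {for x, continuous (fun y => \sum_(i <- r) f i y)}.
Proof.
move=> cf; elim: r => [|i r ih].
  rewrite (_ : (fun y => _) = cst 0); first exact: cst_continuous.
  by apply/funext => y; rewrite big_nil.
rewrite (_ : (fun y => _) = f i \+ (fun y => \sum_(j <- r) f j y)).
  exact: continuousD.
by apply/funext => y; rewrite big_cons.
Qed.

Lemma bin_le_exp2 m i : ('C(m, i) <= 2 ^ m)%N.
Proof.
elim: m i => [|m ih] [|i]; rewrite ?bin0 ?bin0n ?expn_gt0 //.
by rewrite binS expnS mul2n -addnn leq_add.
Qed.

Section PadeBounds.
Variables (R : realType) (a : R).
Hypothesis a_itv : -1 <= a <= 1.

(** For k < n the next numerator n + a - k lies between 0 and n + 1 - k, so each step grows no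
    faster than that of the integer binomial. *)
Lemma gbinom_ge0_le n k : (k <= n)%N ->
  0 <= gbinom (n%:R + a) k <= 'C(n.+1, k)%:R.
Proof.
case/andP: a_itv => al au.
elim: k => [_|k ih kn]; first by rewrite /gbinom big_ord0 fact0 divr1 bin0 ler01 lexx.
have /andP[h1 h2] := ih (ltnW kn).
have k0 : 0 < k.+1%:R :> R by rewrite ltr0n.
have nk : 1 <= n%:R - k%:R :> R by rewrite -natrB ?(ltnW kn) // ler1n subn_gt0.
have e := gbinomS (n%:R + a) k.
have c : 'C(n.+1, k.+1)%:R * k.+1%:R = 'C(n.+1, k)%:R * (n%:R + 1 - k%:R) :> R.
  rewrite natr1 -natrB ?(leq_trans (ltnW kn)) // -!natrM mulnC mul_bin_left mulnC.
  by [].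
apply/andP; split.
  by rewrite -(pmulr_lge0 _ k0) e mulr_ge0 //; lra.
rewrite -(ler_pM2r k0) e c; apply: ler_pM => //; lra.
Qed.

End PadeBounds.

Section PadeRemainderBounds.
Variables (R : realType) (a : R).
Hypothesis a_itv : -1 <= a <= 1.

Let aN_itv : -1 <= - a <= 1.
Proof. by move: a_itv => /andP[? ?]; apply/andP; split; lra. Qed.

Lemma pade_coef_ge0 n (k : 'I_n.+1) :
  0 <= gbinom (n%:R + a) k * gbinom (n%:R - a) (n - k).
Proof.
have /andP[h1 _] := gbinom_ge0_le a_itv (leq_ord k).
have /andP[h2 _] := gbinom_ge0_le aN_itv (leq_subr k n).
by rewrite mulr_ge0.
Qed.

Lemma pade_ge0 n (t : R) : 0 <= t -> 0 <= pade a n t.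
Proof.
by move=> t0; apply: sumr_ge0 => k _; rewrite mulr_ge0 ?exprn_ge0 // pade_coef_ge0.
Qed.

(** Termwise comparison followed by Vandermonde's convolution bounds the sum by C(2n+2, n). *)
Lemma pade_le n (t : R) : 0 <= t <= 1 -> pade a n t <= 4 ^+ n.+1.
Proof.
move=> /andP[t0 t1].
have -> : 4 ^+ n.+1 = (2 ^ (n.+1 + n.+1))%:R :> R.
  by rewrite addnn -mul2n expnM natrX.
apply: (@le_trans _ _ 'C(n.+1 + n.+1, n)%:R); last by rewrite ler_nat bin_le_exp2.
rewrite -binomial.Vandermonde natr_sum; apply: ler_sum => k _.
have /andP[h1 h1'] := gbinom_ge0_le a_itv (leq_ord k).
have /andP[h2 h2'] := gbinom_ge0_le aN_itv (leq_subr k n).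
rewrite -[leRHS]mulr1 natrM.
apply: ler_pM; [exact: mulr_ge0|exact: exprn_ge0|exact: ler_pM|].
by rewrite exprn_ile1.
Qed.

End PadeRemainderBounds.

(** * Gamma integrals of the Pade polynomials *)

Section PadeGamma.
Variable R : realType.
Notation mu := (@lebesgue_measure R).
Local Open Scope ereal_scope.

Lemma continuous_powR_expR_pade (s a : R) n (x : R) : (0 < x)%R ->
  {for x, continuous (fun t => t `^ s * expR (- t) * pade a n t)%R}.
Proof.
move=> x0; apply: continuousM.
  by apply: is_derive_continuous; exact: is_derive_powR_expR.
rewrite /pade; apply: continuous_sumr => k.
by apply: continuousM; [exact: cst_continuous|apply: continuous_exprn; exact: cvg_id].
Qed.

(** The monomial t^k yields Gamma(s+n+k) = (s)_(n+k) Gamma(s): this is the origin of the Pochhammer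
    factors of [p] and [q]. *)
Lemma integral_powR_expR_pade (s a : R) n : (0 < s <= 1)%R -> (-1 <= a <= 1)%R ->
  \int[mu]_(t in `]0%R, +oo[) (t `^ (s + n%:R - 1) * expR (- t) * pade a n t)%:E =
  (EulerGamma s * \sum_(k < n.+1) hterm a s n k)%:E.
Proof.
move=> s01 a1; have /andP[s0 _] := s01.
transitivity (\int[mu]_(t in `]0%R, +oo[) \sum_(k < n.+1)
   ((gbinom (n%:R + a) k * gbinom (n%:R - a) (n - k))%:E *
    (t `^ (s + (n + k)%:R - 1) * expR (- t))%:E)).
  apply: eq_integral => t; rewrite inE /= in_itv /= andbT => t0.
  rewrite /pade mulr_sumr -sumEFin; apply: eq_bigr => k _; rewrite -EFinM.
  have -> : (s + (n + k)%:R - 1 = (s + n%:R - 1) + k%:R)%R by rewrite natrD; ring.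
  by rewrite [(t `^ (_ + _%:R))%R]powRD ?(gt_eqF t0) ?implybT // powR_mulrn ?(ltW t0) //; congr EFin; ring.
have mf r : measurable_fun (`]0%R, +oo[%classic : set (measurableTypeR R))
      (fun t : R => (t `^ r * expR (- t))%:E).
  apply/measurable_EFinP; apply: measurable_itvoy => x x0.
  by apply: is_derive_continuous; exact: is_derive_powR_expR.
rewrite ge0_integral_sum //; first last.
- by move=> k t _; rewrite mule_ge0 // lee_fin ?pade_coef_ge0 ?mulr_ge0 ?powR_ge0 ?expR_ge0.
- by move=> k; apply: measurable_funeM; exact: mf.
rewrite mulr_sumr -sumEFin; apply: eq_bigr => k _.
rewrite ge0_integralZl_EFin //; last by rewrite pade_coef_ge0.
  by rewrite -[X in _ * X]/(eGamma (s + (n + k)%:R)) eGammaD // -EFinM /hterm; congr EFin; ring.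
by move=> t _; rewrite lee_fin mulr_ge0 ?powR_ge0 ?expR_ge0.
Qed.

Lemma integral_itvoc01_pade (s a : R) n : (0 <= s)%R -> (-1 <= a <= 1)%R ->
  \int[mu]_(t in `]0%R, 1%R]) (t `^ s * expR (- t) * pade a n t)%:E <= (4 ^+ n.+1)%:E.
Proof.
move=> s0 a1.
apply: (@le_trans _ _ (\int[mu]_(t in `]0%R, 1%R]) (cst (4 ^+ n.+1)%:E) t)).
  apply: ge0_le_integral => //.
  - move=> t /=; rewrite in_itv /= => /andP[t0 t1].
    by rewrite lee_fin !mulr_ge0 ?powR_ge0 ?expR_ge0 ?pade_ge0 // ltW.
  - have cf := @continuous_powR_expR_pade s a n.
    apply/measurable_EFinP; apply: measurable_funS (measurable_itvoy cf) => //.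
    by move=> t /=; rewrite !in_itv /= => /andP[-> _].
  - move=> t /=; rewrite in_itv /= => /andP[t0 t1].
    rewrite lee_fin -[leRHS]mul1r; apply: ler_pM.
    + by rewrite mulr_ge0 ?powR_ge0 ?expR_ge0.
    + by rewrite pade_ge0 // ltW.
    + rewrite -[leRHS]mul1r; apply: ler_pM; rewrite ?powR_ge0 ?expR_ge0 //.
        have : (t `^ s <= 1 `^ s)%R by apply: ge0_ler_powR; rewrite ?nnegrE // ltW.
        by rewrite powR1.
      by rewrite expR_le1 oppr_le0 ltW.
    + by rewrite pade_le // ltW.
rewrite integral_cst //= lebesgue_measure_itv /= lte_fin ltr01 oppr0 adde0.
by rewrite mule1.
Qed.

End PadeGamma.

(** * The linear form in two Gamma values as a double integral *)

Section RemainderIntegral.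
Variable R : realType.
Notation mu := (@lebesgue_measure R).
Local Open Scope ereal_scope.

Lemma integralT_support (D : set (measurableTypeR R)) (f : R -> \bar R) :
  (forall x, ~ D x -> f x = 0) -> \int[mu]_x f x = \int[mu]_(x in D) f x.
Proof.
move=> f0; rewrite [RHS]integral_mkcond; apply: eq_integral => x _.
by rewrite patchE; case: ifPn => // /negP xD; apply: f0; rewrite inE in xD.
Qed.

(** The truncations make the kernel vanish off 1 < x < t when n > 0, so Tonelli's theorem applies on
    the whole plane and the domains are restored afterwards. *)
Definition rem_kernel (s r : R) n (t x : R) : R :=
  (t `^ s * expR (- t) * Num.max 0 (t - x) ^+ n *
    (Num.max 0 (x - 1) ^+ n * x `^ r))%R.

Lemma rem_kernel_ge0 s r n t x : (0 <= rem_kernel s r n t x)%R.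
Proof.
by rewrite /rem_kernel !mulr_ge0 ?powR_ge0 ?expR_ge0 ?exprn_ge0 // le_max lexx.
Qed.

Lemma rem_kernel_eq0 s r n t x : (0 < n)%N -> (t <= x)%R || (x <= 1)%R ->
  rem_kernel s r n t x = 0%R.
Proof.
move=> n0; rewrite /rem_kernel => /orP[h|h].
  by rewrite (max_idPl _) ?subr_le0 // expr0n gtn_eqF // mulr0 mul0r.
by rewrite [(Num.max 0 (x - 1))%R](max_idPl _) ?subr_le0 // expr0n gtn_eqF // mul0r mulr0.
Qed.

Lemma measurable_rem_kernel s r n :
  measurable_fun setT (fun z : R * R => (rem_kernel s r n z.1 z.2)%:E).
Proof.
apply/measurable_EFinP; rewrite /rem_kernel.
have m1 : measurable_fun setT (fun z : R * R => z.1) by exact: measurable_fst.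
have m2 : measurable_fun setT (fun z : R * R => z.2) by exact: measurable_snd.
have c (f : R * R -> R) : measurable_fun setT f -> measurable_fun setT (fun z : R * R => Num.max 0 (f z) ^+ n)%R.
  move=> mf; apply: measurable_funX; apply: measurable_maxr => //.
apply: measurable_funM.
  apply: measurable_funM; last by apply: c; exact: measurable_funB.
  apply: measurable_funM.
    exact: (measurableT_comp (measurable_powR s) m1).
  by apply: measurableT_comp => //; exact: measurableT_comp.
apply: measurable_funM; first by apply: c; exact: measurable_funB.
exact: (measurableT_comp (measurable_powR r) m2).
Qed.

Lemma rem_kernel_tonelli s r n : (0 < n)%N ->
  \int[mu]_(t in `]1%R, +oo[) \int[mu]_(x in `[1%R, t]) (rem_kernel s r n t x)%:E =
  \int[mu]_(x in `]0%R, +oo[) \int[mu]_(t in `](x / 2)%R, +oo[) (rem_kernel s r n t x)%:E.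
Proof.
move=> n0.
transitivity (\int[mu]_t \int[mu]_x (rem_kernel s r n t x)%:E).
  rewrite (@integralT_support `]1%R, +oo[%classic); last first.
    move=> t /=; rewrite in_itv /= andbT => /negP; rewrite -leNgt => t1.
    apply: integral0_eq => x _; rewrite rem_kernel_eq0 //.
    by have [//|/ltW x1] := leP t x; rewrite (le_trans x1 t1).
  apply: eq_integral => t _; symmetry; apply: integralT_support => x /=.
  rewrite in_itv /= => /negP; rewrite negb_and -!ltNge => h; congr EFin.
  by apply: rem_kernel_eq0 => //; case/orP: h => /ltW ->; rewrite ?orbT.
transitivity (\int[mu]_x \int[mu]_t (rem_kernel s r n t x)%:E).
  apply: (@fubini_tonelli _ _ _ _ _ mu mu (fun z : R * R => (rem_kernel s r n z.1 z.2)%:E)).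
    exact: measurable_rem_kernel.
  by move=> z; rewrite lee_fin rem_kernel_ge0.
rewrite (@integralT_support `]0%R, +oo[%classic); last first.
  move=> x /=; rewrite in_itv /= andbT => /negP; rewrite -leNgt => x0.
  apply: integral0_eq => t _; rewrite rem_kernel_eq0 //.
  by rewrite (le_trans x0 ler01) orbT.
apply: eq_integral => x; rewrite inE /= in_itv /= andbT => x0.
apply: integralT_support => t /=.
rewrite in_itv /= andbT => /negP; rewrite -leNgt => tx.
rewrite rem_kernel_eq0 //; apply/orP; left; apply: le_trans tx _.
by lra.
Qed.

(* The kernel vanishes unless [1 <= x <= t]; the lower bound [x / 2] for [t] is that of
   the shifted variable [t - x / 2] which carries the Gamma density. *)
Definition rem_integral (n : nat) : \bar R :=
  \int[mu]_(x in `]0%R, +oo[) \int[mu]_(t in `](x / 2)%R, +oo[)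
    (rem_kernel (n%:R - 3 / 4) (- n%:R - 3 / 4) n t x)%:E.

Lemma pade_const_gt0 n : (0 < pade_const (1 / 4 : R) n)%R.
Proof.
apply: mulr_gt0; last by rewrite invr_gt0 exprn_gt0 // ltr0n fact_gt0.
apply: mulr_gt0; first by lra.
apply: prodr_gt0 => i _; have i0 : (1 <= i.+1%:R :> R)%R by rewrite ler1n.
by nra.
Qed.

(** The remainder formula is used for t > 1 only; [A] and [B] are the parts of the P and Q integrals
    over t <= 1. The identity is additive because [rem_integral] is still an extended real. *)
Lemma EulerGamma_remainder n : (0 < n)%N ->
  exists2 A : R, (0 <= A <= 4 ^+ n.+1)%R & exists2 B : R, (0 <= B <= 4 ^+ n.+1)%R &
  (EulerGamma (1 / 2) * q R n + A)%:E =
  (EulerGamma (1 / 4) * p R n + B)%:E + (pade_const (1 / 4) n)%:E * rem_integral n.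
Proof.
move=> n0.
have h2 : (0 < (1 / 2 : R) <= 1)%R by lra.
have h4 : (0 < (1 / 4 : R) <= 1)%R by lra.
have a1 : (-1 <= (1 / 4 : R) <= 1)%R by lra.
have a2 : (-1 <= - (1 / 4 : R) <= 1)%R by lra.
have a3 : (0 < `|1 / 4 : R| < 1)%R by rewrite ger0_norm; lra.
have n1 : (1 <= n%:R :> R)%R by rewrite ler1n.
pose wq (t : R) : \bar R := (t `^ (1 / 2 + n%:R - 1) * expR (- t) * pade (- (1 / 4)) n t)%:E.
pose wp (t : R) : \bar R := (t `^ (1 / 4 + n%:R - 1) * expR (- t) * pade (1 / 4) n t)%:E.
have cf s a x : (0 < x)%R ->
  {for x, continuous (fun t => t `^ s * expR (- t) * pade a n t)%R}.
  exact: continuous_powR_expR_pade.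
have w0 s a t : (-1 <= a <= 1)%R -> (0 < t)%R -> (0 <= t `^ s * expR (- t) * pade a n t)%R.
  by move=> ha t0; rewrite !mulr_ge0 ?powR_ge0 ?expR_ge0 ?pade_ge0 // ltW.
have Iq : \int[mu]_(t in `]0%R, +oo[) wq t = (EulerGamma (1 / 2) * q R n)%:E.
  by rewrite integral_powR_expR_pade // qE.
have Ip : \int[mu]_(t in `]0%R, +oo[) wp t = (EulerGamma (1 / 4) * p R n)%:E.
  by rewrite integral_powR_expR_pade // pE.
have split s a : (-1 <= a <= 1)%R ->
  \int[mu]_(t in `]0%R, +oo[) (t `^ s * expR (- t) * pade a n t)%:E =
  \int[mu]_(t in `]0%R, 1%R]) (t `^ s * expR (- t) * pade a n t)%:E +
  \int[mu]_(t in `]1%R, +oo[) (t `^ s * expR (- t) * pade a n t)%:E.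
  move=> ha; have E : `]0%R, +oo[%classic = `]0%R, 1%R]%classic `|` `]1%R, +oo[%classic :> set R.
    by rewrite -itv_bndbnd_setU // bnd_simp.
  rewrite E ge0_integral_setU //.
  - rewrite -E; apply/measurable_EFinP; apply: measurable_itvoy; exact: cf.
  - by move=> t; rewrite -E /= in_itv /= andbT => t0; rewrite lee_fin w0.
  - apply/disj_setPS => t [] /=; rewrite !in_itv /= andbT => /andP[_ t1].
    by rewrite ltNge t1.
have small s a : (0 <= s)%R -> (-1 <= a <= 1)%R -> exists2 A : R, (0 <= A <= 4 ^+ n.+1)%R &
   \int[mu]_(t in `]0%R, 1%R]) (t `^ s * expR (- t) * pade a n t)%:E = A%:E.
  move=> s0 ha; have := integral_itvoc01_pade n s0 ha.
  have : 0 <= \int[mu]_(t in `]0%R, 1%R]) (t `^ s * expR (- t) * pade a n t)%:E.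
    apply: integral_ge0 => t /=; rewrite in_itv /= => /andP[t0 _].
    by rewrite lee_fin w0.
  case: (integral _ _ _) => [r| |] //; rewrite !lee_fin => r0 r1.
  by exists r => //; rewrite r0.
have [|B Bn EB] := small (1 / 2 + n%:R - 1)%R (- (1 / 4))%R _ a2; first by lra.
have [|A An EA] := small (1 / 4 + n%:R - 1)%R (1 / 4)%R _ a1; first by lra.
exists A => //; exists B => //.
have big : \int[mu]_(t in `]1%R, +oo[) wq t =
    \int[mu]_(t in `]1%R, +oo[) wp t + (pade_const (1 / 4) n)%:E * rem_integral n.
  rewrite /rem_integral -rem_kernel_tonelli //.
  have c0 := pade_const_gt0 n.
  have inner t : (1 < t)%R -> \int[mu]_(x in `[1%R, t])
      (rem_kernel (n%:R - 3 / 4) (- n%:R - 3 / 4) n t x)%:E =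
      (t `^ (n%:R - 3 / 4) * expR (- t) * ((t `^ (1 / 4) * pade (- (1 / 4)) n t
        - pade (1 / 4) n t) / pade_const (1 / 4) n))%:E.
    move=> t1; rewrite [RHS]EFinM -pade_remainder //.
    rewrite -ge0_integralZl_EFin //.
    - apply: eq_integral => x; rewrite inE /= in_itv /= => /andP[x1 xt].
      rewrite -EFinM /rem_kernel !(max_idPr _) ?subr_ge0 //.
      by congr EFin; rewrite (_ : 1 / 4 - n%:R - 1 = - n%:R - 3 / 4)%R; [ring|lra].
    - move=> x /=; rewrite in_itv /= => /andP[x1 xt].
      by rewrite lee_fin !mulr_ge0 ?powR_ge0 ?exprn_ge0 ?subr_ge0.
    - apply/measurable_EFinP; apply: measurable_funTS.
      apply: measurable_funM; last exact: measurable_powR.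
      apply: measurable_funM; apply: measurable_funX; exact: measurable_funB.
    - by rewrite mulr_ge0 ?powR_ge0 ?expR_ge0.
  have I0 t : 0 <= \int[mu]_(x in `[1%R, t])
      (rem_kernel (n%:R - 3 / 4) (- n%:R - 3 / 4) n t x)%:E.
    by apply: integral_ge0 => x _; rewrite lee_fin rem_kernel_ge0.
  have mI : measurable_fun (`]1%R, +oo[%classic : set (measurableTypeR R))
     (fun t => \int[mu]_(x in `[1%R, t])
      (rem_kernel (n%:R - 3 / 4) (- n%:R - 3 / 4) n t x)%:E).
    apply: (eq_measurable_fun (fun t => (t `^ (n%:R - 3 / 4) * expR (- t) * ((t `^ (1 / 4) * pade (- (1 / 4)) n t
        - pade (1 / 4) n t) / pade_const (1 / 4) n))%:E)).
      by move=> t; rewrite inE /= in_itv /= andbT => t1; rewrite inner.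
    apply/measurable_EFinP; apply: measurable_itvoy => t t1.
    have t0 : (0 < t)%R by apply: lt_trans t1.
    have cp a : {for t, continuous (pade a n)}.
      apply: continuous_sumr => k; apply: continuousM; first exact: cst_continuous.
      by apply: continuous_exprn; exact: cvg_id.
    apply: continuousM; first by apply: is_derive_continuous; exact: is_derive_powR_expR.
    apply: continuousM; last exact: cst_continuous.
    apply: continuousB; last exact: cp.
    apply: continuousM; last exact: cp.
    by apply: is_derive_continuous; exact: is_derive1_powR.
  rewrite -ge0_integralZl //; last by rewrite lee_fin ltW.
  rewrite -ge0_integralD //.
  - apply: eq_integral => t; rewrite inE /= in_itv /= andbT => t1.
    rewrite inner // /wq /wp -EFinM -EFinD; congr EFin.
    have t0 : (0 < t)%R by apply: lt_trans t1.
    (* The factor t^(1/4) in front of Q(t) turns the common weight into the one that belongs to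
       Gamma(1/2). *)
    have -> : (1 / 2 + n%:R - 1 = (n%:R - 3 / 4) + 1 / 4 :> R)%R by lra.
    have -> : (1 / 4 + n%:R - 1 = n%:R - 3 / 4 :> R)%R by lra.
    rewrite powRD ?(gt_eqF t0) ?implybT //.
    by field; rewrite gt_eqF.
  - by move=> t /=; rewrite in_itv /= andbT => t1; rewrite lee_fin w0 // (lt_trans _ t1).
  - apply/measurable_EFinP; apply: measurable_itvoy => t t1; apply: cf; exact: lt_trans t1.
  - by move=> t _; rewrite mule_ge0 // lee_fin ltW.
  - exact: measurable_funeM.
have {}Iq := Iq; rewrite /wq split // EB -/wq in Iq.
have {}Ip := Ip; rewrite /wp split // EA -/wp in Ip.
have key (P C : \bar R) : B%:E + (P + C) + A%:E = A%:E + P + B%:E + C.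
  by rewrite [LHS]addeC -!addeA [X in A%:E + X = _]addeCA.
by rewrite EFinD -Iq EFinD -Ip big key.
Qed.

End RemainderIntegral.

(** * Asymptotics of the remainder integral *)

Lemma is_derive_exprn (R : realType) (f : R -> R) n (x d : R) :
  is_derive x (1 : R) f d ->
  is_derive x (1 : R) (fun y => f y ^+ n) (n%:R * f x ^+ n.-1 * d).
Proof.
move=> df; have := is_deriveX n df.
by rewrite (_ : f ^+ n = (fun y => f y ^+ n)) //; apply/funext => y; rewrite exprfctE.
Qed.

(** * Integrals with known values and comparison between them *)

Section HasIntegral.
Variable R : realType.
Notation mu := (@lebesgue_measure R).
Implicit Types (a v c : R) (f g e : R -> R).

Definition has_int a f v :=
  mu.-integrable (`]a, +oo[%classic : set (measurableTypeR R)) (EFin \o f) /\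
  (\int[mu]_(x in `]a, +oo[) (f x)%:E = v%:E)%E.

Lemma has_int_ext a f g v : (forall x, a < x -> f x = g x) ->
  has_int a f v -> has_int a g v.
Proof.
move=> fg [fi fv]; split.
  apply: eq_integrable fi => // x; rewrite inE /= in_itv /= andbT => ax.
  by rewrite /= fg.
rewrite -fv; apply: eq_integral => x; rewrite inE /= in_itv /= andbT => ax.
by rewrite fg.
Qed.

Lemma has_intD a f g v w : has_int a f v -> has_int a g w ->
  has_int a (fun x => f x + g x) (v + w).
Proof.
move=> [fi fv] [gi gv]; split; first exact: (integrableD _ fi gi).
under eq_integral do rewrite EFinD.
by rewrite integralD_EFin // fv gv EFinD.
Qed.

Lemma has_intZ a c f v : has_int a f v -> has_int a (fun x => c * f x) (c * v).
Proof.
move=> [fi fv]; split; first exact: (integrableZl _ c fi).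
under eq_integral do rewrite EFinM.
by rewrite integralZl // fv EFinM.
Qed.

Lemma has_int_ge0 a f v : (forall x, a < x -> 0 <= f x) ->
  (forall x, a < x -> {for x, continuous f}) ->
  (\int[mu]_(x in `]a, +oo[) (f x)%:E = v%:E)%E -> has_int a f v.
Proof.
move=> f0 cf fv; split => //; apply/integrableP; split.
  by apply/measurable_EFinP; exact: measurable_itvoy.
rewrite (_ : integral _ _ _ = v%:E) ?ltry // -fv; apply: eq_integral => x.
rewrite inE /= in_itv /= andbT => ax.
by rewrite ger0_norm // f0.
Qed.

Lemma has_int_le a f g v w : (forall x, a < x -> f x <= g x) ->
  has_int a f v -> has_int a g w -> v <= w.
Proof.
move=> fg [fi fv] [gi gv]; rewrite -lee_fin -fv -gv; apply: le_integral => // x.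
by rewrite inE /= in_itv /= andbT => ax; rewrite lee_fin fg.
Qed.

(** All integral estimates below go through this: [g] and [e] are combinations of functions with
    exactly known integrals, so only a pointwise inequality has to be proved. Integrability of [f]
    comes out as well. *)
Lemma has_int_sandwich a f g e vg ve :
  measurable_fun (`]a, +oo[%classic : set (measurableTypeR R)) f ->
  (forall x, a < x -> `|f x - g x| <= e x) ->
  has_int a g vg -> has_int a e ve ->
  exists2 vf, has_int a f vf & `|vf - vg| <= ve.
Proof.
move=> mf fge hg he.
have fi : mu.-integrable (`]a, +oo[%classic : set (measurableTypeR R)) (EFin \o f).
  have [gi _] := hg; have [ei _] := he.
  apply: (@le_integrable _ _ _ mu _ _ _ (EFin \o (fun x => `|g x| + `|e x|))) => //.
  - exact/measurable_EFinP.
  - move=> x /=; rewrite in_itv /= andbT => ax; rewrite lee_fin.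
    rewrite [leRHS]ger0_norm ?addr_ge0 //.
    have := fge x ax; have := ler_norm (e x).
    by have := ler_normD (f x - g x) (g x); rewrite subrK; lra.
  - exact: (integrableD _ (integrable_norm gi) (integrable_norm ei)).
have [vf fv] : exists vf, (\int[mu]_(x in `]a, +oo[) (f x)%:E = vf%:E)%E.
  have : (\int[mu]_(x in `]a, +oo[) (f x)%:E)%E \is a fin_num.
    exact: integrable_fin_num.
  by case: (integral _ _ _) => [r _| |] //; exists r.
have hf : has_int a f vf by [].
exists vf => //; rewrite ler_distl; apply/andP; split.
  rewrite lerBlDr.
  apply: has_int_le hg (has_intD hf he) => x ax.
  by have := fge x ax; rewrite ler_distl => /andP[]; lra.
apply: has_int_le hf (has_intD hg he) => x ax.
by have := fge x ax; rewrite ler_distl => /andP[]; lra.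
Qed.

Lemma has_int_shifted_gamma a m :
  has_int a (fun t => (t - a) ^+ m * expR (- (t - a))) m`!%:R.
Proof.
have cf k x : {for x, continuous (fun t : R => (t - a) ^+ k * expR (- (t - a)))}.
  apply: continuousM.
    by apply: continuous_exprn; apply: continuousB; [exact: cvg_id|exact: cst_continuous].
  apply: (is_derive_continuous (d := - expR (- (x - a)))).
  by apply: is_derive_eq; rewrite /GRing.scale /=; ring.
have f0 k x : a < x -> 0 <= (x - a) ^+ k * expR (- (x - a)).
  by move=> ax; rewrite mulr_ge0 ?expR_ge0 ?exprn_ge0 // subr_ge0 ltW.
apply: has_int_ge0 => [x|x _|]; [exact: f0|exact: cf|].
have lim k : (t - a) ^+ k * expR (- (t - a)) @[t --> +oo] --> (0 : R).
  have := @cvgy_powR_expR R k%:R 1 ltr01 => h.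
  apply: (@cvg_trans _ ((fun t => t `^ k%:R * expR (- (1 * t))) (t - a) @[t --> +oo])).
    apply: near_eq_cvg; near=> t; rewrite mul1r powR_mulrn // subr_ge0.
    by near: t; apply: nbhs_pinfty_ge; exact: num_real.
  apply: (@cvg_comp _ _ _ (fun t => t - a) (fun t => t `^ k%:R * expR (- (1 * t))) _ _ _ _ h).
  apply/cvgryPge => A; near=> t; rewrite lerBrDr.
  by near: t; apply: nbhs_pinfty_ge; exact: num_real.
elim: m => [|m ih].
  rewrite (_ : 0`!%:R = 0 - (- 1)); last by rewrite fact0; ring.
  apply: (@integral_itvoy_FTC R _ (fun t => - expR (- (t - a)))) => [x|x _|x _||].
  - exact: f0.
  - exact: cf.
  - by apply: is_derive_eq; rewrite /GRing.scale /= expr0; ring.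
  - apply: cvg_at_right_filter; rewrite [X in _ --> X](_ : _ = - expR (- (a - a))).
      apply: (is_derive_continuous (F := fun t => - expR (- (t - a))) (d := expR (- (a - a)))).
      by apply: is_derive_eq; rewrite /GRing.scale /=; ring.
    by rewrite subrr oppr0 expR0.
  - rewrite -[X in _ --> X]oppr0; apply: cvgN; have := lim 0.
    by under eq_fun do rewrite expr0 mul1r.
have : (\int[mu]_(t in `]a, +oo[) ((t - a) ^+ m.+1 * expR (- (t - a)))%:E + 0%:E =
   \int[mu]_(t in `]a, +oo[) (m.+1%:R * ((t - a) ^+ m * expR (- (t - a))))%:E + 0%:E)%E.
  apply: (@integral_itvoy_sub R _ _ (fun t => - ((t - a) ^+ m.+1 * expR (- (t - a))))) =>
    [x|x ax|x _|x _|x _||].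
  - exact: f0.
  - by rewrite mulr_ge0 // f0.
  - exact: cf.
  - by apply: continuousM; [exact: cst_continuous|exact: cf].
  - have d : is_derive x (1 : R) (fun t : R => t - a) 1.
      by apply: is_derive_eq; rewrite subr0.
    have dX := is_derive_exprn m.+1 d.
    by apply: is_derive_eq; rewrite /GRing.scale /=; ring.
  - apply: cvg_at_right_filter.
    rewrite [X in _ --> X](_ : _ = - ((a - a) ^+ m.+1 * expR (- (a - a)))).
      by apply: cvgN; exact: cf.
    by rewrite subrr expr0n mul0r oppr0.
  - by rewrite -[X in _ --> X]oppr0; apply: cvgN; exact: lim.
rewrite !adde0 => ->.
under eq_integral do rewrite EFinM.
rewrite ge0_integralZl_EFin //.
- by rewrite ih -EFinM factS natrM.
- by move=> t /=; rewrite in_itv /= andbT => at0; rewrite lee_fin f0.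
- by apply/measurable_EFinP; apply: measurable_itvoy => x _; exact: cf.
Unshelve. all: by end_near. Qed.

End HasIntegral.

(** * Elementary inequalities and the pointwise error of the inner integrand *)

Section ElementaryBounds.
Variable R : realType.
Implicit Types (x y u v h tau xi X : R).

Lemma norm_expRN_sub u v : 0 <= u -> 0 <= v ->
  `|expR (- u) - expR (- v)| <= `|u - v|.
Proof.
have key a b : 0 <= a -> a <= b -> `|expR (- a) - expR (- b)| <= `|a - b|.
  move=> a0 ab; rewrite ger0_norm; last by rewrite subr_ge0 ler_expR lerN2.
  rewrite distrC ger0_norm ?subr_ge0 //.
  have -> : expR (- b) = expR (- a) * expR (- (b - a)) by rewrite -expRD; congr expR; ring.
  have e1 : expR (- a) <= 1 by rewrite expR_le1 oppr_le0.
  have e2 := expR_ge1Dx (- (b - a)).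
  have e3 := expR_gt0 (- a).
  have ba : 0 <= b - a by rewrite subr_ge0.
  have : expR (- a) * (1 - (b - a)) <= expR (- a) * expR (- (b - a)).
    by rewrite ler_pM2l.
  nra.
move=> u0 v0; have [uv|/ltW vu] := leP u v; first exact: key.
by rewrite distrC [leRHS]distrC; exact: key.
Qed.

Lemma norm_exprn_sub n x y : 0 <= x <= 1 -> 0 <= y <= 1 ->
  `|x ^+ n - y ^+ n| <= n%:R * `|x - y|.
Proof.
move=> /andP[x0 x1] /andP[y0 y1]; elim: n => [|n ih]; first by rewrite subrr normr0 mul0r.
rewrite -natr1 mulrDl mul1r !exprS.
have -> : x * x ^+ n - y * y ^+ n = x * (x ^+ n - y ^+ n) + (x - y) * y ^+ n by ring.
apply: le_trans (ler_normD _ _) _; rewrite !normrM; apply: lerD.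
  rewrite (ger0_norm x0); apply: le_trans ih.
  by rewrite -[leRHS]mul1r ler_wpM2r.
by rewrite -[leRHS]mulr1 ler_wpM2l // ger0_norm ?exprn_ge0 // exprn_ile1.
Qed.

Lemma expRN_le_quadratic y : 0 <= y -> expR (- y) <= 1 - y + y ^+ 2.
Proof.
move=> y0; rewrite expRN; have h := expR_ge1Dx y.
have h1 : 0 < 1 + y by lra.
apply: (@le_trans _ _ (1 + y)^-1); first by rewrite lef_pV2 ?posrE // expR_gt0.
rewrite -[leLHS]mul1r ler_pdivrMr //.
have := exprn_ge0 3 y0; rewrite !exprS expr0 => h3; nra.
Qed.

Lemma max_subr_expRN y : 0 <= y -> 0 <= Num.max 0 (1 - y) <= 1 /\
  `|Num.max 0 (1 - y) - expR (- y)| <= y ^+ 2.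
Proof.
move=> y0; have e0 := expR_gt0 (- y).
have e1 : expR (- y) <= 1 by rewrite expR_le1 oppr_le0.
have e2 := expR_ge1Dx (- y).
have e3 := expRN_le_quadratic y0.
have [y1|y1] := leP 0 (1 - y); split.
- by apply/andP; split; lra.
- by rewrite ler0_norm; lra.
- by apply/andP; split; lra.
- rewrite sub0r normrN ger0_norm ?(ltW e0) //.
  have : 1 <= y ^+ 2 by rewrite expr_ge1 //; lra.
  by lra.
Qed.

Lemma norm_powR_sub1 s x : 0 <= s <= 1 -> 0 < x -> `|x `^ s - 1| <= `|x - 1|.
Proof.
move=> /andP[s0 s1] x0; have [x1|/ltW x1] := leP x 1.
  have h1 : x <= x `^ s by apply: ger1_powR; rewrite ?x0.
  have h2 : x `^ s <= 1.
    by rewrite -(powRr0 x); apply: ger_powR; rewrite ?x0.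
  by rewrite !ler0_norm; lra.
have h1 : x `^ s <= x by apply: ler1_powR.
have h2 : 1 <= x `^ s.
  by rewrite -(powRr0 x); apply: ler_powR.
by rewrite !ger0_norm; lra.
Qed.

Lemma powRN_bounds s h : 0 <= s <= 1 -> 0 <= h ->
  0 <= (1 + h) `^ (- s) <= 1 /\ 1 - (1 + h) `^ (- s) <= h.
Proof.
move=> /andP[s0 s1] h0; have h1 : 1 <= 1 + h by lra.
have p0 : 0 < (1 + h) `^ s by rewrite powR_gt0; lra.
have p1 : 1 <= (1 + h) `^ s.
  have : (1 + h) `^ 0 <= (1 + h) `^ s by apply: ler_powR.
  by rewrite powRr0.
have p2 : (1 + h) `^ s <= 1 + h by apply: ler1_powR.
rewrite powRN; split.
  by rewrite invr_ge0 ltW //= invf_le1.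
have : (1 + h)^-1 <= ((1 + h) `^ s)^-1 by rewrite lef_pV2 ?posrE //; lra.
have : 1 - h <= (1 + h)^-1.
  by rewrite -[leRHS]mul1r ler_pdivlMr; [nra|lra].
by lra.
Qed.

(** With s = t - x/2 the variables are xi = x/X, tau = 2n/s and h = x/(2s). First (1-h^2)^n is
    replaced by exp(-n h^2) = exp(-xi^2 tau^2/8), then tau by 1. The bound is polynomial in tau
    because tau^k integrates exactly against s^(2n) exp(-s). *)
Lemma inner_pointwise n X xi tau h : 1 <= X -> X ^+ 2 = 2 * n%:R ->
  0 < xi -> 0 < tau -> h = xi * tau / (2 * X) ->
  `|Num.max 0 (1 - h ^+ 2) ^+ n * (1 + h) `^ (- (3 / 4)) * tau `^ (3 / 4)
    - expR (- (xi ^+ 2 / 8))| <=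
  (1 + xi ^+ 4) * (4 * (1 + tau ^+ 5) / X + X * (tau ^+ 2 - 1) ^+ 2).
Proof.
move=> X1 Xn xi0 tau0 hE.
have X0 : 0 < X by lra.
have h0 : 0 < h by rewrite hE divr_gt0 ?mulr_gt0 //; lra.
have nh2 : n%:R * h ^+ 2 = xi ^+ 2 * tau ^+ 2 / 8.
  have -> : n%:R = X ^+ 2 / 2 by rewrite Xn; field.
  by rewrite hE; field; rewrite gt_eqF.
have [A01 dA] := max_subr_expRN (exprn_ge0 2 (ltW h0)).
set A := Num.max 0 (1 - h ^+ 2) in A01 dA *.
have E01 : 0 <= expR (- h ^+ 2) <= 1.
  by rewrite expR_ge0 expR_le1 oppr_le0 exprn_ge0 // ltW.
have dAn := norm_exprn_sub n A01 E01.
have EnE : expR (- h ^+ 2) ^+ n = expR (- (xi ^+ 2 * tau ^+ 2 / 8)).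
  by rewrite -expRM_natl mulrN nh2.
rewrite EnE in dAn.
have {}dAn : `|A ^+ n - expR (- (xi ^+ 2 * tau ^+ 2 / 8))| <= xi ^+ 4 * tau ^+ 4 / (32 * X ^+ 2).
  apply: le_trans dAn _; apply: le_trans (ler_wpM2l (ler0n _ _) dA) _.
  have -> : n%:R = X ^+ 2 / 2 by rewrite Xn; field.
  by rewrite hE le_eqVlt; apply/orP; left; apply/eqP; field; rewrite gt_eqF.
have An01 : 0 <= A ^+ n <= 1.
  by case/andP: A01 => A0 A1; rewrite exprn_ge0 //= exprn_ile1.
have s34 : 0 <= (3 / 4 : R) <= 1 by lra.
have [/andP[B0 B1] dB] := powRN_bounds s34 (ltW h0).
set B := (1 + h) `^ (- (3 / 4)) in B0 B1 dB *.
have dC := norm_powR_sub1 s34 tau0.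
have C0 := powR_ge0 tau (3 / 4).
have C1 := powR_le1D s34 tau0.
set C := tau `^ (3 / 4) in dC C0 C1 *.
have dE : `|expR (- (xi ^+ 2 * tau ^+ 2 / 8)) - expR (- (xi ^+ 2 / 8))| <=
    xi ^+ 2 * `|tau ^+ 2 - 1| / 8.
  apply: le_trans (norm_expRN_sub _ _) _.
  - by rewrite !mulr_ge0 ?exprn_ge0 ?ltW.
  - by rewrite !mulr_ge0 ?exprn_ge0 ?ltW.
  have -> : xi ^+ 2 * tau ^+ 2 / 8 - xi ^+ 2 / 8 = xi ^+ 2 / 8 * (tau ^+ 2 - 1) by ring.
  rewrite normrM ger0_norm; last by rewrite divr_ge0 ?exprn_ge0 ?ltW.
  by rewrite mulrAC.
set E1 := expR (- (xi ^+ 2 * tau ^+ 2 / 8)) in dAn dE.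
have E0 := expR_gt0 (- (xi ^+ 2 / 8)).
have E0' : expR (- (xi ^+ 2 / 8)) <= 1 by rewrite expR_le1 oppr_le0 divr_ge0 ?exprn_ge0 // ltW.
set E := expR (- (xi ^+ 2 / 8)) in dE E0 E0' *.
set d := `|tau ^+ 2 - 1| in dE.
have d0 : 0 <= d by exact: normr_ge0.
have dd : d ^+ 2 = (tau ^+ 2 - 1) ^+ 2 by rewrite real_normK // num_real.
have td : `|tau - 1| <= d.
  have -> : d = `|tau - 1| * (1 + tau).
    rewrite -[X in _ * X]ger0_norm ?addr_ge0 ?ltW // -normrM /d; congr `|_|; ring.
  by rewrite -[leLHS]mulr1 ler_wpM2l //; lra.
have step : `|A ^+ n * B * C - E| <= (1 + tau) * (xi ^+ 4 * tau ^+ 4 / (32 * X ^+ 2)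
    + h + xi ^+ 2 * d / 8) + d.
  have -> : A ^+ n * B * C - E = C * ((A ^+ n - E1) + (E1 - E) - A ^+ n * (1 - B)) + E * (C - 1).
    by ring.
  apply: le_trans (ler_normD _ _) _; apply: lerD.
    rewrite normrM (ger0_norm C0); apply: ler_pM => //.
    apply: le_trans (ler_normB _ _) _.
    have : `|A ^+ n * (1 - B)| <= h.
      case/andP: An01 => a0 a1; rewrite ger0_norm ?mulr_ge0 ?subr_ge0 //.
      by apply: le_trans dB; rewrite -[leRHS]mul1r ler_wpM2r ?subr_ge0.
    have := ler_normD (A ^+ n - E1) (E1 - E); lra.
  rewrite normrM (gtr0_norm E0); apply: le_trans (le_trans dC td).
  by rewrite -[leRHS]mul1r ler_wpM2r.
apply: le_trans step _.
set P := 1 + xi ^+ 4.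
have xi4 : 0 <= xi ^+ 4 by rewrite exprn_ge0 // ltW.
have P2 : xi ^+ 2 <= P by rewrite /P; have := sqr_ge0 (xi ^+ 2 - 1); nra.
have P1 : xi <= P by have := sqr_ge0 (xi - 1); rewrite /P; have := sqr_ge0 (xi ^+ 2 - 1); nra.
have Pge1 : 1 <= P by rewrite /P; lra.
pose T5 := 1 + tau ^+ 5.
have t5 : 0 <= tau ^+ 5 by rewrite exprn_ge0 // ltW.
(* Five is the highest power that occurs, from (1 + tau) tau^4; the lower ones are absorbed. *)
have tk k : (k <= 5)%N -> tau ^+ k <= T5.
  move=> k5; rewrite /T5; have [t1|/ltW t1] := leP tau 1.
    have : tau ^+ k <= 1 by rewrite exprn_ile1 // ltW.
    by lra.
  have : tau ^+ k <= tau ^+ 5 by exact: ler_weXn2l.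
  by lra.
have T0 : 0 < T5 by rewrite /T5; lra.
pose Y := X^-1; have Y0 : 0 < Y by rewrite invr_gt0.
have Y1 : Y <= 1 by rewrite invf_le1.
have XY : X * Y = 1 by rewrite mulfV // gt_eqF.
have t1 := tk 1 isT; have t2 := tk 2 isT; have t4 := tk 4 isT; rewrite expr1 in t1.
have s1 : (1 + tau) * (xi ^+ 4 * tau ^+ 4 / (32 * X ^+ 2)) <= P * (2 * T5) / 32 * Y.
  have -> : (1 + tau) * (xi ^+ 4 * tau ^+ 4 / (32 * X ^+ 2)) =
     xi ^+ 4 * (tau ^+ 4 + tau ^+ 5) / 32 * Y * Y by rewrite /Y; field; rewrite gt_eqF.
  rewrite -[leRHS]mulr1; apply: ler_pM => //.
  - by rewrite !mulr_ge0 ?addr_ge0 ?exprn_ge0 ?ltW.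
  - exact: ltW.
  rewrite !ler_pM2r //; apply: ler_pM; rewrite ?addr_ge0 ?exprn_ge0 ?(ltW tau0) ?(ltW xi0) //.
    by rewrite /P lerDr.
  by have t5' := tk 5 isT; lra.
have s2 : (1 + tau) * h <= P * T5 * Y.
  have -> : (1 + tau) * h = xi * ((tau + tau ^+ 2) / 2) * Y.
    by rewrite hE /Y; field; rewrite gt_eqF.
  rewrite ler_pM2r //; apply: ler_pM; rewrite ?mulr_ge0 ?addr_ge0 ?exprn_ge0 ?(ltW tau0) ?(ltW xi0) //.
  by lra.
pose w := (9 + tau) / 8.
have s3 : (1 + tau) * (xi ^+ 2 * d / 8) + d <= P * (w * d).
  have : xi ^+ 2 * ((1 + tau) * d) <= P * ((1 + tau) * d).
    by rewrite ler_wpM2r // mulr_ge0 //; lra.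
  have : d <= P * d by rewrite -[leLHS]mul1r ler_wpM2r.
  by rewrite /w; lra.
(* Completing a square replaces the first-order term by X d^2, whose mean is O(1/X), at the price of
   w^2/(4X). *)
have s4 : w * d <= X * d ^+ 2 + T5 * Y / 2.
  have : 0 <= X * (d - w * Y / 2) ^+ 2 by rewrite mulr_ge0 ?sqr_ge0 // ltW.
  have -> : X * (d - w * Y / 2) ^+ 2 = X * d ^+ 2 - (X * Y) * (w * d) + (X * Y) * Y * w ^+ 2 / 4 by field.
  rewrite XY; have : Y * w ^+ 2 <= Y * (2 * T5).
    rewrite ler_pM2l // /w; have -> : ((9 + tau) / 8) ^+ 2 = (81 + 18 * tau + tau ^+ 2) / 64 by field.
    have T51 : 1 <= T5 by rewrite /T5 lerDl.
    by clear - t1 t2 T51; lra.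
  by lra.
have s5 : P * (w * d) <= P * (X * d ^+ 2 + T5 * Y / 2) by rewrite ler_pM2l //; lra.
rewrite -dd mulrDr mulrDr -/T5 -/Y.
have : 0 <= P * T5 * Y by rewrite !mulr_ge0 // ltW //; lra.
lra.
Qed.

End ElementaryBounds.

Section InnerEstimate.
Variable R : realType.
Notation mu := (@lebesgue_measure R).

Let X (n : nat) : R := Num.sqrt (2 * n%:R).

Lemma sqr_sqrt2n n : Num.sqrt (2 * n%:R) ^+ 2 = 2 * n%:R :> R.
Proof. by rewrite sqr_sqrtr // mulr_ge0. Qed.

Lemma sqrt2n_ge1 n : (0 < n)%N -> 1 <= Num.sqrt (2 * n%:R) :> R.
Proof.
move=> n0; rewrite -[leLHS]sqrtr1 ler_sqrt ?mulr_ge0 //.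
have : 1 <= n%:R :> R by rewrite ler1n.
by lra.
Qed.

Definition inner_weight (n : nat) (x : R) : R :=
  (2 * n)`!%:R * (2 * n%:R) `^ (- (3 / 4)) * expR (- (x / 2)).

(** Centring at x/2 gives t(t-x) = s^2(1-h^2), without a linear term in h; this is the reason for
    the shift. *)
Lemma inner_integrandE n (x t : R) : (0 < n)%N -> 0 < x -> x / 2 < t ->
  let s := t - x / 2 in let h := x / (2 * s) in
  t `^ (n%:R - 3 / 4) * expR (- t) * Num.max 0 (t - x) ^+ n =
  (2 * n%:R) `^ (- (3 / 4)) * expR (- (x / 2)) * (s ^+ (2 * n) * expR (- s)) *
  (Num.max 0 (1 - h ^+ 2) ^+ n * (1 + h) `^ (- (3 / 4)) * (2 * n%:R / s) `^ (3 / 4)).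
Proof.
move=> n0 x0 xt s h.
have s0 : 0 < s by rewrite subr_gt0.
have N0 : 0 < 2 * n%:R :> R by rewrite mulr_gt0 // ltr0n.
have h0 : 0 < h by rewrite divr_gt0 // mulr_gt0.
have h1 : 0 < 1 + h by lra.
have hs : s * h = x / 2 by rewrite /h; field; rewrite gt_eqF.
have tE : t = s * (1 + h) by rewrite mulrDr mulr1 hs /s; ring.
have txE : t - x = s * (1 - h) by rewrite mulrBr mulr1 hs /s; lra.
have -> : expR (- t) = expR (- (x / 2)) * expR (- s).
  by rewrite -expRD; congr expR; rewrite /s; ring.
have -> : Num.max 0 (t - x) ^+ n = s ^+ n * Num.max 0 (1 - h) ^+ n.
  by rewrite txE -exprMn maxr_pMr ?(ltW s0) // mulr0.
have -> : t `^ (n%:R - 3 / 4) = s ^+ n * (1 + h) ^+ n * (s `^ (- (3 / 4)) * (1 + h) `^ (- (3 / 4))).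
  rewrite -powRM ?(ltW s0) ?(ltW h1) // -tE -exprMn -tE powRD ?powR_mulrn ?ltW //.
    by lra.
  by apply/implyP => _; rewrite gt_eqF //; lra.
have -> : (2 * n%:R / s) `^ (3 / 4) = (2 * n%:R) `^ (3 / 4) * s `^ (- (3 / 4)).
  rewrite [LHS]powRM ?invr_ge0 ?(ltW N0) ?(ltW s0) //.
  by rewrite -(powR_inv1 (ltW s0)) -powRrM mulN1r.
have -> : Num.max 0 (1 - h ^+ 2) ^+ n = (1 + h) ^+ n * Num.max 0 (1 - h) ^+ n.
  by rewrite -exprMn maxr_pMr ?(ltW h1) // mulr0; congr (Num.max _ _ ^+ _); ring.
have -> : s ^+ (2 * n) = s ^+ n * s ^+ n by rewrite mul2n -addnn exprD.
have e : (2 * n%:R) `^ (- (3 / 4)) * (2 * n%:R) `^ (3 / 4) = 1 :> R.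
  by rewrite powRN mulVf // gt_eqF // powR_gt0.
rewrite -[LHS]mul1r -{1}e; ring.
Qed.

(** The left side is the integral of 4(1+tau^5)/X + X(tau^2-1)^2 against s^(2n) exp(-s). With 2n = M
    + 6 and common factors removed, a polynomial in M remains. At n = 3 the left side is about 60.4
    (2n)!/X, which explains the size of 62. *)
Lemma inner_moment_bound n : (3 <= n)%N ->
  (4 / X n + X n) * (2 * n)`!%:R + 4 / X n * (2 * n%:R) ^+ 5 * (2 * n - 5)`!%:R
  + X n * (2 * n%:R) ^+ 4 * (2 * n - 4)`!%:R
  - 2 * X n * (2 * n%:R) ^+ 2 * (2 * n - 2)`!%:R <= 62 / X n * (2 * n)`!%:R.
Proof.
move=> n3; have n0 : (0 < n)%N by apply: leq_trans n3.
have X1 := sqrt2n_ge1 n0; rewrite -/(X n) in X1.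
have X2 := sqr_sqrt2n n; rewrite -/(X n) in X2.
have X0 : 0 < X n by lra.
have [m mE] : exists m, (2 * n = m + 6)%N by exists (2 * n - 6)%N; lia.
have NE : 2 * n%:R = m%:R + 6 :> R by rewrite -natrM mE natrD.
rewrite NE in X2 *; rewrite mE.
rewrite !addnS !addn0 !subSS !subn0 !factS !natrM.
set F := (m`!)%:R; have F0 : 0 < F by rewrite ltr0n fact_gt0.
rewrite -!natr1.
set M := m%:R; have M0 : 0 <= M by exact: ler0n.
rewrite -subr_ge0.
rewrite (_ : _ - _ = F * (M + 1) / X n * (62 * ((M + 6) * (M + 5) * (M + 4) * (M + 3) * (M + 2))
  - ((4 + X n ^+ 2) * ((M + 6) * (M + 5) * (M + 4) * (M + 3) * (M + 2)) + 4 * (M + 6) ^+ 5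
   + X n ^+ 2 * ((M + 6) ^+ 4 * (M + 2) - 2 * (M + 6) ^+ 2 * ((M + 4) * (M + 3) * (M + 2)))))); last first.
  by field; rewrite gt_eqF.
rewrite X2; apply: mulr_ge0; first by rewrite !mulr_ge0 ?invr_ge0 ?ltW // ltr_wpDl.
have := exprn_ge0 5 M0; have := exprn_ge0 4 M0; have := exprn_ge0 3 M0; have := exprn_ge0 2 M0.
rewrite !exprS !expr0.
lra.
Qed.

Lemma inner_estimate n (x : R) : (3 <= n)%N -> 0 < x ->
  exists2 v, has_int (x / 2)
    (fun t => t `^ (n%:R - 3 / 4) * expR (- t) * Num.max 0 (t - x) ^+ n) v &
  `|v - inner_weight n x * expR (- ((x / X n) ^+ 2 / 8))| <=
    inner_weight n x * (62 * (1 + (x / X n) ^+ 4) / X n).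
Proof.
move=> n3 x0; have n0 : (0 < n)%N by apply: leq_trans n3.
have X1 := sqrt2n_ge1 n0; rewrite -/(X n) in X1.
have X2 := sqr_sqrt2n n; rewrite -/(X n) in X2.
have X0 : 0 < X n by lra.
set xi := x / X n; have xi0 : 0 < xi by rewrite divr_gt0.
pose w := (2 * n%:R) `^ (- (3 / 4)) * expR (- (x / 2)) : R.
have w0 : 0 < w by rewrite mulr_gt0 ?expR_gt0 // powR_gt0 // mulr_gt0 // ltr0n.
have WE : inner_weight n x = w * (2 * n)`!%:R by rewrite /inner_weight /w; ring.
pose gam m (t : R) := (t - x / 2) ^+ m * expR (- (t - x / 2)).
have hgam m : has_int (x / 2) (gam m) m`!%:R by exact: has_int_shifted_gamma.
have hg := has_intZ (expR (- (xi ^+ 2 / 8)) * w) (hgam (2 * n)%N).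
have he := has_intZ (w * (1 + xi ^+ 4))
 (has_intD (has_intD (has_intD (has_intZ (4 / X n + X n) (hgam (2 * n)%N))
   (has_intZ (4 / X n * (2 * n%:R) ^+ 5) (hgam (2 * n - 5)%N)))
   (has_intZ (X n * (2 * n%:R) ^+ 4) (hgam (2 * n - 4)%N)))
   (has_intZ (- (2 * X n * (2 * n%:R) ^+ 2)) (hgam (2 * n - 2)%N))).
have mf : measurable_fun (`](x / 2)%R, +oo[%classic : set (measurableTypeR R))
   (fun t => t `^ (n%:R - 3 / 4) * expR (- t) * Num.max 0 (t - x) ^+ n).
  apply: measurable_funM.
    apply: measurable_itvoy => t xt; apply: is_derive_continuous.
    by apply: is_derive_powR_expR; apply: lt_trans xt; rewrite divr_gt0.
  apply: measurable_funX; apply: measurable_maxr => //.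
  by apply: measurable_funB.
have bnd (t : R) : x / 2 < t ->
  `|t `^ (n%:R - 3 / 4) * expR (- t) * Num.max 0 (t - x) ^+ n -
    expR (- (xi ^+ 2 / 8)) * w * gam (2 * n)%N t| <=
  w * (1 + xi ^+ 4) * ((4 / X n + X n) * gam (2 * n)%N t +
    4 / X n * (2 * n%:R) ^+ 5 * gam (2 * n - 5)%N t +
    X n * (2 * n%:R) ^+ 4 * gam (2 * n - 4)%N t +
    - (2 * X n * (2 * n%:R) ^+ 2) * gam (2 * n - 2)%N t).
  move=> xt; rewrite (inner_integrandE n0 x0 xt) /= -/w.
  set s := t - x / 2; have s0 : 0 < s by rewrite subr_gt0.
  set h := x / (2 * s).
  have N0 : 0 < 2 * n%:R :> R by rewrite mulr_gt0 // ltr0n.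
  have t0 : 0 < 2 * n%:R / s by rewrite divr_gt0.
  have hE : h = xi * (2 * n%:R / s) / (2 * X n).
    by rewrite -X2 /h /xi; field; rewrite !gt_eqF.
  have := inner_pointwise X1 X2 xi0 t0 hE.
  set c := _ * _ * _; set b := _ * _ => cb.
  have g0 : 0 <= w * gam (2 * n)%N t.
    by rewrite mulr_ge0 ?(ltW w0) // mulr_ge0 ?expR_ge0 // exprn_ge0 // ltW.
  have -> : w * (s ^+ (2 * n) * expR (- s)) * c - expR (- (xi ^+ 2 / 8)) * w * gam (2 * n)%N t =
    w * gam (2 * n)%N t * (c - expR (- (xi ^+ 2 / 8))) by rewrite /gam -/s; ring.
  rewrite normrM (ger0_norm g0); apply: le_trans (ler_wpM2l g0 cb) _.
  (* As tau = 2n/s, multiplying by tau^k lowers the exponent of s by k and produces (2n)^k; [n >= 3]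
     keeps all exponents nonnegative. *)
  have gk k : (k <= 2 * n)%N -> gam (2 * n)%N t = s ^+ k * gam (2 * n - k)%N t.
    by move=> kn; rewrite /gam -/s mulrA -exprD subnKC.
  have e5 : gam (2 * n)%N t = s ^+ 5 * gam (2 * n - 5)%N t by apply: gk; clear - n3; lia.
  have e4 : gam (2 * n)%N t = s ^+ 4 * gam (2 * n - 4)%N t by apply: gk; clear - n3; lia.
  have e2 : gam (2 * n)%N t = s ^+ 2 * gam (2 * n - 2)%N t by apply: gk; clear - n3; lia.
  move: e5 e4 e2; move: (gam (2 * n)%N t) (gam (2 * n - 5)%N t) (gam (2 * n - 4)%N t)
    (gam (2 * n - 2)%N t) => g a5 a4 a2.
  have sK k u v : u = s ^+ k * v -> v = u / s ^+ k.
    by move=> ->; rewrite mulrC mulKf // expf_neq0 // gt_eqF.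
  move=> /sK -> /sK -> /sK ->; rewrite /b; clear -s0 X0 N0.
  by rewrite le_eqVlt; apply/orP; left; apply/eqP; field; rewrite !gt_eqF.
have [v hv dv] := has_int_sandwich mf bnd hg he.
exists v => //; rewrite WE.
have -> : w * (2 * n)`!%:R * expR (- (xi ^+ 2 / 8)) = expR (- (xi ^+ 2 / 8)) * w * (2 * n)`!%:R by ring.
apply: le_trans dv _.
have -> : w * (2 * n)`!%:R * (62 * (1 + xi ^+ 4) / X n) =
   w * (1 + xi ^+ 4) * (62 / X n * (2 * n)`!%:R) by field; rewrite gt_eqF.
rewrite ler_pM2l; last by rewrite mulr_gt0 // ltr_wpDr // exprn_ge0 // ltW.
apply: le_trans (inner_moment_bound n3).
by rewrite mulNr.
Qed.

End InnerEstimate.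

(** * The Gauss error function *)

Section GaussPrimitive.
Variable R : realType.
Notation mu := (@lebesgue_measure R).

(** In terms of the error function this is sqrt(pi)/2 (1 + erf(w)). *)
Definition gauss_primitive (w : R) : R :=
  \int[mu]_(t in `]-oo, w]) gauss_fun t.

Let gauss_ge0 (D : set R) : (0 <= \int[mu]_(t in D) (gauss_fun t)%:E)%E.
Proof. by apply: integral_ge0 => t _; rewrite lee_fin gauss_fun_ge0. Qed.

Let measurable_gauss (D : set (measurableTypeR R)) :
  measurable_fun D (EFin \o @gauss_fun R).
Proof. by apply/measurable_EFinP/measurable_funTS; exact: measurable_gauss_fun. Qed.

Let integrable_gauss (D : set (measurableTypeR R)) : measurable D ->
  mu.-integrable D (EFin \o @gauss_fun R).
Proof.
by move=> mD; apply: integrableS (@integrableT_gauss R).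
Qed.

Lemma gauss_primitiveE w :
  (\int[mu]_(t in `]-oo, w]) (gauss_fun t)%:E = (gauss_primitive w)%:E)%E.
Proof.
rewrite /gauss_primitive /Rintegral fineK //; apply: integrable_fin_num => //.
exact: integrable_gauss.
Qed.

Lemma is_derive_gauss_primitive w :
  is_derive w (1 : R) gauss_primitive (gauss_fun w).
Proof.
have w1 : w < w + 1 by rewrite ltrDl.
have [||d e] := @continuous_FTC1 R gauss_fun -oo%O w (w + 1) w1
  (integrable_gauss (measurable_itv _)); [by rewrite ltNyr|exact: continuous_gauss_fun|].
by split; [exact: d|rewrite -derive1E].
Qed.

Let gauss_tail w : 1 <= w ->
  (\int[mu]_(t in `]w, +oo[) (gauss_fun t)%:E <= (expR (- w))%:E)%E.
Proof.
move=> w1; have [_ h] := has_intZ (expR (- w)) (has_int_shifted_gamma w 0).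
rewrite -[X in (_ <= X%:E)%E]mulr1 -[X in (_ <= (_ * X)%:E)%E]/(0`!%:R) -h.
apply: ge0_le_integral => //.
- by move=> t _; rewrite lee_fin gauss_fun_ge0.
- apply/measurable_EFinP; apply: measurable_itvoy => t _.
  apply: continuousM; first exact: cst_continuous.
  apply: continuousM.
    by apply: continuous_exprn; apply: continuousB; [exact: cvg_id|exact: cst_continuous].
  apply: (is_derive_continuous (d := - expR (- (t - w)))).
  by apply: is_derive_eq; rewrite /GRing.scale /=; ring.
- move=> t /=; rewrite in_itv /= andbT => wt; rewrite lee_fin expr0 mul1r -expRD /gauss_fun.
  by rewrite ler_expR; nra.
Qed.

Lemma cvg_gauss_primitivey : gauss_primitive w @[w --> +oo] --> Num.sqrt pi.
Proof.
apply: (@squeeze_cvgr _ _ _ _ (fun w => Num.sqrt pi - expR (- w)) (cst (Num.sqrt pi))).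
- near=> w.
  have w1 : 1 <= w by near: w; apply: nbhs_pinfty_ge; exact: num_real.
  have : (\int[mu]_t (gauss_fun t)%:E = \int[mu]_(t in `]-oo, w]) (gauss_fun t)%:E +
     \int[mu]_(t in `]w, +oo[) (gauss_fun t)%:E)%E.
    rewrite -ge0_integral_setU //.
    - by rewrite -itv_bndbnd_setU // ?bnd_simp // set_itvNyy.
    - by move=> t _; rewrite lee_fin gauss_fun_ge0.
    - apply/disj_setPS => t [] /=; rewrite !in_itv /= andbT => t1.
      by rewrite ltNge t1.
  rewrite integralT_gauss gauss_primitiveE; move: (gauss_tail w1) (gauss_ge0 `]w, +oo[%classic).
  case: (integral _ _ _) => [r| |] //; rewrite !lee_fin => h1 h2 -[->].
  by rewrite /cst; apply/andP; split; lra.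
- rewrite -[X in _ --> X]subr0; apply: cvgB; [exact: cvg_cst|exact: cvgr_expR].
- exact: cvg_cst.
Unshelve. all: by end_near. Qed.

Lemma cvg_gauss_primitiveNy : gauss_primitive w @[w --> -oo] --> (0 : R).
Proof.
apply/cvgNy_compNP.
apply: (@squeeze_cvgr _ _ _ _ (cst 0) (fun w => expR (- w))).
- near=> w.
  have w1 : 1 <= w by near: w; apply: nbhs_pinfty_ge; exact: num_real.
  rewrite /cst /=; rewrite -!lee_fin -gauss_primitiveE gauss_ge0 /=.
  rewrite ge0_integration_by_substitutionNy; first last.
  - by move=> t _; exact: gauss_fun_ge0.
  - by apply: continuous_subspaceT; exact: continuous_gauss_fun.
  rewrite -integral_itv_obnd_cbnd; last first.
    apply/measurable_EFinP; apply: measurable_itvoy => t _.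
    apply: (@continuous_comp _ _ _ -%R gauss_fun); first exact: oppr_continuous.
    exact: continuous_gauss_fun.
  under eq_integral do rewrite /comp /gauss_fun sqrrN.
  exact: gauss_tail.
- exact: cvg_cst.
- exact: cvgr_expR.
Unshelve. all: by end_near. Qed.

End GaussPrimitive.

(** * Moments of the Bessel density *)

Section BesselMoments.
Variables (R : realType) (X : R).
Hypothesis X_ge1 : 1 <= X.

Let X0 : 0 < X. Proof. exact: lt_le_trans X_ge1. Qed.

(* The integrand [x^s exp(-x/2 - X^2/(2x))] of a modified Bessel function. *)
Definition bessel_fun (s x : R) : R := x `^ s * expR (- (x / 2 + X ^+ 2 / 2 / x)).

Local Notation V := bessel_fun.
Implicit Types (s x v : R).

Lemma bessel_fun_ge0 s x : 0 <= V s x.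
Proof. by rewrite mulr_ge0 ?powR_ge0 ?expR_ge0. Qed.

Lemma is_derive_bessel_fun s x : 0 < x ->
  is_derive x (1 : R) (V s) (s * V (s - 1) x + X ^+ 2 / 2 * V (s - 2) x - V s x / 2).
Proof.
move=> x0; have x_neq0 : x != 0 by rewrite gt_eqF.
have d1 := is_derive1_powR s x0.
have d2 : is_derive x (1 : R) (fun y : R => - (y / 2 + X ^+ 2 / 2 / y))
    (- (1 / 2 - X ^+ 2 / 2 / x ^+ 2)).
  have dV : is_derive x (1 : R) (fun y : R => y^-1) (- x ^- 2 *: (1 : R)).
    by have := is_deriveV x_neq0 (is_derive_id x (1 : R)).
  by apply: is_derive_eq; rewrite /GRing.scale /=; field.
have d3 : is_derive x (1 : R) (fun y : R => expR (- (y / 2 + X ^+ 2 / 2 / y)))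
    (expR (- (x / 2 + X ^+ 2 / 2 / x)) * (- (1 / 2 - X ^+ 2 / 2 / x ^+ 2))).
  exact: (is_derive1_comp (f := expR)).
apply: is_derive_eq; rewrite /V /GRing.scale /=.
have -> : x `^ (s - 1) = x `^ s / x by rewrite powRB ?x_neq0 ?implybT // powRr1 // ltW.
have -> : x `^ (s - 2) = x `^ s / x ^+ 2.
  by rewrite powRB ?x_neq0 ?implybT // powR_mulrn // ltW.
by field.
Qed.

Lemma continuous_bessel_fun s x : 0 < x -> {for x, continuous (V s)}.
Proof. by move=> x0; apply: is_derive_continuous; exact: is_derive_bessel_fun. Qed.

Lemma cvg0_bessel_fun s : V s x @[x --> 0^'+] --> (0 : R).
Proof.
have X2 : 0 < X ^+ 2 / 2 by rewrite divr_gt0 // exprn_gt0.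
apply: (@squeeze_cvgr _ _ _ _ (cst 0) (fun x => x `^ s * expR (- (X ^+ 2 / 2 / x)))).
- near=> x; rewrite /cst bessel_fun_ge0 ler_wpM2l ?powR_ge0 // ler_expR lerN2 lerDr.
  by rewrite divr_ge0.
- exact: cvg_cst.
- exact: cvg0_powR_expR.
Unshelve. all: by end_near. Qed.

Lemma cvgy_bessel_fun s : V s x @[x --> +oo] --> (0 : R).
Proof.
apply: (@squeeze_cvgr _ _ _ _ (cst 0) (fun x => x `^ s * expR (- (2^-1 * x)))).
- near=> x; rewrite /cst bessel_fun_ge0 ler_wpM2l ?powR_ge0 // ler_expR lerN2 mulrC lerDl.
  have x0 : 0 < x by near: x; apply: nbhs_pinfty_gt; exact: num_real.
  by rewrite !divr_ge0 ?exprn_ge0 // ltW.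
- exact: cvg_cst.
- exact: cvgy_powR_expR.
Unshelve. all: by end_near. Qed.

(** Integrating the derivative of [V s], which vanishes at both ends, gives the three-term
    recurrence of Bessel functions. The sign of [s] decides on which side its term keeps the
    integrands nonnegative, hence separate versions upwards and downwards. *)
Lemma has_int_bessel_up s v1 v2 : 0 <= s -> has_int 0 (V (s - 1)) v1 ->
  has_int 0 (V (s - 2)) v2 -> has_int 0 (V s) (2 * s * v1 + X ^+ 2 * v2).
Proof.
move=> s0 h1 h2.
have hg := has_intD (has_intZ s h1) (has_intZ (X ^+ 2 / 2) h2).
have cf r x : 0 < x -> {for x, continuous (V r)} by exact: continuous_bessel_fun.
have E : (\int[@lebesgue_measure R]_(x in `]0%R, +oo[) (2^-1 * V s x)%:E + 0%:E =
  \int[@lebesgue_measure R]_(x in `]0%R, +oo[)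
    (s * V (s - 1) x + X ^+ 2 / 2 * V (s - 2) x)%:E + 0%:E)%E.
  apply: (@integral_itvoy_sub R _ _ (fun x => - V s x)).
- by move=> x _; rewrite mulr_ge0 ?bessel_fun_ge0.
- by move=> x _; apply: addr_ge0; apply: mulr_ge0; rewrite ?bessel_fun_ge0 ?divr_ge0 ?sqr_ge0.
- by move=> x x0; apply: continuousM; [exact: cst_continuous|exact: cf].
- move=> x x0; apply: continuousD; (apply: continuousM; [exact: cst_continuous|exact: cf]).
- move=> x x0; have d := is_derive_bessel_fun s x0.
  by apply: is_derive_eq; ring.
- by rewrite -[X in _ --> X]oppr0; apply: cvgN; exact: cvg0_bessel_fun.
- by rewrite -[X in _ --> X]oppr0; apply: cvgN; exact: cvgy_bessel_fun.
move: E; rewrite !adde0 hg.2 => E.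
have h : has_int 0 (fun x => 2^-1 * V s x) (s * v1 + X ^+ 2 / 2 * v2).
  apply: has_int_ge0 => //.
  - by move=> x _; rewrite mulr_ge0 ?bessel_fun_ge0.
  - by move=> x x0; apply: continuousM; [exact: cst_continuous|exact: cf].
have := has_intZ 2 h.
rewrite (_ : 2 * (s * v1 + X ^+ 2 / 2 * v2) = 2 * s * v1 + X ^+ 2 * v2); last by field.
by apply: has_int_ext => x _; rewrite mulrA mulfV // mul1r.
Qed.

Lemma has_int_bessel_down s v0 v1 : s <= 0 -> has_int 0 (V s) v0 ->
  has_int 0 (V (s - 1)) v1 -> has_int 0 (V (s - 2)) ((v0 - 2 * s * v1) / X ^+ 2).
Proof.
move=> s0 h0 h1.
have X2 : 0 < X ^+ 2 by rewrite exprn_gt0.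
have hg := has_intD (has_intZ 2^-1 h0) (has_intZ (- s) h1).
have cf r x : 0 < x -> {for x, continuous (V r)} by exact: continuous_bessel_fun.
have E : (\int[@lebesgue_measure R]_(x in `]0%R, +oo[) (X ^+ 2 / 2 * V (s - 2) x)%:E + 0%:E =
  \int[@lebesgue_measure R]_(x in `]0%R, +oo[)
    (2^-1 * V s x + - s * V (s - 1) x)%:E + 0%:E)%E.
  apply: (@integral_itvoy_sub R _ _ (V s)).
  - by move=> x _; rewrite mulr_ge0 ?bessel_fun_ge0 ?divr_ge0 ?sqr_ge0.
  - by move=> x _; apply: addr_ge0; apply: mulr_ge0; rewrite ?bessel_fun_ge0 ?oppr_ge0.
  - by move=> x x0; apply: continuousM; [exact: cst_continuous|exact: cf].
  - move=> x x0; apply: continuousD; (apply: continuousM; [exact: cst_continuous|exact: cf]).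
  - move=> x x0; have d := is_derive_bessel_fun s x0.
    by apply: is_derive_eq; ring.
  - exact: cvg0_bessel_fun.
  - exact: cvgy_bessel_fun.
move: E; rewrite !adde0 hg.2 => E.
have h : has_int 0 (fun x => X ^+ 2 / 2 * V (s - 2) x) (2^-1 * v0 + - s * v1).
  apply: has_int_ge0 => //.
  - by move=> x _; rewrite mulr_ge0 ?bessel_fun_ge0 ?divr_ge0 ?sqr_ge0.
  - by move=> x x0; apply: continuousM; [exact: cst_continuous|exact: cf].
have := has_intZ (2 / X ^+ 2) h.
have e : (v0 - 2 * s * v1) / X ^+ 2 = 2 / X ^+ 2 * (2^-1 * v0 + - s * v1).
  by field; rewrite gt_eqF.
rewrite -e; apply: has_int_ext => x _.
by field; rewrite gt_eqF.
Qed.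

Let M0 : R := Num.sqrt (2 * pi) * expR (- X).

(** The squares of [wm] and [wp] are x/2 + X^2/(2x) - X and the same with + X, so [gauss_fun] of
    either is the exponential in [bessel_fun] up to a constant factor. *)
Let wm x : R := (Num.sqrt x - X / Num.sqrt x) / Num.sqrt 2.
Let wp x : R := (Num.sqrt x + X / Num.sqrt x) / Num.sqrt 2.

Let s2 : 0 < Num.sqrt 2 :> R. Proof. by rewrite sqrtr_gt0. Qed.

Let cvg_wmy : wm x @[x --> +oo] --> +oo.
Proof.
apply/cvgryPge => A; near=> x.
have h1 : 1 <= x by near: x; apply: nbhs_pinfty_ge; exact: num_real.
have h2 : (`|A| * Num.sqrt 2 + X) ^+ 2 <= x by near: x; apply: nbhs_pinfty_ge; exact: num_real.
have q1 : 1 <= Num.sqrt x by rewrite -[leLHS]sqrtr1 ler_sqrt //; lra.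
have q2 : `|A| * Num.sqrt 2 + X <= Num.sqrt x.
  rewrite -[leLHS]ger0_norm; last by rewrite addr_ge0 ?mulr_ge0 // ltW.
  by rewrite -sqrtr_sqr ler_sqrt //; lra.
rewrite /wm ler_pdivlMr //.
have : X / Num.sqrt x <= X by rewrite ler_pdivrMr ?ler_peMr // ?ltW //; lra.
have : A * Num.sqrt 2 <= `|A| * Num.sqrt 2 by rewrite ler_pM2r // ler_norm.
lra.
Unshelve. all: by end_near. Qed.

Let wm_le_wp x : 0 < x -> wm x <= wp x.
Proof.
move=> x0; rewrite /wm /wp ler_pM2r ?invr_gt0 //.
have : 0 <= X / Num.sqrt x by rewrite divr_ge0 // ltW.
by lra.
Qed.

Let cvg_wpy : wp x @[x --> +oo] --> +oo.
Proof.
apply/cvgryPge => A; near=> x.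
have x0 : 0 < x by near: x; apply: nbhs_pinfty_gt; exact: num_real.
apply: le_trans (wm_le_wp x0).
by near: x; move/cvgryPge : cvg_wmy; exact.
Unshelve. all: by end_near. Qed.

Let cvg0_inv_sqrt B : \forall x \near 0^'+, B <= X / Num.sqrt x.
Proof.
near=> x; have x0 : 0 < x by [].
have B0 : 0 < 1 + `|B| by rewrite ltr_pwDl.
have h1 : x <= (X / (1 + `|B|)) ^+ 2.
  by near: x; apply: nbhs_right_le; rewrite exprn_gt0 // divr_gt0.
have q0 : 0 < Num.sqrt x by rewrite sqrtr_gt0.
have q1 : Num.sqrt x <= X / (1 + `|B|).
  rewrite -[leRHS]ger0_norm; last by rewrite divr_ge0 // ltW.
  by rewrite -sqrtr_sqr ler_sqrt // exprn_ge0 // divr_ge0 // ltW.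
rewrite ler_pdivlMr // mulrC -ler_pdivlMr // in q1.
apply: le_trans q1.
by have := ler_norm B; lra.
Unshelve. all: by end_near. Qed.

Let cvg_wp0 : wp x @[x --> 0^'+] --> +oo.
Proof.
apply/cvgryPge => A; near=> x.
rewrite /wp ler_pdivlMr //.
have : A * Num.sqrt 2 <= X / Num.sqrt x by near: x; exact: cvg0_inv_sqrt.
by have := sqrtr_ge0 x; lra.
Unshelve. all: by end_near. Qed.

Let cvg_wm0 : wm x @[x --> 0^'+] --> -oo.
Proof.
apply/cvgrNyPle => A; near=> x.
rewrite /wm ler_pdivrMr //.
have : 1 - A * Num.sqrt 2 <= X / Num.sqrt x by near: x; exact: cvg0_inv_sqrt.
have x1 : x <= 1 by near: x; exact: nbhs_right_le.
have : Num.sqrt x <= 1 by rewrite -[leRHS]sqrtr1 ler_sqrt.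
lra.
Unshelve. all: by end_near. Qed.

Let is_derive_w (e : R) x : 0 < x ->
  is_derive x (1 : R) (fun y : R => (Num.sqrt y + e * (X / Num.sqrt y)) / Num.sqrt 2)
    ((x `^ (- (1 / 2)) - e * X * x `^ (- (3 / 2))) / 2 / Num.sqrt 2).
Proof.
move=> x0; have q0 : 0 < Num.sqrt x by rewrite sqrtr_gt0.
have qn : Num.sqrt x != 0 by rewrite gt_eqF.
have d1 := is_derive1_sqrt x0.
have dV : is_derive x (1 : R) (fun y : R => (Num.sqrt y)^-1)
    (- (Num.sqrt x) ^- 2 *: (2 * Num.sqrt x)^-1).
  by have := is_deriveV qn d1.
have xq : x = Num.sqrt x ^+ 2 by rewrite sqr_sqrtr // ltW.
have e1 : x `^ (- (1 / 2)) = (Num.sqrt x)^-1.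
  by rewrite powRN div1r powR12_sqrt // ltW.
have e3 : x `^ (- (3 / 2)) = (Num.sqrt x)^-1 ^+ 3.
  rewrite (_ : - (3 / 2) = - (1 / 2) - 1); last by field.
  rewrite powRB ?(gt_eqF x0) ?implybT // e1 powRr1 ?(ltW x0) // {2}xq.
  by field.
rewrite e1 e3.
by apply: is_derive_eq; rewrite /GRing.scale /=; field; rewrite qn gt_eqF.
Qed.

Let gauss_wE (e : R) x : e ^+ 2 = 1 -> 0 < x ->
  gauss_fun ((Num.sqrt x + e * (X / Num.sqrt x)) / Num.sqrt 2) =
  expR (- (x / 2 + X ^+ 2 / 2 / x)) * expR (- (e * X)).
Proof.
move=> e2 x0; rewrite /gauss_fun -expRD; congr expR.
have q0 : 0 < Num.sqrt x by rewrite sqrtr_gt0.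
have xq : x = Num.sqrt x ^+ 2 by rewrite sqr_sqrtr // ltW.
have tq : Num.sqrt 2 ^+ 2 = 2 :> R by rewrite sqr_sqrtr.
rewrite expr_div_n tq [in RHS]xq; set u := Num.sqrt x in q0 *.
have -> : (u + e * (X / u)) ^+ 2 = u ^+ 2 + 2 * e * X + e ^+ 2 * X ^+ 2 / u ^+ 2.
  by field; rewrite gt_eqF.
by rewrite e2; field; rewrite gt_eqF.
Qed.

(** The derivatives of [wm] and [wp] contain X x^(-3/2) with opposite signs. For e = 1 that part
    cancels and [V (-1/2)] remains; for e = -1 the other part cancels and X times [V (-3/2)]
    remains. *)
Let is_derive_bessel_primitive (e : R) x : 0 < x ->
  is_derive x (1 : R)
    (fun y => Num.sqrt 2 * (expR (- X) * gauss_primitive (wm y) + e * expR X * gauss_primitive (wp y)))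
    ((1 + e) / 2 * V (- (1 / 2)) x + (1 - e) / 2 * X * V (- (3 / 2)) x).
Proof.
move=> x0; have := @is_derive_w (-1) x x0; have := @is_derive_w 1 x x0.
have wpE : (fun y : R => (Num.sqrt y + 1 * (X / Num.sqrt y)) / Num.sqrt 2) = wp.
  by apply/funext => y; rewrite mul1r.
have wmE : (fun y : R => (Num.sqrt y + -1 * (X / Num.sqrt y)) / Num.sqrt 2) = wm.
  by apply/funext => y; rewrite mulN1r.
rewrite wpE wmE => dp dm.
have gp : gauss_fun (wp x) = expR (- (x / 2 + X ^+ 2 / 2 / x)) * expR (- X).
  by rewrite -wpE gauss_wE ?mul1r // expr1n.
have gm : gauss_fun (wm x) = expR (- (x / 2 + X ^+ 2 / 2 / x)) * expR X.
  by rewrite -wmE gauss_wE ?mulN1r ?opprK // sqrrN expr1n.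
have Dp := is_derive1_comp (is_derive_gauss_primitive (wp x)) dp.
have Dm := is_derive1_comp (is_derive_gauss_primitive (wm x)) dm.
rewrite gp in Dp; rewrite gm in Dm.
have eX : expR (- X) * expR X = 1 by rewrite mulrC expRxMexpNx_1.
have Dm' : is_derive x (1 : R) (fun y => gauss_primitive (wm y)) _ := Dm.
have Dp' : is_derive x (1 : R) (fun y => gauss_primitive (wp y)) _ := Dp.
apply: is_derive_eq; rewrite /GRing.scale /= /V.
set E := expR (- (_ + _)); set a := x `^ _; set b := x `^ _.
transitivity ((expR (- X) * expR X) * (E * ((1 + e) / 2 * a + (1 - e) / 2 * X * b))).
  by field; rewrite gt_eqF.
by rewrite eX mul1r; ring.
Qed.

(** [wp] tends to +oo at both ends, so the large terms with exp(X) cancel in the difference of the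
    limits; [wm] runs from -oo to +oo and leaves sqrt(2 pi) exp(-X). *)
Let bessel_primitive_lim (e : R) :
  (fun y => Num.sqrt 2 * (expR (- X) * gauss_primitive (wm y) + e * expR X * gauss_primitive (wp y)))
     y @[y --> 0^'+] --> Num.sqrt 2 * (e * expR X * Num.sqrt pi) /\
  (fun y => Num.sqrt 2 * (expR (- X) * gauss_primitive (wm y) + e * expR X * gauss_primitive (wp y)))
     y @[y --> +oo] --> Num.sqrt 2 * (expR (- X) * Num.sqrt pi + e * expR X * Num.sqrt pi).
Proof.
split; (apply: cvgM; first exact: cvg_cst).
  rewrite -[X in _ --> X]add0r; apply: cvgD.
    rewrite -[X in _ --> X](mulr0 (expR (- X))); apply: cvgM; first exact: cvg_cst.
    exact: (cvg_comp _ _ cvg_wm0 (@cvg_gauss_primitiveNy R)).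
  apply: cvgM; first exact: cvg_cst.
  exact: (cvg_comp _ _ cvg_wp0 (@cvg_gauss_primitivey R)).
apply: cvgD; (apply: cvgM; first exact: cvg_cst).
  exact: (cvg_comp _ _ cvg_wmy (@cvg_gauss_primitivey R)).
exact: (cvg_comp _ _ cvg_wpy (@cvg_gauss_primitivey R)).
Qed.

Let sqrt2pi : Num.sqrt (2 * pi) = Num.sqrt 2 * Num.sqrt pi :> R.
Proof. by rewrite sqrtrM. Qed.

Lemma has_int_besselN12 : has_int 0 (V (- (1 / 2))) M0.
Proof.
have cf r x : 0 < x -> {for x, continuous (V r)} by exact: continuous_bessel_fun.
apply: has_int_ge0 => [x _|x x0|]; [exact: bessel_fun_ge0|exact: cf|].
have [l0 ly] := bessel_primitive_lim 1.
rewrite (_ : M0 = Num.sqrt 2 * (expR (- X) * Num.sqrt pi + 1 * expR X * Num.sqrt pi) -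
   Num.sqrt 2 * (1 * expR X * Num.sqrt pi)); last by rewrite /M0 sqrt2pi; ring.
apply: (integral_itvoy_FTC _ _ _ l0 ly) => [x _|x x0|x x0].
- exact: bessel_fun_ge0.
- exact: cf.
- have d := is_derive_bessel_primitive 1 x0.
  by apply: is_derive_eq; field.
Qed.

Lemma has_int_besselN32 : has_int 0 (V (- (3 / 2))) (M0 / X).
Proof.
have cf r x : 0 < x -> {for x, continuous (V r)} by exact: continuous_bessel_fun.
apply: has_int_ge0 => [x _|x x0|]; [exact: bessel_fun_ge0|exact: cf|].
have [l0 ly] := bessel_primitive_lim (-1).
have h : (\int[@lebesgue_measure R]_(x in `]0%R, +oo[) (X * V (- (3 / 2)) x)%:E = M0%:E)%E.
  rewrite (_ : M0 = Num.sqrt 2 * (expR (- X) * Num.sqrt pi + -1 * expR X * Num.sqrt pi) -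
     Num.sqrt 2 * (-1 * expR X * Num.sqrt pi)); last by rewrite /M0 sqrt2pi; ring.
  apply: (integral_itvoy_FTC _ _ _ l0 ly) => [x _|x x0|x x0].
  - by rewrite mulr_ge0 ?bessel_fun_ge0 // ltW.
  - by apply: continuousM; [exact: cst_continuous|exact: cf].
  - have d := is_derive_bessel_primitive (-1) x0.
    by apply: is_derive_eq; field.
have hX : has_int 0 (fun x => X * V (- (3 / 2)) x) M0.
  apply: has_int_ge0 h => x x0; first by rewrite mulr_ge0 ?bessel_fun_ge0 // ltW.
  by apply: continuousM; [exact: cst_continuous|exact: cf].
have := has_intZ X^-1 hX; rewrite [X^-1 * M0]mulrC => -[_ <-].
by apply: eq_integral => x _; rewrite mulrA mulVf ?mul1r // gt_eqF.
Qed.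

(** The exponents are -1/2 shifted by 0, 2, 4, -2 and -4: the powers of xi in [outer_pointwise]
    times the density. The recurrences reach them from -1/2 and -3/2. *)
Lemma has_int_bessel_moments :
  [/\ has_int 0 (V (- (1 / 2))) M0,
   has_int 0 (V (3 / 2)) ((3 + 3 * X + X ^+ 2) * M0),
   has_int 0 (V (- (5 / 2))) ((1 + X^-1) / X ^+ 2 * M0),
   has_int 0 (V (7 / 2)) ((105 + 105 * X + 45 * X ^+ 2 + 10 * X ^+ 3 + X ^+ 4) * M0) &
   has_int 0 (V (- (9 / 2)))
     ((1 + 6 / X + 15 / X ^+ 2 + 15 / X ^+ 3) / X ^+ 4 * M0)].
Proof.
have Xn : X != 0 by rewrite gt_eqF.
have h0 := has_int_besselN12; have hN1 := has_int_besselN32.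
have up s v1 v2 w : 0 <= s -> has_int 0 (V (s - 1)) v1 -> has_int 0 (V (s - 2)) v2 ->
    w = 2 * s * v1 + X ^+ 2 * v2 -> has_int 0 (V s) w.
  by move=> s0 k1 k2 ->; exact: has_int_bessel_up.
have down s v0 v1 w : s <= 0 -> has_int 0 (V s) v0 -> has_int 0 (V (s - 1)) v1 ->
    w = (v0 - 2 * s * v1) / X ^+ 2 -> has_int 0 (V (s - 2)) w.
  by move=> s0 k1 k2 ->; exact: has_int_bessel_down.
have eV s t v : s = t -> has_int 0 (V s) v -> has_int 0 (V t) v by move=> ->.
have h1 : has_int 0 (V (1 / 2)) ((1 + X) * M0).
  apply: (up _ M0 (M0 / X)); last by field.
  - by lra.
  - by apply: eV h0; field.
  - by apply: eV hN1; field.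
have h2 : has_int 0 (V (3 / 2)) ((3 + 3 * X + X ^+ 2) * M0).
  apply: (up _ ((1 + X) * M0) M0); last by field.
  - by lra.
  - by apply: eV h1; field.
  - by apply: eV h0; field.
have h3 : has_int 0 (V (5 / 2)) ((15 + 15 * X + 6 * X ^+ 2 + X ^+ 3) * M0).
  apply: (up _ ((3 + 3 * X + X ^+ 2) * M0) ((1 + X) * M0)); last by field.
  - by lra.
  - by apply: eV h2; field.
  - by apply: eV h1; field.
have h4 : has_int 0 (V (7 / 2)) ((105 + 105 * X + 45 * X ^+ 2 + 10 * X ^+ 3 + X ^+ 4) * M0).
  apply: (up _ ((15 + 15 * X + 6 * X ^+ 2 + X ^+ 3) * M0) ((3 + 3 * X + X ^+ 2) * M0)); last by field.
  - by lra.
  - by apply: eV h3; field.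
  - by apply: eV h2; field.
have hN2 : has_int 0 (V (- (5 / 2))) ((1 + X^-1) / X ^+ 2 * M0).
  apply: (eV (- (1 / 2) - 2)); first by field.
  apply: (down _ M0 (M0 / X)) => //; last by field.
  - by apply: eV hN1; field.
have hN3 : has_int 0 (V (- (7 / 2))) ((1 / X + 3 / X ^+ 2 + 3 / X ^+ 3) / X ^+ 2 * M0).
  apply: (eV (- (3 / 2) - 2)); first by field.
  apply: (down _ (M0 / X) ((1 + X^-1) / X ^+ 2 * M0)) => //; last by field.
  - by apply: eV hN2; field.
split=> //.
apply: (eV (- (5 / 2) - 2)); first by field.
apply: (down _ ((1 + X^-1) / X ^+ 2 * M0) ((1 / X + 3 / X ^+ 2 + 3 / X ^+ 3) / X ^+ 2 * M0)) => //.
- by apply: eV hN3; field.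
- by field.
Qed.

End BesselMoments.

(** * The slowly varying factor of the outer integral *)

Section OuterBounds.
Variable R : realType.
Implicit Types (x y z xi X : R).

(** The exponent is the beginning of the series of -ln(1-y), and the derivative collapses to -y^2
    times the exponential. *)
Lemma subr1_mulr_expR_le1 y : 0 <= y -> (1 - y) * expR (y + y ^+ 2 / 2) <= 1.
Proof.
move=> y0; have [->|yn] := eqVneq y 0.
  by rewrite subr0 mul1r expr0n /= mul0r addr0 expR0.
have yp : 0 < y by rewrite lt_neqAle eq_sym yn.
pose f x := (1 - x) * expR (x + x ^+ 2 / 2).
have df x : is_derive x (1 : R) f (- x ^+ 2 * expR (x + x ^+ 2 / 2)).
  have d2 : is_derive x (1 : R) (fun y : R => y + y ^+ 2 / 2) (1 + x).
    have := is_derive_exprn 2 (is_derive_id x (1 : R)); rewrite /= expr1 => dX.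
    by apply: is_derive_eq; rewrite /GRing.scale /=; field.
  have d3 : is_derive x (1 : R) (fun y : R => expR (y + y ^+ 2 / 2))
      (expR (x + x ^+ 2 / 2) * (1 + x)) by exact: (is_derive1_comp (f := expR)).
  by apply: is_derive_eq; rewrite /GRing.scale /=; ring.
have : f y <= f 0.
  apply: (@ler0_derive1_le_cc _ f 0 y); rewrite ?in_itv /= ?lexx ?(ltW yp) //.
  - move=> x _; rewrite derive1E; have [_ ->] := df x.
    by rewrite mulNr oppr_le0 mulr_ge0 ?sqr_ge0 ?expR_ge0.
  - apply: derivable_within_continuous => x _; by have [] := df x.
by rewrite /f subr0 mul1r expr0n /= mul0r addr0 expR0.
Qed.

(** Applied with y = 1/x: in (1-1/x)^n the linear part exp(-n/x) = exp(-X^2/(2x)) belongs to the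
    Bessel density, and this controls the rest. *)
Lemma max_subr_mul_expR y : 0 < y ->
  0 <= Num.max 0 (1 - y) * expR y <= 1 /\
  `|Num.max 0 (1 - y) * expR y - expR (- (y ^+ 2 / 2))| <= 4 * y ^+ 3.
Proof.
move=> y0; have ey := expR_gt0 y.
have h0 : (1 - y) * expR (y + y ^+ 2 / 2) <= 1 by apply: subr1_mulr_expR_le1; exact: ltW.
have q0 : 0 <= y ^+ 2 / 2 by rewrite divr_ge0 // sqr_ge0.
have h1 : (1 - y) * expR y <= expR (- (y ^+ 2 / 2)).
  rewrite expRN -[leRHS]mul1r ler_pdivlMr ?expR_gt0 //.
  by rewrite -mulrA -expRD.
have e1 : expR (- (y ^+ 2 / 2)) <= 1 by rewrite expR_le1 oppr_le0.
have e0 := expR_gt0 (- (y ^+ 2 / 2)).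
have [y1|y1] := leP 0 (1 - y); last first.
  rewrite mul0r lexx ler01; split => //; rewrite sub0r normrN gtr0_norm //.
  apply: le_trans e1 _.
  have : 1 <= y ^+ 3 by rewrite expr_ge1 //; lra.
  by lra.
split.
  by rewrite mulr_ge0 ?expR_ge0 //=; apply: le_trans h1 e1.
rewrite ler0_norm ?subr_le0 // opprB.
(* Here y <= 1, so exp(y/2) <= 1/(1-y/2) <= 2; this is the 4 of the statement. *)
have ey4 : expR y <= 4.
  have := expR_ge1Dx (- (y / 2)); rewrite expRN => h.
  have h2 : 0 < expR (y / 2) by exact: expR_gt0.
  have h3 : expR (y / 2) <= 2.
    rewrite -[expR (y / 2)]invrK -[leRHS]invrK lef_pV2 ?posrE ?invr_gt0 //; lra.
  have -> : expR y = expR (y / 2) * expR (y / 2) by rewrite -expRD; congr expR; field.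
  by nra.
pose z := y + y ^+ 2 / 2.
have z0 : 0 <= z by rewrite /z; lra.
have ez : 1 + z + z ^+ 2 / 2 <= expR z.
  pose f x := expR x - (1 + x + x ^+ 2 / 2).
  have df x : is_derive x (1 : R) f (expR x - (1 + x)).
    have := is_derive_exprn 2 (is_derive_id x (1 : R)); rewrite /= expr1 => dX.
    by apply: is_derive_eq; rewrite /GRing.scale /=; field.
  have [->|zn] := eqVneq z 0; first by rewrite expR0 expr0n /= mul0r !addr0.
  have : f 0 <= f z.
    apply: (@ger0_derive1_le_cc _ f 0 z); rewrite ?in_itv /= ?lexx ?z0 //.
    - move=> x _; rewrite derive1E; have [_ ->] := df x.
      by rewrite subr_ge0 expR_ge1Dx.
    - apply: derivable_within_continuous => x _; by have [] := df x.
  by rewrite /f expR0 expr0n /= mul0r !addr0 subrr subr_ge0.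
have d : expR (- z) - (1 - y) <= y ^+ 3.
  have z2 : 0 < 1 + z + z ^+ 2 / 2 by have := sqr_ge0 z; lra.
  have : expR (- z) <= (1 + z + z ^+ 2 / 2)^-1 by rewrite expRN lef_pV2 ?posrE ?expR_gt0.
  have : (1 + z + z ^+ 2 / 2)^-1 <= 1 - y + y ^+ 3.
    rewrite -[leLHS]mul1r ler_pdivrMr //.
    have -> : (1 - y + y ^+ 3) * (1 + z + z ^+ 2 / 2) =
      1 + y ^+ 3 * (1 / 2 + y * (5 / 8) + y ^+ 2 * (7 / 8) + y ^+ 3 / 2 + y ^+ 4 / 8).
      by rewrite /z; field.
    have y3 : 0 <= y ^+ 3 by rewrite exprn_ge0 // ltW.
    rewrite lerDl mulr_ge0 // !addr_ge0 ?mulr_ge0 ?exprn_ge0 ?(ltW y0) //; lra.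
  by lra.
have -> : expR (- (y ^+ 2 / 2)) = expR (- z) * expR y.
  by rewrite -expRD; congr expR; rewrite /z; ring.
rewrite -mulrBl mulrC; apply: ler_pM => //.
rewrite subr_ge0.
by rewrite -(ler_pM2r ey) -expRD /z (_ : - (y + y ^+ 2 / 2) + y = - (y ^+ 2 / 2)) //; ring.
Qed.

(* The logarithm of the product is critical at [xi = 1], with value [- 3 / 8]. *)
Lemma outer_critical xi : 0 < xi ->
  `|xi `^ (- (1 / 4)) * expR (- (xi ^+ 2 / 8)) * expR (- (1 / (4 * xi ^+ 2)))
     - expR (- (3 / 8))| <= (xi ^+ 2 - 2 + (xi ^+ 2)^-1) / 4.
Proof.
move=> x0; pose z := xi ^+ 2; have z0 : 0 < z by rewrite exprn_gt0.
pose L := ln xi.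
have xE : xi = expR L by rewrite lnK.
have zE : z = expR (2 * L) by rewrite /z xE -expRM_natl.
have zV : z^-1 = expR (- (2 * L)) by rewrite zE expRN.
have l1 : 2 * L <= z - 1 by have := expR_ge1Dx (2 * L); rewrite -zE; lra.
have l2 : 1 - z^-1 <= 2 * L by have := expR_ge1Dx (- (2 * L)); rewrite -zV; lra.
pose w := L / 4 + (z - 1) / 8 + (z^-1 - 1) / 4.
have w0 : 0 <= w.
  have : 0 <= (z - 2 + z^-1) / 8.
    have -> : (z - 2 + z^-1) / 8 = (z - 1) ^+ 2 / z / 8 by field; rewrite gt_eqF.
    by rewrite !divr_ge0 ?sqr_ge0 ?ltW.
  by rewrite /w; lra.
have w1 : w <= (z - 2 + z^-1) / 4 by rewrite /w; lra.
have -> : xi `^ (- (1 / 4)) * expR (- (xi ^+ 2 / 8)) * expR (- (1 / (4 * xi ^+ 2))) =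
   expR (- (3 / 8)) * expR (- w).
  rewrite {1}xE -expRM -!expRD -/z; congr expR.
  by rewrite /w; field; rewrite gt_eqF.
rewrite -[X in _ - X]mulr1 -mulrBr normrM gtr0_norm ?expR_gt0 //.
have e1 : expR (- (3 / 8) : R) <= 1 by rewrite expR_le1; lra.
have := norm_expRN_sub w0 (lexx 0); rewrite oppr0 expR0 addr0 (ger0_norm w0) => h.
apply: le_trans (le_trans h w1).
by rewrite -[leRHS]mul1r ler_wpM2r.
Qed.

End OuterBounds.

Section OuterIntegrand.
Variable R : realType.
Notation mu := (@lebesgue_measure R).

Let X (n : nat) : R := Num.sqrt (2 * n%:R).

Definition outer_weight (n : nat) : R :=
  (2 * n)`!%:R * (2 * n%:R) `^ (- (3 / 4)) * Num.sqrt (2 * n%:R) `^ (- (1 / 4)).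

Let A (n : nat) (x : R) : R := (Num.max 0 (1 - x^-1) * expR x^-1) ^+ n.

Lemma rem_inner n (x : R) : (3 <= n)%N -> 0 < x ->
  exists2 v, `|v - expR (- ((x / X n) ^+ 2 / 8))| <= 62 * (1 + (x / X n) ^+ 4) / X n &
  (\int[mu]_(t in `](x / 2)%R, +oo[)
     (rem_kernel (n%:R - 3 / 4) (- n%:R - 3 / 4) n t x)%:E =
   (outer_weight n * bessel_fun (X n) (- (1 / 2)) x *
     ((x / X n) `^ (- (1 / 4)) * A n x * v))%:E)%E.
Proof.
move=> n3 x0; have n0 : (0 < n)%N by apply: leq_trans n3.
have X1 := sqrt2n_ge1 R n0; rewrite -/(X n) in X1.
have X2 := sqr_sqrt2n R n; rewrite -/(X n) in X2.
have X0 : 0 < X n by lra.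
have [vf hf dv] := inner_estimate n3 x0; rewrite -/(X n) in dv.
have W0 : 0 < inner_weight n x.
  rewrite /inner_weight mulr_gt0 ?expR_gt0 // mulr_gt0 ?powR_gt0 ?ltr0n ?fact_gt0 //.
  by rewrite mulr_gt0 // ltr0n.
exists (vf / inner_weight n x).
  rewrite -(ler_pM2l W0) -(gtr0_norm W0) -normrM (gtr0_norm W0).
  by rewrite mulrBr mulrC mulfVK // gt_eqF.
have [_ h] := has_intZ (Num.max 0 (x - 1) ^+ n * x `^ (- n%:R - 3 / 4)) hf.
rewrite (_ : integral _ _ _ = (Num.max 0 (x - 1) ^+ n * x `^ (- n%:R - 3 / 4) * vf)%:E); last first.
  by rewrite -h; apply: eq_integral => t _; rewrite /rem_kernel mulrC.
congr EFin.
have -> : Num.max 0 (x - 1) ^+ n = x ^+ n * Num.max 0 (1 - x^-1) ^+ n.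
  by rewrite -exprMn maxr_pMr ?(ltW x0) // mulr0 mulrBr mulr1 mulfV // gt_eqF.
have xn : x != 0 by rewrite gt_eqF.
have Xn : X n != 0 by rewrite gt_eqF.
(* The part x^(-1/2) goes to the density, for which the primitive is elementary; x^(-1/4) is left to
   the slowly varying factor. *)
have -> : x `^ (- n%:R - 3 / 4) = (x ^+ n)^-1 * (x `^ (- (1 / 2)) * x `^ (- (1 / 4))).
  rewrite -powRD ?xn ?implybT // -powR_mulrn ?(ltW x0) // -powRN -powRD ?xn ?implybT //.
  by congr (_ `^ _); field.
have -> : (x / X n) `^ (- (1 / 4)) = x `^ (- (1 / 4)) * X n `^ (1 / 4).
  rewrite powRM ?invr_ge0 ?(ltW x0) ?(ltW X0) //; congr (_ * _).
  by rewrite -(powR_inv1 (ltW X0)) -powRrM; congr (_ `^ _); ring.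
rewrite /outer_weight -/(X n) /inner_weight /bessel_fun /A exprMn -expRM_natl X2.
have -> : expR (- (x / 2 + 2 * n%:R / 2 / x)) = expR (- (x / 2)) * (expR (n%:R * x^-1))^-1.
  by rewrite -expRN -expRD; congr expR; field.
have XX : X n `^ (- (1 / 4)) * X n `^ (1 / 4) = 1.
  by rewrite powRN mulVf // gt_eqF // powR_gt0.
have N34 : (2 * n%:R) `^ (- (3 / 4)) != 0 :> R.
  by rewrite gt_eqF // powR_gt0 // mulr_gt0 // ltr0n.
have f0 : (2 * n)`!%:R != 0 :> R by rewrite pnatr_eq0 -lt0n fact_gt0.
set b := X n `^ (1 / 4) in XX *; set c := X n `^ (- (1 / 4)) in XX *.
have b0 : b != 0 by rewrite gt_eqF // powR_gt0.
have -> : c = b^-1 by rewrite -[c](mulfK b0) XX mul1r.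
have e1 : expR (n%:R * x^-1) != 0 by rewrite gt_eqF // expR_gt0.
have e2 : expR (- (x / 2)) != 0 by rewrite gt_eqF // expR_gt0.
have xp : x ^+ n != 0 by rewrite expf_neq0.
by field; rewrite xp e1 e2 N34 f0 b0.
Qed.

Lemma outer_pointwise n (x v : R) : (3 <= n)%N -> 0 < x ->
  let xi := x / X n in
  `|v - expR (- (xi ^+ 2 / 8))| <= 62 * (1 + xi ^+ 4) / X n ->
  `|xi `^ (- (1 / 4)) * A n x * v - expR (- (3 / 8))| <=
    (xi ^+ 2 - 2 + (xi ^+ 2)^-1) / 4 + 260 / X n * (1 + xi ^+ 4 + (xi ^+ 4)^-1).
Proof.
move=> n3 x0 xi dv; have n0 : (0 < n)%N by apply: leq_trans n3.
have X1 := sqrt2n_ge1 R n0; rewrite -/(X n) in X1.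
have X2 := sqr_sqrt2n R n; rewrite -/(X n) in X2.
have X0 : 0 < X n by lra.
have xi0 : 0 < xi by rewrite divr_gt0.
have y0 : 0 < x^-1 by rewrite invr_gt0.
have [B01 dB] := max_subr_mul_expR y0.
have E01 : 0 <= expR (- (x^-1 ^+ 2 / 2)) <= 1.
  by rewrite expR_ge0 expR_le1 oppr_le0 divr_ge0 ?sqr_ge0.
have dA := norm_exprn_sub n B01 E01; rewrite -/(A n x) in dA.
have A01 : 0 <= A n x <= 1.
  by case/andP: B01 => b0 b1; rewrite exprn_ge0 // exprn_ile1.
have nE : n%:R = X n ^+ 2 / 2 by rewrite X2; field.
have EnE : expR (- (x^-1 ^+ 2 / 2)) ^+ n = expR (- (1 / (4 * xi ^+ 2))).
  by rewrite -expRM_natl nE /xi; congr expR; field; rewrite !gt_eqF.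
rewrite EnE in dA.
have {}dA : `|A n x - expR (- (1 / (4 * xi ^+ 2)))| <= 2 / X n / xi ^+ 3.
  apply: le_trans dA _; apply: le_trans (ler_wpM2l (ler0n _ _) dB) _.
  by rewrite nE /xi le_eqVlt; apply/orP; left; apply/eqP; field; rewrite !gt_eqF.
have crit := outer_critical xi0.
set p := xi `^ (- (1 / 4)) in crit *.
set E8 := expR (- (xi ^+ 2 / 8)) in dv crit *.
set E4 := expR (- (1 / (4 * xi ^+ 2))) in dA crit *.
set E := expR (- (3 / 8)) in crit *.
have p0 : 0 <= p by exact: powR_ge0.
have p1 : p <= 1 + xi^-1.
  have -> : p = xi^-1 `^ (1 / 4).
    by rewrite /p -(powR_inv1 (ltW xi0)) -powRrM; congr (_ `^ _); ring.
  by apply: powR_le1D; [lra|rewrite invr_gt0].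
have e8 : 0 <= E8 <= 1 by rewrite expR_ge0 expR_le1 oppr_le0 divr_ge0 ?sqr_ge0.
have d1 : `|A n x * v - E4 * E8| <= 62 * (1 + xi ^+ 4) / X n + 2 / X n / xi ^+ 3.
  have -> : A n x * v - E4 * E8 = A n x * (v - E8) + (A n x - E4) * E8 by ring.
  apply: le_trans (ler_normD _ _) _; rewrite !normrM; apply: lerD.
    case/andP: A01 => a0 a1; rewrite (ger0_norm a0); apply: le_trans dv.
    by rewrite -[leRHS]mul1r ler_wpM2r.
  case/andP: e8 => e0 e1; rewrite (ger0_norm e0); apply: le_trans dA.
  by rewrite -[leRHS]mulr1 ler_wpM2l.
have d2 : `|p * (A n x * v - E4 * E8)| <= 260 / X n * (1 + xi ^+ 4 + (xi ^+ 4)^-1).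
  rewrite normrM (ger0_norm p0).
  apply: le_trans (ler_pM p0 (normr_ge0 _) p1 d1) _.
  have -> : (1 + xi^-1) * (62 * (1 + xi ^+ 4) / X n + 2 / X n / xi ^+ 3) =
     (62 * (1 + xi ^+ 4 + xi^-1 + xi ^+ 3) + 2 * (xi^-1 ^+ 3 + (xi ^+ 4)^-1)) / X n.
    by field; rewrite !gt_eqF.
  have -> : 260 / X n * (1 + xi ^+ 4 + (xi ^+ 4)^-1) = 260 * (1 + xi ^+ 4 + (xi ^+ 4)^-1) / X n.
    by field; rewrite !gt_eqF // exprn_gt0.
  rewrite ler_pM2r ?invr_gt0 // -exprVn.
  set u := xi^-1; have u0 : 0 < u by rewrite invr_gt0.
  have k1 : u <= 1 + u ^+ 4.
    by have := sqr_ge0 (u ^+ 2 - 1); have := sqr_ge0 (u - 1); rewrite !exprS expr0; nra.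
  have k2 : u ^+ 3 <= 1 + u ^+ 4.
    have := sqr_ge0 (u ^+ 2 - 1); have := sqr_ge0 (u ^+ 2 - u).
    by rewrite !exprS expr0; nra.
  have k3 : xi ^+ 3 <= 1 + xi ^+ 4.
    have := sqr_ge0 (xi ^+ 2 - 1); have := sqr_ge0 (xi ^+ 2 - xi).
    by rewrite !exprS expr0; nra.
  have : 0 <= u ^+ 4 by rewrite exprn_ge0 // ltW.
  have : 0 <= xi ^+ 4 by rewrite exprn_ge0 // ltW.
  by lra.
have -> : p * A n x * v - E = (p * E8 * E4 - E) + p * (A n x * v - E4 * E8) by ring.
by apply: le_trans (ler_normD _ _) _; apply: lerD.
Qed.

End OuterIntegrand.

Section OuterIntegral.
Variable R : realType.
Notation mu := (@lebesgue_measure R).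

Let X (n : nat) : R := Num.sqrt (2 * n%:R).

Lemma measurable_rem_inner n : (0 < n)%N ->
  measurable_fun (`]0, +oo[%classic : set (measurableTypeR R))
    (fun x => fine (\int[mu]_(t in `](x / 2)%R, +oo[)
      (rem_kernel (n%:R - 3 / 4) (- n%:R - 3 / 4) n t x)%:E)%E).
Proof.
move=> n0.
apply: (eq_measurable_fun (fun x => fine (\int[mu]_t
   (rem_kernel (n%:R - 3 / 4) (- n%:R - 3 / 4) n t x)%:E)%E)).
  move=> x; rewrite inE /= in_itv /= andbT => x0; congr fine.
  apply: integralT_support => t /=.
  rewrite in_itv /= andbT => /negP; rewrite -leNgt => tx.
  rewrite rem_kernel_eq0 //; apply/orP; left; apply: le_trans tx _.
  by lra.
apply: measurable_funTS; apply: measurableT_comp; first exact: fine_measurable.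
apply: (@measurable_fun_fubini_tonelli_G _ _ _ _ _ mu
  (fun z : R * R => (rem_kernel (n%:R - 3 / 4) (- n%:R - 3 / 4) n z.1 z.2)%:E)).
  exact: measurable_rem_kernel.
by move=> z; rewrite lee_fin rem_kernel_ge0.
Qed.

(** By the exact moments the mean of (xi^2 - 2 + xi^(-2))/4 is 1/X + 3/(4X^2): the critical point
    turns a quadratic error into O(1/X). *)
Lemma rem_integral_estimate n : (3 <= n)%N ->
  exists2 v, rem_integral R n = v%:E &
  `|v - outer_weight R n * (Num.sqrt (2 * pi) * expR (- X n)) * expR (- (3 / 8))| <=
   outer_weight R n * (Num.sqrt (2 * pi) * expR (- X n)) * (10 ^+ 5 / X n).
Proof.
move=> n3; have n0 : (0 < n)%N by apply: leq_trans n3.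
have X1 := sqrt2n_ge1 R n0; rewrite -/(X n) in X1.
have X2 := sqr_sqrt2n R n; rewrite -/(X n) in X2.
have X0 : 0 < X n by lra.
have [h0 h2 hN2 h4 hN4] := has_int_bessel_moments X1.
set M := Num.sqrt (2 * pi) * expR (- X n) in h0 h2 hN2 h4 hN4 *.
set ow := outer_weight R n.
have ow0 : 0 < ow.
  rewrite /ow /outer_weight -/(X n) !mulr_gt0 ?powR_gt0 ?mulr_gt0 ?ltr0n ?fact_gt0 //.
have M0 : 0 < M by rewrite mulr_gt0 ?expR_gt0 // sqrtr_gt0 mulr_gt0 // pi_gt0.
have hg := has_intZ (ow * expR (- (3 / 8))) h0.
have he := has_intD (has_intD (has_intD (has_intD
  (has_intZ (ow / 4 / X n ^+ 2) h2) (has_intZ (ow * (260 / X n - 1 / 2)) h0))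
  (has_intZ (ow * X n ^+ 2 / 4) hN2)) (has_intZ (ow * (260 / X n) / X n ^+ 4) h4))
  (has_intZ (ow * (260 / X n) * X n ^+ 4) hN4).
have bnd (x : R) : 0 < x ->
  `|fine (\int[mu]_(t in `](x / 2)%R, +oo[)
      (rem_kernel (n%:R - 3 / 4) (- n%:R - 3 / 4) n t x)%:E)%E -
    ow * expR (- (3 / 8)) * bessel_fun (X n) (- (1 / 2)) x| <=
  ow / 4 / X n ^+ 2 * bessel_fun (X n) (3 / 2) x +
  ow * (260 / X n - 1 / 2) * bessel_fun (X n) (- (1 / 2)) x +
  ow * X n ^+ 2 / 4 * bessel_fun (X n) (- (5 / 2)) x +
  ow * (260 / X n) / X n ^+ 4 * bessel_fun (X n) (7 / 2) x +
  ow * (260 / X n) * X n ^+ 4 * bessel_fun (X n) (- (9 / 2)) x.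
  move=> x0; have [v dv ->] := rem_inner n3 x0.
  have := outer_pointwise n3 x0 dv; rewrite -/(X n) -/ow /=.
  set V := bessel_fun _ (- (1 / 2)) x.
  set c := _ * _ * v => hc.
  have V0 : 0 <= ow * V by rewrite mulr_ge0 ?bessel_fun_ge0 // ltW.
  have -> : ow * V * c - ow * expR (- (3 / 8)) * V = ow * V * (c - expR (- (3 / 8))) by ring.
  rewrite normrM (ger0_norm V0); apply: le_trans (ler_wpM2l V0 hc) _.
  have xn : x != 0 by rewrite gt_eqF.
  have Vp k : bessel_fun (X n) (- (1 / 2) + k%:R) x = x ^+ k * V.
    by rewrite /V /bessel_fun powRD ?xn ?implybT // powR_mulrn ?ltW //; ring.
  have VN k : bessel_fun (X n) (- (1 / 2) - k%:R) x = x ^- k * V.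
    by rewrite /V /bessel_fun powRB ?xn ?implybT // powR_mulrn ?ltW //; ring.
  have -> : bessel_fun (X n) (3 / 2) x = x ^+ 2 * V.
    by rewrite -Vp; congr bessel_fun; field.
  have -> : bessel_fun (X n) (7 / 2) x = x ^+ 4 * V.
    by rewrite -Vp; congr bessel_fun; field.
  have -> : bessel_fun (X n) (- (5 / 2)) x = x ^- 2 * V.
    by rewrite -VN; congr bessel_fun; field.
  have -> : bessel_fun (X n) (- (9 / 2)) x = x ^- 4 * V.
    by rewrite -VN; congr bessel_fun; field.
  by rewrite le_eqVlt; apply/orP; left; apply/eqP; field; rewrite xn gt_eqF.
have [v [_ hv] dv] := has_int_sandwich (measurable_rem_inner n0) bnd hg he.
exists v.
  rewrite -hv /rem_integral; apply: eq_integral => x; rewrite inE /= in_itv /= andbT => x0.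
  by have [w _ ->] := rem_inner n3 x0.
have -> : ow * M * expR (- (3 / 8)) = ow * expR (- (3 / 8)) * M by ring.
apply: le_trans dv _.
pose u := (X n)^-1.
have u0 : 0 < u by rewrite invr_gt0.
have u1 : u <= 1 by rewrite invf_le1.
(* For u <= 1 the factor of u is at most 1 + 3/4 + 260 * 304, which is below 10^5. *)
rewrite [leLHS](_ : _ = ow * M * (u * (1 + 3 / 4 * u + 260 * (3 +
   (10 + 45 * u ^+ 1 + 105 * u ^+ 2 + 105 * u ^+ 3) * u + 6 * u + 15 * u ^+ 2 + 15 * u ^+ 3)))); last first.
  by rewrite /u; field; rewrite gt_eqF.
have uk k : u ^+ k <= 1 by rewrite exprn_ile1 // ltW.
have owM : 0 < ow * M by rewrite mulr_gt0.
rewrite (ler_pM2l owM) -/u [leRHS]mulrC (ler_pM2l u0).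
rewrite expr1; have := uk 2; have := uk 3; have := uk 4 => k4 k3 k2.
have -> : (10 + 45 * u + 105 * u ^+ 2 + 105 * u ^+ 3) * u =
  10 * u + 45 * u ^+ 2 + 105 * u ^+ 3 + 105 * u ^+ 4 by ring.
lra.
Qed.

End OuterIntegral.

(** * Asymptotics of the denominators *)

Section ExpPartialSums.
Variable R : realType.
Implicit Types (x : R) (L k i : nat).

Definition exp_sum x L : R := \sum_(i < L) x ^+ i / i`!%:R.

Lemma exp_sumE x L : exp_sum x L = series (exp_coeff x) L.
Proof. by rewrite /series /= big_mkord. Qed.

Lemma exp_sumS x L : exp_sum x L.+1 = exp_sum x L + x ^+ L / L`!%:R.
Proof. by rewrite /exp_sum big_ord_recr. Qed.

Lemma exp_sum_le_expR x L : 0 <= x -> exp_sum x L <= expR x.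
Proof.
move=> x0; rewrite exp_sumE /expR; apply: nondecreasing_cvgn_le.
  by apply: nondecreasing_series => i _ _; exact: exp_coeff_ge0.
exact: is_cvg_series_exp_coeff.
Qed.

Lemma exp_sum_ge0 x L : 0 <= x -> 0 <= exp_sum x L.
Proof. by move=> x0; apply: sumr_ge0 => i _; rewrite divr_ge0 ?exprn_ge0. Qed.

Lemma exp_sum_mono x L K : 0 <= x -> (L <= K)%N -> exp_sum x L <= exp_sum x K.
Proof.
move=> x0 LK; rewrite -(subnK LK); elim: (K - L)%N => [|d ih] //.
by rewrite addSn exp_sumS; apply: le_trans ih _; rewrite lerDl divr_ge0 ?exprn_ge0.
Qed.

Lemma natr_ffact i k : (i ^_ k)%:R = \prod_(j < k) (i%:R - j%:R) :> R.
Proof.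
elim: k => [|k ih]; first by rewrite big_ord0.
rewrite big_ord_recr /= -ih ffactnSr natrM.
by have [ki|ik] := leqP k i; [rewrite natrB|rewrite ffact_small // !mul0r].
Qed.

(** Factorial moments: the falling factorial cancels against i!, which shifts the index and shortens
    the truncation by k. *)
Lemma exp_sum_ffact x L k :
  \sum_(i < L) x ^+ i / i`!%:R * (i ^_ k)%:R = x ^+ k * exp_sum x (L - k).
Proof.
elim: L => [|L ih]; first by rewrite big_ord0 sub0n /exp_sum big_ord0 mulr0.
rewrite big_ord_recr /= ih; have [kL|Lk] := leqP k L; last first.
  by rewrite ffact_small // mulr0 addr0 (eqP (ltnW Lk)) (eqP Lk).
rewrite subSn // exp_sumS mulrDr; congr (_ + _).
rewrite -(ffact_fact kL) natrM.
have f0 : (L ^_ k)%:R != 0 :> R by rewrite pnatr_eq0 -lt0n ffact_gt0.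
have f1 : (L - k)`!%:R != 0 :> R by rewrite pnatr_eq0 -lt0n fact_gt0.
have -> : x ^+ L = x ^+ k * x ^+ (L - k) by rewrite -exprD subnKC.
by field; rewrite f0 f1.
Qed.

(** Chebyshev's argument with the second factorial moment: i(i-1) >= L(L-1) throughout the tail. *)
Lemma exp_sum_tail x L K : 0 <= x -> (1 < L)%N -> (L <= K)%N ->
  exp_sum x K - exp_sum x L <= x ^+ 2 * expR x / (L%:R * (L%:R - 1)).
Proof.
move=> x0 L1 LK.
have L2 : 1 < L%:R :> R by rewrite ltr1n.
have LL : 0 < L%:R * (L%:R - 1) :> R by rewrite mulr_gt0; lra.
rewrite ler_pdivlMr //.
apply: le_trans (_ : \sum_(i < K) x ^+ i / i`!%:R * (i ^_ 2)%:R <= _); last first.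
  rewrite exp_sum_ffact ler_wpM2l ?exprn_ge0 //; exact: exp_sum_le_expR.
rewrite -(subnK LK); elim: (K - L)%N => [|d ih].
  by rewrite subrr mul0r sumr_ge0 // => i _; rewrite mulr_ge0 // divr_ge0 ?exprn_ge0.
rewrite addSn exp_sumS big_ord_recr /= addrAC mulrDl lerD //.
rewrite ler_wpM2l ?divr_ge0 ?exprn_ge0 //.
rewrite natr_ffact !big_ord_recr big_ord0 /= mul1r subr0.
have : L%:R <= (d + L)%:R :> R by rewrite ler_nat leq_addl.
by move=> h; apply: ler_pM; lra.
Qed.

Lemma exp_sum_error x L : (1 < L)%N ->
  `|expR x - exp_sum x L| <= `|x| ^+ 2 * expR `|x| / (L%:R * (L%:R - 1)).
Proof.
move=> L1; rewrite distrC.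
have key K : (L <= K)%N -> `|exp_sum x L - exp_sum x K| <=
    `|x| ^+ 2 * expR `|x| / (L%:R * (L%:R - 1)).
  move=> LK; apply: le_trans (exp_sum_tail (normr_ge0 x) L1 LK).
  rewrite -(subnK LK); elim: (K - L)%N => [|d ih]; first by rewrite !subrr normr0.
  rewrite addSn !exp_sumS opprD addrA; apply: le_trans (ler_normB _ _) _.
  by rewrite addrAC lerD // normrM normrX normfV (ger0_norm (ler0n _ _)).
have cv : (fun K => `|exp_sum x L - exp_sum x K|) @ \oo --> `|exp_sum x L - expR x|.
  apply: cvg_norm; apply: cvgB; first exact: cvg_cst.
  rewrite (_ : exp_sum x = series (exp_coeff x)); last by apply/funext => K; exact: exp_sumE.
  exact: is_cvg_series_exp_coeff.
apply: (cvgr_to_le cv); near=> K; apply: key.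
by near: K; exact: nbhs_infty_ge.
Unshelve. all: by end_near. Qed.

(** The coefficients 1, 6, 7, 1 are the Stirling numbers that express i^4 in falling factorials. *)
Lemma poisson_moment4 x L : 0 <= x ->
  \sum_(i < L) x ^+ i / i`!%:R * (i%:R ^+ 4) <=
    (x ^+ 4 + 6 * x ^+ 3 + 7 * x ^+ 2 + x) * expR x.
Proof.
move=> x0.
rewrite (eq_bigr (fun i : 'I_L => x ^+ i / i`!%:R * (i ^_ 4)%:R +
  6 * (x ^+ i / i`!%:R * (i ^_ 3)%:R) + 7 * (x ^+ i / i`!%:R * (i ^_ 2)%:R) +
  x ^+ i / i`!%:R * (i ^_ 1)%:R)); last first.
  move=> i _; rewrite !natr_ffact !big_ord_recr !big_ord0 /=; ring.
rewrite !big_split /= -!mulr_sumr !exp_sum_ffact !mulrDl expr1 -!mulrA.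
by rewrite !lerD // ?ler_wpM2l ?exprn_ge0 // exp_sum_le_expR.
Qed.

Lemma exp_term_le_expR x k : 0 <= x -> x ^+ k / k`!%:R <= expR x.
Proof.
move=> x0; apply: le_trans (exp_sum_le_expR k.+1 x0).
by rewrite exp_sumS lerDr; exact: exp_sum_ge0.
Qed.

(** For the full series the value is (4x^3 + 7x^2 + x) exp(x), the terms in x^4 cancelling.
    Truncated, they carry partial sums of lengths L-2, L and L+2, and cancel only up to two boundary
    terms; the condition on [L] makes each of these at most exp(x)/(2x). *)
Lemma poisson_concentration x L : 1 <= x -> 2 * x ^+ 2 <= L%:R ->
  \sum_(i < L.+2) x ^+ i / i`!%:R * (i%:R ^+ 2 - x ^+ 2) ^+ 2 <= 15 * x ^+ 3 * expR x.
Proof.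
move=> x1 xL; have x0 : 0 <= x by lra.
rewrite (eq_bigr (fun i : 'I_L.+2 => x ^+ i / i`!%:R * (i ^_ 4)%:R +
  6 * (x ^+ i / i`!%:R * (i ^_ 3)%:R) + (7 - 2 * x ^+ 2) * (x ^+ i / i`!%:R * (i ^_ 2)%:R) +
  (1 - 2 * x ^+ 2) * (x ^+ i / i`!%:R * (i ^_ 1)%:R) +
  x ^+ 4 * (x ^+ i / i`!%:R * (i ^_ 0)%:R))); last first.
  move=> i _; rewrite !natr_ffact !big_ord_recr !big_ord0 /=; ring.
rewrite !big_split /= -!mulr_sumr !exp_sum_ffact expr1 expr0 mul1r subn0.
have -> : (L.+2 - 2 = L)%N by rewrite subn2.
set e := expR x.
have e0 : 0 < e by exact: expR_gt0.
have h4 : exp_sum x (L.+2 - 4) <= exp_sum x L by apply: exp_sum_mono => //; lia.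
have h3 : exp_sum x (L.+2 - 3) <= e by exact: exp_sum_le_expR.
have h2 : exp_sum x L <= e by exact: exp_sum_le_expR.
have h1 : exp_sum x (L.+2 - 1) <= e by exact: exp_sum_le_expR.
have h1' := exp_sum_ge0 (L.+2 - 1) x0.
have w k : (k`!%:R != 0 :> R) by rewrite pnatr_eq0 -lt0n fact_gt0.
have L0 : 0 < L%:R :> R by have := sqr_ge0 (x - 1); nra.
have wL k : (L <= k.+1)%N -> x ^+ k.+1 / k.+1`!%:R <= x * e / L%:R.
  move=> Lk; have k0 : 0 < k.+1%:R :> R by rewrite ltr0n.
  have := exp_term_le_expR k x0.
  move=> h; rewrite factS natrM exprS.
  have -> : x * x ^+ k / (k.+1%:R * k`!%:R) = x * (x ^+ k / k`!%:R) / k.+1%:R.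
    by rewrite invfM; ring.
  apply: ler_pM; rewrite ?invr_ge0 ?mulr_ge0 ?divr_ge0 ?exprn_ge0 //.
    by rewrite ler_wpM2l.
  by rewrite lef_pV2 ?posrE // ler_nat.
have h0 : exp_sum x L.+2 <= exp_sum x L + 2 * (x * e / L%:R).
  rewrite !exp_sumS -addrA lerD2l.
  have [l lE] : exists l, L = l.+1 by exists L.-1; rewrite prednK // -(ltr_nat R).
  have := wL L (leqnSn _); have := wL l; rewrite -lE => /(_ (leqnn _)).
  lra.
have hL : x * e / L%:R <= e / (2 * x).
  rewrite ler_pdivrMr // mulrAC ler_pdivlMr; last by lra.
  have : 0 <= e * (L%:R - 2 * x ^+ 2) by rewrite mulr_ge0 ?subr_ge0 // ltW.
  nra.
have hx : x ^+ 4 * (e / (2 * x)) = x ^+ 3 * e / 2 by field; rewrite gt_eqF; lra.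
have x4 : 0 <= x ^+ 4 by rewrite exprn_ge0.
have x3 : 0 <= x ^+ 3 by rewrite exprn_ge0.
have x2 : 0 <= x ^+ 2 by rewrite exprn_ge0.
have b4 : x ^+ 4 * exp_sum x (L.+2 - 4) <= x ^+ 4 * exp_sum x L by rewrite ler_wpM2l.
have b0 : x ^+ 4 * exp_sum x L.+2 <= x ^+ 4 * exp_sum x L + 2 * (x ^+ 3 * e / 2).
  rewrite -hx; apply: le_trans (ler_wpM2l x4 h0) _; rewrite mulrDr lerD2l mulrCA.
  by rewrite ler_pM2l // ler_wpM2l.
have b3 : x ^+ 3 * exp_sum x (L.+2 - 3) <= x ^+ 3 * e by rewrite ler_wpM2l.
have b2 : x ^+ 2 * exp_sum x L <= x ^+ 2 * e by rewrite ler_wpM2l.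
have b1 : x * exp_sum x (L.+2 - 1) <= x * e by rewrite ler_wpM2l.
have b1' : 0 <= x ^+ 2 * (x * exp_sum x (L.+2 - 1)) by rewrite !mulr_ge0.
have c1 : x * e <= x ^+ 3 * e.
  by rewrite ler_pM2r //; have := sqr_ge0 (x - 1); rewrite !exprS expr0; nra.
have c2 : x ^+ 2 * e <= x ^+ 3 * e.
  by rewrite ler_pM2r // ler_weXn2l.
have -> : (7 - 2 * x ^+ 2) * (x ^+ 2 * exp_sum x L) =
   7 * (x ^+ 2 * exp_sum x L) - 2 * (x ^+ 4 * exp_sum x L) by ring.
have -> : (1 - 2 * x ^+ 2) * (x * exp_sum x (L.+2 - 1)) =
   x * exp_sum x (L.+2 - 1) - 2 * (x ^+ 2 * (x * exp_sum x (L.+2 - 1))) by ring.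
lra.
Qed.

End ExpPartialSums.

(** * The denominators as sums over Poisson weights *)

Section DenominatorExpansion.
Variable R : realType.

(** The price of exchanging (3/4)_j for (3/2)_j, which completes 4^j j! to (2j+1)!; it grows like
    j^(3/4). *)
Definition poch_ratio j : R := poch (3 / 2) j / poch (3 / 4) j.

(** The ratio of consecutive summands, counted from k = n downwards, divided by its leading form
    (n/2)/((i+1)(i+3/4)). It is close to 1 - 3i/(2n). *)
Definition q_factor n i : R :=
  (1 - (i%:R - 1 / 4) / n%:R) * (1 - i%:R / n%:R) / (1 - (i%:R + 1 / 2) / (2 * n%:R)).

Definition q_correction n j : R := \prod_(i < j) q_factor n i.

Lemma poch_gt0 (a : R) m : 0 < a -> 0 < poch a m.
Proof. by move=> a0; apply: prodr_gt0 => i _; rewrite ltr_wpDr. Qed.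

Lemma poch_ratio_gt0 j : 0 < poch_ratio j.
Proof. by rewrite divr_gt0 // poch_gt0 //; lra. Qed.

Lemma poch_ratioS j : poch_ratio j.+1 = poch_ratio j * ((j%:R + 3 / 2) / (j%:R + 3 / 4)).
Proof.
have j0 : 0 <= j%:R :> R by [].
have h : poch (3 / 4 : R) j != 0 by rewrite gt_eqF // poch_gt0; lra.
by rewrite /poch_ratio !pochS; field; rewrite h gt_eqF //; lra.
Qed.

Lemma gbinom_diag (a : R) n : gbinom (n%:R - a) n = poch (1 - a) n / n`!%:R.
Proof.
rewrite /gbinom /poch; congr (_ / _).
rewrite (reindex_inj rev_ord_inj) /=; apply: eq_bigr => i _.
by rewrite natrB // -natr1; ring.
Qed.

Lemma fact_odd_poch j : (j.*2.+1)`!%:R = 4 ^+ j * j`!%:R * poch (3 / 2 : R) j.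
Proof.
elim: j => [|j ih]; first by rewrite /poch big_ord0 expr0 fact0 !mulr1.
rewrite doubleS factS natrM factS natrM ih pochS exprS factS natrM.
by rewrite -!natr1 -muln2 natrM; field.
Qed.

Lemma q_hterm n j : (0 < n)%N -> (j <= n)%N ->
  hterm (- (1 / 4)) (1 / 2) n (n - j) =
  poch (3 / 4) n * poch (1 / 2) n.*2 / n`!%:R * ((n%:R / 2) ^+ j /
    (j`!%:R * poch (3 / 4 : R) j) * q_correction n j).
Proof.
move=> n0; have nR : 0 < n%:R :> R by rewrite ltr0n.
elim: j => [|j ih] jn.
  rewrite subn0 /hterm subnn opprK /q_correction !big_ord0 gbinom_diag addnn.
  rewrite /gbinom /poch !big_ord0 !fact0 expr0.
  have -> : 1 - 1 / 4 = 3 / 4 :> R by field.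
  have h : n`!%:R != 0 :> R by rewrite pnatr_eq0 -lt0n fact_gt0.
  by field.
have jR : j.+1%:R <= n%:R :> R by rewrite ler_nat.
have jR0 : 0 <= j%:R :> R by [].
have kn : (n - j.+1 < n)%N by lia.
have := htermSk (- (1 / 4)) (1 / 2 : R) kn.
have -> : (n - j.+1).+1 = (n - j)%N by lia.
rewrite ih; last exact: ltnW.
rewrite (natrB _ jn) (natrB _ (ltnW jn)).
rewrite /q_correction big_ord_recr /= -/(q_correction n j) pochS exprS factS natrM.
rewrite -natr1 in jR *; move=> h.
have d1 : (n%:R - (n%:R - (j%:R + 1))) * (n%:R + - (1 / 4) - (n%:R - (j%:R + 1))) *
  (1 / 2 + n%:R + (n%:R - (j%:R + 1))) != 0 :> R.
  by rewrite !mulf_neq0 // gt_eqF //; lra.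
apply: (mulIf d1); rewrite -h /q_factor.
have w1 : n`!%:R != 0 :> R by rewrite pnatr_eq0 -lt0n fact_gt0.
have w2 : j`!%:R != 0 :> R by rewrite pnatr_eq0 -lt0n fact_gt0.
have w3 : poch (3 / 4 : R) j != 0 by rewrite gt_eqF // poch_gt0; lra.
field; rewrite w1 w2 w3 !gt_eqF //; lra.
Qed.

(** With X^2 = 2n one has (n/2)^j = X^(2j)/4^j, and [fact_odd_poch] absorbs 4^j j! into (2j+1)!. *)
Lemma q_expansion n : (0 < n)%N -> q R n =
  poch (3 / 4) n * poch (1 / 2) n.*2 / n`!%:R / Num.sqrt (2 * n%:R) *
  \sum_(j < n.+1) Num.sqrt (2 * n%:R) ^+ j.*2.+1 / j.*2.+1`!%:R *
    (poch_ratio j * q_correction n j).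
Proof.
move=> n0; have X1 := sqrt2n_ge1 R n0; have X2 := sqr_sqrt2n R n.
set X := Num.sqrt _ in X1 X2 *.
have XN : X != 0 by rewrite gt_eqF //; lra.
rewrite qE (reindex_inj rev_ord_inj) /= mulr_sumr; apply: eq_bigr => j _.
rewrite subSS q_hterm //; last by rewrite -ltnS.
rewrite fact_odd_poch -(mul2n j) exprS exprM X2 /poch_ratio.
have w1 : n`!%:R != 0 :> R by rewrite pnatr_eq0 -lt0n fact_gt0.
have w2 : (nat_of_ord j)`!%:R != 0 :> R by rewrite pnatr_eq0 -lt0n fact_gt0.
have w3 : poch (3 / 4 : R) j != 0 by rewrite gt_eqF // poch_gt0; lra.
have w4 : poch (3 / 2 : R) j != 0 by rewrite gt_eqF // poch_gt0; lra.
have -> : (n%:R / 2) ^+ j = (2 * n%:R) ^+ j / 4 ^+ j :> R.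
  by rewrite -expr_div_n; congr (_ ^+ _); field.
have w5 : 4 ^+ j != 0 :> R by rewrite expf_neq0.
by field; rewrite XN w1 w2 w3 w4 w5.
Qed.

End DenominatorExpansion.

Section DenominatorFactors.
Variable R : realType.

(** The fourth power [V] removes the fractional exponent. Its successive ratios lie between 1 and 1
    + 3/(M(M+2)) with M = 2k+1, and 3/(M(M+2)) = 3/2 (1/M - 1/(M+2)) telescopes. *)
Lemma poch_ratio_quotient j n : (j <= n)%N ->
  1 <= poch_ratio R j / poch_ratio R n * ((2 * n%:R + 1) / (2 * j%:R + 1)) `^ (3 / 4)
    <= 1 + (2 * j%:R + 1)^-1.
Proof.
move=> jn; set m : R := 2 * j%:R + 1.
have j0 : 0 <= j%:R :> R by [].
have m1 : 1 <= m by rewrite /m; lra.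
pose V k : R := (poch_ratio R j / poch_ratio R k) ^+ 4 * ((2 * k%:R + 1) / m) ^+ 3.
have key : 1 <= V n <= expR (3 / 2 * (m^-1 - (2 * n%:R + 1)^-1)).
  rewrite -(subnKC jn); elim: (n - j)%N => [|d /andP[ih1 ih2]].
    rewrite /V addn0 !divff ?gt_eqF ?poch_ratio_gt0 -/m //; last by lra.
    by rewrite subrr mulr0 expR0 !expr1n mulr1 lexx.
  rewrite addnS; set k := (j + d)%N in ih1 ih2 *.
  pose M : R := 2 * k%:R + 1.
  have k0 : 0 <= k%:R :> R by [].
  have M1 : 1 <= M by rewrite /M; lra.
  have E : V k.+1 = V k * ((M + 1 / 2) ^+ 4 / ((M + 2) * M ^+ 3)).
    have h := gt_eqF (poch_ratio_gt0 R k).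
    rewrite /V poch_ratioS -natr1 /M; field; rewrite h !gt_eqF //=; lra.
  have D0 : 0 < (M + 2) * M ^+ 3 by rewrite mulr_gt0 ?exprn_gt0 //; lra.
  have M3 : 0 < M * (M + 2) by rewrite mulr_gt0 //; lra.
  have r1 : 1 <= (M + 1 / 2) ^+ 4 / ((M + 2) * M ^+ 3).
    by rewrite ler_pdivlMr // mul1r !exprS expr0; nra.
  have r2 : (M + 1 / 2) ^+ 4 / ((M + 2) * M ^+ 3) <= 1 + 3 / (M * (M + 2)).
    rewrite ler_pdivrMr //.
    have -> : (1 + 3 / (M * (M + 2))) * ((M + 2) * M ^+ 3) = (M + 2) * M ^+ 3 + 3 * M ^+ 2.
      by field; rewrite !gt_eqF //; lra.
    by rewrite !exprS expr0; nra.
  rewrite E; apply/andP; split; first by apply: (le_trans ih1); rewrite ler_peMr //; exact: le_trans ler01 ih1.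
  have -> : 3 / 2 * (m^-1 - (2 * k.+1%:R + 1)^-1) =
    3 / 2 * (m^-1 - (2 * k%:R + 1)^-1) + 3 / (M * (M + 2)).
    by rewrite -natr1 /M; field; rewrite !gt_eqF //; lra.
  rewrite expRD; apply: ler_pM => //; [exact: le_trans ler01 ih1|exact: le_trans ler01 r1|].
  by apply: le_trans r2 _; exact: expR_ge1Dx.
set U := _ * _ `^ _.
have n0 : 0 <= n%:R :> R by [].
have q0 : 0 < (2 * n%:R + 1) / m by rewrite divr_gt0 //; lra.
have U0 : 0 <= U by rewrite mulr_ge0 ?powR_ge0 // divr_ge0 // ltW ?poch_ratio_gt0.
have U4 : U ^+ 4 = V n.
  rewrite /U exprMn -(powR_mulrn 4 (powR_ge0 _ _)) -powRrM.
  have -> : 3 / 4 * 4%:R = 3%:R :> R by field.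
  by rewrite powR_mulrn // ltW.
have /andP[k1 k2] := key.
have U1 : 1 <= U by rewrite -(@ler_pXn2r _ 4) ?nnegrE // expr1n U4.
rewrite U1 /=; set s := 3 / 8 * m^-1.
have mV0 : 0 < m^-1 by rewrite invr_gt0; lra.
have mV1 : m^-1 <= 1 by rewrite invf_le1 //; lra.
have nV0 : 0 <= (2 * n%:R + 1)^-1 :> R by rewrite invr_ge0; lra.
have U2 : U <= expR s.
  rewrite -(@ler_pXn2r _ 4) ?nnegrE ?expR_ge0 // U4 -expRM_natl.
  by apply: le_trans k2 _; rewrite ler_expR /s; lra.
apply: le_trans U2 _.
have h : expR s * (1 - s) <= 1.
  have := expR_ge1Dx (- s) => h.
  by rewrite -[leRHS](expRxMexpNx_1 s) ler_pM2l // expR_gt0.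
have e0 := expR_gt0 s.
have s0 : 0 < s by rewrite /s; lra.
have : m^-1 = 8 / 3 * s by rewrite /s; field; rewrite gt_eqF //; lra.
move=> ->; have s1 : s <= 3 / 8 by rewrite /s; lra.
rewrite -(@ler_pM2r _ (1 - s)); last by lra.
by apply: le_trans h _; nra.
Qed.

(** Only the factor i = 0 can exceed 1; it equals 5/3 at n = 1, which is therefore also the bound
    for the whole product. *)
Lemma q_factor_bounds n i : (i < n)%N ->
  [/\ 0 <= q_factor R n i <= 5 / 3, (0 < i)%N -> q_factor R n i <= 1 &
   `|q_factor R n i - expR (- (3 / 4 * (2 * i%:R + 1) / n%:R))| <=
     5 * ((i%:R / n%:R) ^+ 2 + n%:R^-1)].
Proof.
move=> lin; have n1 : 1 <= n%:R :> R by rewrite ler1n (leq_ltn_trans _ lin).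
pose s : R := i%:R / n%:R; pose e : R := n%:R^-1.
have e0 : 0 < e by rewrite invr_gt0; lra.
have e1 : e <= 1 by rewrite invf_le1 //; lra.
have s0 : 0 <= s by rewrite divr_ge0.
have se : s + e <= 1.
  rewrite /s /e -[X in _ + X]mul1r -mulrDl ler_pdivrMr ?mul1r; last by lra.
  by rewrite natr1 ler_nat.
have E : q_factor R n i = (1 - s + e / 4) * (1 - s) / (1 - s / 2 - e / 4).
  rewrite /q_factor /s /e; congr (_ * _ / _); first by field; rewrite gt_eqF //; lra.
  by field; rewrite gt_eqF //; lra.
have -> : 3 / 4 * (2 * i%:R + 1) / n%:R = 3 / 2 * s + 3 / 4 * e.
  by rewrite /s /e; field; rewrite gt_eqF //; lra.
rewrite E -/s -/e; have d0 : 1 / 2 <= 1 - s / 2 - e / 4 by lra.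
have d1 : 0 < 1 - s / 2 - e / 4 by lra.
split.
- apply/andP; split; first by rewrite divr_ge0 ?mulr_ge0 //; lra.
  by rewrite ler_pdivrMr //; nra.
- move=> i0; have : e <= s by rewrite /s /e ler_peMl ?ler1n // ltW.
  by rewrite ler_pdivrMr //; nra.
set y := 3 / 2 * s + 3 / 4 * e.
have y0 : 0 <= y by rewrite /y; lra.
set a := _ / _.
have ea : `|a - (1 - 3 / 2 * s)| <= s ^+ 2 / 2 + e.
  have -> : a - (1 - 3 / 2 * s) = (s ^+ 2 / 4 + e / 4 * (2 - 5 / 2 * s)) / (1 - s / 2 - e / 4).
    by rewrite /a; field; rewrite gt_eqF //; lra.
  have sq := sqr_ge0 s.
  have h : `|s ^+ 2 / 4 + e / 4 * (2 - 5 / 2 * s)| <= (s ^+ 2 / 2 + e) * (1 / 2).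
    by rewrite ler_norml; apply/andP; split; nra.
  rewrite normrM normfV (ger0_norm (ltW d1)) ler_pdivrMr //.
  apply: le_trans h _; rewrite ler_wpM2l //; lra.
have eb : `|expR (- y) - (1 - 3 / 2 * s)| <= 9 / 2 * s ^+ 2 + 2 * e.
  have h1 := expR_ge1Dx (- y).
  have h2 := expRN_le_quadratic y0.
  have h3 : y ^+ 2 <= 9 / 2 * s ^+ 2 + 9 / 8 * e.
    have := sqr_ge0 (3 / 2 * s - 3 / 4 * e); rewrite /y !exprS !expr0; nra.
  by rewrite ler_norml; apply/andP; split; have yE : y = 3 / 2 * s + 3 / 4 * e := erefl; have := sqr_ge0 s; lra.
have := ler_distD (1 - 3 / 2 * s) a (expR (- y)).
rewrite [`|1 - 3 / 2 * s - _|]distrC; have := sqr_ge0 s; lra.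
Qed.

Lemma q_correction_bounds n j : (j <= n)%N -> 0 <= q_correction R n j <= 5 / 3.
Proof.
move=> jn; case: j jn => [_|j]; first by rewrite /q_correction big_ord0; lra.
elim: j => [n0|j ih jn].
  by rewrite /q_correction big_ord1; have [] := q_factor_bounds n0.
have /andP[h1 h2] := ih (ltnW jn).
have [/andP[f1 _] /(_ isT) f2 _] := q_factor_bounds jn.
by rewrite /q_correction big_ord_recr /= -/(q_correction R n j.+1); nra.
Qed.

(** The exponents 3/4 (2i+1)/n add up to 3/4 j^2/n, and the errors (i/n)^2 + 1/n of the factors to
    at most j^3/n^2 + j/n. *)
Lemma q_correction_estimate n j : (j <= n)%N ->
  `|q_correction R n j - expR (- (3 / 4 * j%:R ^+ 2 / n%:R))| <=
    10 * (j%:R ^+ 3 / n%:R ^+ 2 + j%:R / n%:R).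
Proof.
elim: j => [_|j ih jn].
  rewrite /q_correction big_ord0 expr0n /= mulr0 mul0r oppr0 expR0 subrr normr0.
  by rewrite expr0n /= !mul0r addr0 mulr0.
have /andP[c0 c1] := q_correction_bounds (ltnW jn).
have [_ _ f] := q_factor_bounds jn.
have {}ih := ih (ltnW jn).
have n1 : 1 <= n%:R :> R by rewrite ler1n (leq_ltn_trans _ jn).
rewrite /q_correction big_ord_recr /= -/(q_correction R n j).
have -> : - (3 / 4 * j.+1%:R ^+ 2 / n%:R) =
  - (3 / 4 * j%:R ^+ 2 / n%:R) + - (3 / 4 * (2 * j%:R + 1) / n%:R) :> R.
  by rewrite -natr1; field; rewrite gt_eqF //; lra.
rewrite expRD; set b := expR (- (_ * (_ + _) / _)) in f *.
set Q := expR _ in ih *; set P := q_correction R n j in c0 c1 ih *.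
set a := q_factor R n j in f *.
have b0 : 0 <= b by exact: expR_ge0.
have b1 : b <= 1 by rewrite expR_le1 oppr_le0 divr_ge0 ?mulr_ge0 ?addr_ge0.
have -> : P * a - Q * b = P * (a - b) + b * (P - Q) by ring.
apply: le_trans (ler_normD _ _) _; rewrite !normrM (ger0_norm c0) (ger0_norm b0).
have h1 : P * `|a - b| <= 2 * (5 * ((j%:R / n%:R) ^+ 2 + n%:R^-1)).
  by apply: ler_pM => //; lra.
have h2 : b * `|P - Q| <= `|P - Q| by rewrite ler_piMl.
have : 10 * (j%:R ^+ 3 / n%:R ^+ 2 + j%:R / n%:R) +
   2 * (5 * ((j%:R / n%:R) ^+ 2 + n%:R^-1)) <= 10 * (j.+1%:R ^+ 3 / n%:R ^+ 2 + j.+1%:R / n%:R) :> R.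
  have -> : 10 * (j%:R ^+ 3 / n%:R ^+ 2 + j%:R / n%:R) +
   2 * (5 * ((j%:R / n%:R) ^+ 2 + n%:R^-1)) =
   10 * ((j%:R ^+ 3 + j%:R ^+ 2) / n%:R ^+ 2 + (j%:R + 1) / n%:R) :> R.
    by field; rewrite gt_eqF //; lra.
  rewrite -(natr1 j) ler_pM2l // lerD2r ler_pM2r ?invr_gt0 ?exprn_gt0 //; last by lra.
  have : 0 <= j%:R :> R by [].
  by rewrite !exprS expr0; nra.
lra.
Qed.

(** With z = y^2 the product is exp(-3/8) w^(3/8), where w = z exp(1-z) satisfies 1 - (z-1)^2 <= w
    <= 1. So y = 1 is critical. *)
Lemma norm_critical_sub (y : R) : 0 < y ->
  `|y `^ (3 / 4) * expR (- (3 / 8 * y ^+ 2)) - expR (- (3 / 8))| <= (y ^+ 2 - 1) ^+ 2.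
Proof.
move=> y0; set z := y ^+ 2; have z0 : 0 < z by rewrite exprn_gt0.
pose w := z * expR (- (z - 1)).
have w0 : 0 < w by rewrite mulr_gt0 // expR_gt0.
have e0 := expR_gt0 (- (z - 1)).
have w1 : w <= 1.
  have := expR_ge1Dx (z - 1); rewrite addrC subrK => h.
  by rewrite -[leRHS](expRxMexpNx_1 (z - 1)) /w ler_pM2r.
have w2 : 1 - (z - 1) ^+ 2 <= w.
  have := expR_ge1Dx (- (z - 1)) => h.
  have -> : 1 - (z - 1) ^+ 2 = z * (1 - (z - 1)) by ring.
  by rewrite /w ler_pM2l.
have s0 : 0 <= (3 / 8 : R) <= 1 by lra.
have hw := norm_powR_sub1 s0 w0.
have -> : y `^ (3 / 4) * expR (- (3 / 8 * z)) - expR (- (3 / 8)) =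
  expR (- (3 / 8)) * (w `^ (3 / 8) - 1).
  rewrite /w powRM ?expR_ge0 //; last exact: ltW.
  have -> : z `^ (3 / 8) = y `^ (3 / 4).
    by rewrite /z -(powR_mulrn 2 (ltW y0)) -powRrM; congr (_ `^ _); field.
  rewrite -expRM.
  have -> : expR (- (3 / 8 * z)) = expR (- (3 / 8)) * expR (- (z - 1) * (3 / 8)).
    by rewrite -expRD; congr expR; field.
  by ring.
rewrite normrM ger0_norm ?expR_ge0 //.
have e1 : expR (- (3 / 8)) <= 1 :> R by rewrite expR_le1; lra.
apply: le_trans (_ : `|w `^ (3 / 8) - 1| <= _); first by rewrite ler_piMl.
apply: le_trans hw _; rewrite ler_norml; lra.
Qed.

Lemma q_term_estimate n j (X y : R) : (0 < n)%N -> (j <= n)%N ->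
  X = Num.sqrt (2 * n%:R) -> y = (2 * j%:R + 1) / X ->
  `|poch_ratio R j / poch_ratio R n * ((2 * n%:R + 1) / X) `^ (3 / 4) * q_correction R n j
    - expR (- (3 / 8))| <= (y ^+ 2 - 1) ^+ 2 + 40 / X * (1 + y^-1 + y ^+ 4).
Proof.
move=> n0 jn XE yE.
have X1 : 1 <= X by rewrite XE; exact: sqrt2n_ge1.
have X2 : X ^+ 2 = 2 * n%:R by rewrite XE; exact: sqr_sqrt2n.
have n1 : 1 <= n%:R :> R by rewrite ler1n.
have j0 : 0 <= j%:R :> R by [].
have X0 : 0 < X by lra.
have y0 : 0 < y by rewrite yE divr_gt0 //; lra.
have mE : 2 * j%:R + 1 = X * y by rewrite yE; field; rewrite gt_eqF.
have nE : n%:R = X ^+ 2 / 2 by rewrite X2; field.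
pose Y := X^-1; have Y0 : 0 < Y by rewrite invr_gt0.
have XY : X * Y = 1 by rewrite mulfV // gt_eqF.
have /andP[u1 u2] := poch_ratio_quotient jn.
have [/andP[c0 c1] cQ] := (q_correction_bounds jn, q_correction_estimate jn).
have [s0 tG] := (powR_ge0 y (3 / 4), norm_critical_sub y0).
have s34 : 0 <= (3 / 4 : R) <= 1 by lra.
have t1 := powR_le1D s34 y0.
have -> : ((2 * n%:R + 1) / X) `^ (3 / 4) =
    ((2 * n%:R + 1) / (2 * j%:R + 1)) `^ (3 / 4) * y `^ (3 / 4).
  rewrite -powRM; last 2 first.
  - by rewrite divr_ge0 //; lra.
  - exact: ltW.
  by congr (_ `^ _); rewrite mE; field; rewrite !gt_eqF.
rewrite [_ / _ * (_ * _)]mulrA.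
set u := _ * _ `^ _ in u1 u2 *; set t := y `^ _ in s0 tG t1 *.
set c := q_correction _ _ _ in c0 c1 cQ *; set Q := expR _ in cQ; set G := expR _ in tG.
set e := expR _ in tG *.
have QG : `|Q - G| <= y * Y.
  apply: le_trans (norm_expRN_sub _ _) _.
  - by rewrite divr_ge0 ?mulr_ge0 ?exprn_ge0.
  - by rewrite mulr_ge0 ?exprn_ge0 ?(ltW y0).
  have jE : j%:R = (X * y - 1) / 2 by rewrite -mE; field.
  have -> : 3 / 4 * j%:R ^+ 2 / n%:R - 3 / 8 * y ^+ 2 = - (3 / 8 * (2 * (X * y) - 1) * Y ^+ 2).
    by rewrite jE nE /Y; field; rewrite gt_eqF.
  have k1 : 1 <= X * y by rewrite -mE; lra.
  rewrite normrN ger0_norm; last by rewrite !mulr_ge0 ?exprn_ge0 ?(ltW Y0) //; lra.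
  have -> : y * Y = X * y * Y ^+ 2 by rewrite /Y; field; rewrite gt_eqF.
  by rewrite ler_pM2r ?exprn_gt0 //; lra.
have {}cQ : `|c - Q| <= 10 * (Y * (y ^+ 3 / 2 + y)).
  apply: le_trans cQ _; rewrite ler_pM2l //.
  have jy : j%:R <= X * y / 2 by lra.
  have -> : Y * (y ^+ 3 / 2 + y) = (X * y / 2) ^+ 3 / n%:R ^+ 2 + (X * y / 2) / n%:R.
    by rewrite nE /Y; field; rewrite gt_eqF.
  apply: lerD; rewrite ler_pM2r ?invr_gt0 ?exprn_gt0 //; try lra.
  by rewrite lerXn2r ?nnegrE //; rewrite divr_ge0 ?mulr_ge0 ?(ltW y0) ?(ltW X0).
have {}u2 : `|u - 1| <= Y * y^-1 by rewrite ger0_norm ?subr_ge0 // /Y -invfM -mE; lra.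
have -> : u * t * c - e = (u - 1) * t * c + t * (c - Q) + t * (Q - G) + (t * G - e) by ring.
apply: le_trans (ler_normD _ _) _; rewrite addrC; apply: lerD; first exact: tG.
have yV0 : 0 < y^-1 by rewrite invr_gt0.
have y3 : 0 < y ^+ 3 by rewrite exprn_gt0.
have A1 : `|(u - 1) * t * c| <= Y * y^-1 * (1 + y) * 2.
  rewrite !normrM (ger0_norm s0) (ger0_norm c0).
  by apply: ler_pM; rewrite ?mulr_ge0 //; [exact: ler_pM|lra].
have A2 : `|t * (c - Q)| <= (1 + y) * (10 * (Y * (y ^+ 3 / 2 + y))).
  by rewrite normrM (ger0_norm s0); exact: ler_pM.
have A3 : `|t * (Q - G)| <= (1 + y) * (y * Y).
  by rewrite normrM (ger0_norm s0); exact: ler_pM.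
have B : y^-1 * (1 + y) * 2 + (1 + y) * (10 * (y ^+ 3 / 2 + y)) + (1 + y) * y <=
    40 * (1 + y^-1 + y ^+ 4).
  have h0 : y^-1 * (1 + y) = y^-1 + 1 by field; rewrite gt_eqF.
  have h2 := sqr_ge0 (y ^+ 2 - 1); have h1 := sqr_ge0 (y - 1).
  have h3 := sqr_ge0 (y * (y - 1)).
  by rewrite h0 !exprS expr0 in h1 h2 h3 *; lra.
have {}B : Y * (y^-1 * (1 + y) * 2 + (1 + y) * (10 * (y ^+ 3 / 2 + y)) + (1 + y) * y) <=
    Y * (40 * (1 + y^-1 + y ^+ 4)) by rewrite ler_pM2l.
have -> : 40 / X * (1 + y^-1 + y ^+ 4) = Y * (40 * (1 + y^-1 + y ^+ 4)) by rewrite /Y; ring.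
have := ler_normD ((u - 1) * t * c + t * (c - Q)) (t * (Q - G)).
have := ler_normD ((u - 1) * t * c) (t * (c - Q)).
lra.
Qed.

End DenominatorFactors.

(** * Summation over the odd Poisson weights *)

Section DenominatorSum.
Variable R : realType.

Lemma exp_sum_odd (x : R) n :
  2 * \sum_(j < n.+1) x ^+ j.*2.+1 / j.*2.+1`!%:R =
  exp_sum x n.+1.*2 - exp_sum (- x) n.+1.*2.
Proof.
elim: n => [|n ih].
  by rewrite !exp_sumS /exp_sum big_ord_recr !big_ord0 /= !expr0 !expr1; field.
have e k : (- x) ^+ k = (-1) ^+ odd k * x ^+ k by rewrite signr_odd -exprNn.
rewrite big_ord_recr mulrDr ih [in RHS]doubleS !exp_sumS !e /= odd_double /=.
by rewrite expr0 expr1; ring.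
Qed.

Lemma ler_sum_odd (F : nat -> R) n L : (forall i, 0 <= F i) -> (n.+1.*2 <= L)%N ->
  \sum_(j < n.+1) F j.*2.+1 <= \sum_(i < L) F i.
Proof.
move=> F0 nL; apply: (@le_trans _ _ (\sum_(i < n.+1.*2) F i)); last first.
  rewrite -(subnKC nL) big_split_ord /= lerDl; exact: sumr_ge0.
elim: n {nL} => [|n ih]; first by rewrite !big_ord_recr !big_ord0 /= !add0r lerDr.
rewrite [in leRHS]doubleS big_ord_recr [leRHS]big_ord_recr [X in _ <= X + _]big_ord_recr /=.
by apply: lerD => //; apply: le_trans ih _; rewrite lerDl.
Qed.

(** The odd part of the exponential series is (exp(X) - exp(-X))/2; both exp(-X) and the truncation
    are O(exp(X)/X). *)
Lemma sum_odd_exp n (X : R) : (0 < n)%N -> X = Num.sqrt (2 * n%:R) ->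
  `|\sum_(j < n.+1) X ^+ j.*2.+1 / j.*2.+1`!%:R - expR X / 2| <= 2 * (expR X / X).
Proof.
move=> n0 XE.
have X1 : 1 <= X by rewrite XE; exact: sqrt2n_ge1.
have X2 : X ^+ 2 = 2 * n%:R by rewrite XE; exact: sqr_sqrt2n.
have X0 : 0 < X by lra.
have n1 : 1 <= n%:R :> R by rewrite ler1n.
set S := \sum_(_ < _) _.
have L1 : (1 < n.+1.*2)%N by lia.
have e1 := exp_sum_error X L1; have e2 := exp_sum_error (- X) L1.
have SE := exp_sum_odd X n; rewrite -/S in SE.
rewrite normrN in e2; rewrite (ger0_norm (ltW X0)) in e1 e2.
have E0 := expR_gt0 X; have EX := expR_ge1Dx X.
have EV : expR (- X) <= 1 by rewrite expR_le1; lra.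
have EV0 := expR_gt0 (- X).
set Y := X^-1; have Y0 : 0 < Y by rewrite invr_gt0.
have XY : X * Y = 1 by rewrite mulfV // gt_eqF.
have h1 : 1 <= expR X * Y by rewrite ler_pdivlMr //; lra.
have hL : X ^+ 2 * expR X / ((n.+1.*2)%:R * ((n.+1.*2)%:R - 1)) <= expR X * Y.
  rewrite -muln2 natrM -(natr1 n) ler_pdivrMr; last by rewrite mulr_gt0 //; lra.
  have -> : X ^+ 2 * expR X = expR X * Y * (X ^+ 2 * X) by rewrite /Y; field; rewrite gt_eqF.
  have XX : X <= X ^+ 2 by rewrite expr2 ler_peMr // ltW.
  by rewrite ler_pM2l ?mulr_gt0 //; apply: ler_pM; rewrite ?exprn_ge0 //; lra.
rewrite !ler_norml in e1 e2 *; lra.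
Qed.

Lemma sum_odd_error n (X : R) : (0 < n)%N -> X = Num.sqrt (2 * n%:R) ->
  \sum_(j < n.+1) X ^+ j.*2.+1 / j.*2.+1`!%:R *
    ((((2 * j%:R + 1) / X) ^+ 2 - 1) ^+ 2 +
     40 / X * (1 + ((2 * j%:R + 1) / X)^-1 + ((2 * j%:R + 1) / X) ^+ 4))
  <= 800 * (expR X / X).
Proof.
move=> n0 XE.
have X1 : 1 <= X by rewrite XE; exact: sqrt2n_ge1.
have X2 : X ^+ 2 = 2 * n%:R by rewrite XE; exact: sqr_sqrt2n.
have X0 : 0 < X by lra.
have E0 := expR_gt0 X.
pose w i : R := X ^+ i / i`!%:R.
have w0 i : 0 <= w i by rewrite divr_ge0 ?exprn_ge0 // ltW.
set Y := X^-1; have Y0 : 0 < Y by rewrite invr_gt0.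
have XY : X * Y = 1 by rewrite mulfV // gt_eqF.
have Y1 : Y <= 1 by rewrite invf_le1.
have M j : 2 * j%:R + 1 = j.*2.+1%:R :> R by rewrite -(natr1 j.*2) -muln2 natrM; ring.
have s1 : \sum_(j < n.+1) w j.*2.+1 * (((2 * j%:R + 1) / X) ^+ 2 - 1) ^+ 2 <=
    15 * (expR X / X).
  (* As 2 X^2 = 4n, extending the sum to all i < 4n + 2 meets the truncation condition of
     [poisson_concentration]. *)
  have x2L : 2 * X ^+ 2 <= (4 * n)%:R by rewrite X2 natrM; lra.
  have F0 i : 0 <= w i * (i%:R ^+ 2 - X ^+ 2) ^+ 2 by rewrite mulr_ge0 ?sqr_ge0.
  have nL : (n.+1.*2 <= (4 * n).+2)%N by lia.
  have := le_trans (ler_sum_odd F0 nL) (poisson_concentration X1 x2L).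
  have Y4 : 0 < Y ^+ 4 by rewrite exprn_gt0.
  rewrite -(ler_pM2r Y4) mulr_suml.
  have -> : 15 * X ^+ 3 * expR X * Y ^+ 4 = 15 * (expR X / X).
    by rewrite /Y; field; rewrite gt_eqF.
  apply: le_trans; rewrite le_eqVlt; apply/orP; left; apply/eqP; apply: eq_bigr => j _.
  by rewrite M /Y; field; rewrite gt_eqF.
have s2 : \sum_(j < n.+1) w j.*2.+1 <= expR X.
  have := ler_sum_odd w0 (leqnn _); move=> /(_ n) h; apply: le_trans h _.
  exact: exp_sum_le_expR (ltW X0).
(* With M = 2j+1, the weight at M times X/M is (M+1)/M <= 2 times the weight at M + 1. *)
have s3 : \sum_(j < n.+1) w j.*2.+1 * ((2 * j%:R + 1) / X)^-1 <= 2 * expR X.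
  pose F i : R := w i.+1.
  have F0 i : 0 <= F i by exact: w0.
  have h := ler_sum_odd F0 (leqnn n.+1.*2).
  have h2 : \sum_(i < n.+1.*2) F i <= expR X.
    apply: le_trans (exp_sum_le_expR n.+1.*2.+1 (ltW X0)).
    by rewrite /exp_sum [leRHS]big_ord_recl lerDr; exact: w0 0%N.
  apply: le_trans (_ : 2 * \sum_(j < n.+1) F j.*2.+1 <= _); last by rewrite ler_pM2l //; lra.
  rewrite mulr_sumr; apply: ler_sum => j _; rewrite M /F /w.
  rewrite (exprS X j.*2.+1) (factS j.*2.+1) natrM; set k := j.*2.+1.
  have k1 : 1 <= k%:R :> R by rewrite ler1n.
  have kf : 0 < k`!%:R :> R by rewrite ltr0n fact_gt0.
  have -> : X ^+ k / k`!%:R * (k%:R / X)^-1 = X * X ^+ k / k`!%:R * k%:R^-1.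
    by rewrite invf_div; field; rewrite !gt_eqF //; lra.
  have -> : 2 * (X * X ^+ k / (k.+1%:R * k`!%:R)) = X * X ^+ k / k`!%:R * (2 / k.+1%:R).
    by rewrite invfM; ring.
  apply: ler_wpM2l; first by rewrite divr_ge0 ?mulr_ge0 ?exprn_ge0 // ltW.
  by rewrite -natr1 ler_pdivlMr ?addr_gt0 // mulrC ler_pdivrMr; lra.
have s4 : \sum_(j < n.+1) w j.*2.+1 * ((2 * j%:R + 1) / X) ^+ 4 <= 15 * expR X.
  have F0 i : 0 <= w i * i%:R ^+ 4 by rewrite mulr_ge0 ?exprn_ge0.
  have := le_trans (ler_sum_odd F0 (leqnn _)) (poisson_moment4 n.+1.*2 (ltW X0)).
  have Y4 : 0 < Y ^+ 4 by rewrite exprn_gt0.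
  rewrite -(ler_pM2r Y4) mulr_suml => h.
  apply: le_trans (_ : (X ^+ 4 + 6 * X ^+ 3 + 7 * X ^+ 2 + X) * expR X * Y ^+ 4 <= _).
    apply: le_trans h; rewrite le_eqVlt; apply/orP; left; apply/eqP; apply: eq_bigr => j _.
    by rewrite M /Y; field; rewrite gt_eqF.
  have -> : (X ^+ 4 + 6 * X ^+ 3 + 7 * X ^+ 2 + X) * expR X * Y ^+ 4 =
    (1 + 6 * Y + 7 * Y ^+ 2 + Y ^+ 3) * expR X by rewrite /Y; field; rewrite gt_eqF.
  rewrite ler_pM2r //.
  have : Y ^+ 2 <= 1 by rewrite exprn_ile1 // ltW.
  have : Y ^+ 3 <= 1 by rewrite exprn_ile1 // ltW.
  lra.
rewrite (eq_bigr (fun j : 'I_n.+1 => w j.*2.+1 * (((2 * j%:R + 1) / X) ^+ 2 - 1) ^+ 2 +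
  40 * Y * (w j.*2.+1 + w j.*2.+1 * ((2 * j%:R + 1) / X)^-1 +
   w j.*2.+1 * ((2 * j%:R + 1) / X) ^+ 4))); last by move=> j _; rewrite -/(w _) /Y; ring.
rewrite big_split /= -mulr_sumr !big_split /=.
have h : 40 * Y * (\sum_(j < n.+1) w j.*2.+1 +
    \sum_(j < n.+1) w j.*2.+1 * ((2 * j%:R + 1) / X)^-1 +
    \sum_(j < n.+1) w j.*2.+1 * ((2 * j%:R + 1) / X) ^+ 4) <= 40 * Y * (18 * expR X).
  by rewrite ler_pM2l ?mulr_gt0 //; lra.
have : 0 < expR X * Y by rewrite mulr_gt0.
rewrite -/Y in s1 *; lra.
Qed.

(** The sum of [q_expansion] normalised so that the factor of the weights is close to exp(-3/8)
    where 2j+1 is close to X. *)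
Definition q_sum n (X : R) := \sum_(j < n.+1) X ^+ j.*2.+1 / j.*2.+1`!%:R *
  (poch_ratio R j / poch_ratio R n * ((2 * n%:R + 1) / X) `^ (3 / 4) * q_correction R n j).

Lemma q_sum_estimate n (X : R) : (0 < n)%N -> X = Num.sqrt (2 * n%:R) ->
  `|q_sum n X - expR (- (3 / 8)) * expR X / 2| <= 1000 * (expR X / X).
Proof.
move=> n0 XE; have X1 : 1 <= X by rewrite XE; exact: sqrt2n_ge1.
set c := expR (- (3 / 8)).
have c1 : 0 <= c <= 1 by rewrite expR_ge0 /= expR_le1; lra.
have a := sum_odd_exp n0 XE; have b := sum_odd_error n0 XE.
set S := \sum_(_ < _) _ in a.
have h : `|q_sum n X - c * S| <= 800 * (expR X / X).
  apply: le_trans b; rewrite /q_sum mulr_sumr -sumrB; apply: le_trans (ler_norm_sum _ _ _) _.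
  apply: ler_sum => j _; rewrite [c * _]mulrC -mulrBr normrM.
  have w0 : 0 <= X ^+ j.*2.+1 / j.*2.+1`!%:R by rewrite divr_ge0 ?exprn_ge0 //; lra.
  rewrite (ger0_norm w0); apply: ler_wpM2l => //.
  by apply: q_term_estimate => //; rewrite -ltnS.
have -> : q_sum n X - c * expR X / 2 = (q_sum n X - c * S) + c * (S - expR X / 2) by ring.
apply: le_trans (ler_normD _ _) _; rewrite (normrM c) (@ger0_norm _ c); last by case/andP: c1.
have : c * `|S - expR X / 2| <= `|S - expR X / 2| by case/andP: c1 => c0 c1; rewrite ler_piMl.
have : 0 <= expR X / X by rewrite divr_ge0 ?expR_ge0 //; lra.
lra.
Qed.

End DenominatorSum.

(** * The error of approximation *)

Section DenominatorScale.
Variable R : realType.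

Lemma pade_constS (a : R) n :
  pade_const a n.+1 = pade_const a n * ((n.+1%:R ^+ 2 - a ^+ 2) / n.+1%:R ^+ 2).
Proof.
by rewrite /pade_const big_ord_recr /= factS natrM exprMn invfM; ring.
Qed.

(** Each factor 1 - 1/(16 i^2) is at least 15/16. The exponential loss is harmless next to (2n)!. *)
Lemma pade_const_ge n : (1 / 4) * (15 / 16) ^+ n <= pade_const (1 / 4 : R) n.
Proof.
elim: n => [|n ih]; first by rewrite /pade_const big_ord0 fact0 expr0 expr1n; lra.
have k1 : 1 <= n.+1%:R :> R by rewrite ler1n.
rewrite pade_constS exprSr mulrA; apply: ler_pM => //; rewrite ?mulr_ge0 ?exprn_ge0 //; try lra.
have : 1 <= n.+1%:R ^+ 2 :> R by rewrite expr_ge1 //; lra.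
by move=> h; rewrite ler_pdivlMr ?exprn_gt0 //; lra.
Qed.

(** This exact identity between the two prefactors takes the place of asymptotics for each of them;
    both sides have the same ratio of consecutive values. *)
Lemma pade_const_fact n : pade_const (1 / 4 : R) n * (4 * (n.*2.+1)`!%:R) =
  poch (3 / 4) n * poch (1 / 2) n.*2 / n`!%:R * poch_ratio R n * (4 * n%:R + 1).
Proof.
elim: n => [|n ih].
  by rewrite (_ : 0.*2.+1`! = 1%N) // /pade_const /poch_ratio /poch !big_ord0 fact0 expr1n; field.
have n0 : 0 <= n%:R :> R by [].
have h1 : n`!%:R != 0 :> R by rewrite pnatr_eq0 -lt0n fact_gt0.
have h : 4 * n%:R + 1 != 0 :> R by rewrite gt_eqF //; lra.
have d1 k : (n.*2 + k)%:R = n%:R * 2 + k%:R :> R by rewrite natrD -muln2 natrM.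
have -> : (n.+1.*2.+1)`!%:R = (n%:R * 2 + 3) * (n%:R * 2 + 2) * (n.*2.+1)`!%:R :> R.
  by rewrite doubleS factS (factS n.*2.+1) mulnA natrM natrM -!d1 addn3 addn2.
have -> : n.+1`!%:R = (n%:R + 1) * n`!%:R :> R by rewrite factS natrM natr1.
have sE : n.+1%:R = n%:R + 1 :> R by rewrite natr1.
apply: (mulIf h); rewrite pade_constS poch_ratioS doubleS !pochS sE -(addn1 n.*2) d1.
rewrite -(addn0 n.*2) d1 addn0 addn1.
transitivity (pade_const (1 / 4 : R) n * (4 * (n.*2.+1)`!%:R) *
  ((((n%:R + 1) ^+ 2 - (1 / 4) ^+ 2) / (n%:R + 1) ^+ 2) *
    ((n%:R * 2 + 3) * (n%:R * 2 + 2)) * (4 * n%:R + 1))); first by ring.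
rewrite ih; set P := poch (3 / 4) n; set Q := poch _ _; set rho := poch_ratio _ _.
by field; rewrite h1 !gt_eqF //; lra.
Qed.

(** The algebraic mismatch left after the prefactors cancel; it tends to 1/2, which compensates the
    1/2 in exp(X)/2. *)
Definition q_scale n (X : R) : R :=
  (4 * n%:R + 1) / (4 * (2 * n%:R + 1)) * ((2 * n%:R + 1) / X ^+ 2) `^ (3 / 4).

Lemma q_scale_sum n (X : R) : (0 < n)%N -> X = Num.sqrt (2 * n%:R) ->
  q_scale n X * q R n = pade_const (1 / 4) n * outer_weight R n * q_sum n X.
Proof.
move=> n0 XE; have X1 : 1 <= X by rewrite XE; exact: sqrt2n_ge1.
have X2 : X ^+ 2 = 2 * n%:R by rewrite XE; exact: sqr_sqrt2n.
have X0 : 0 < X by lra.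
have n1 : 1 <= n%:R :> R by rewrite ler1n.
set S := \sum_(j < n.+1) X ^+ j.*2.+1 / j.*2.+1`!%:R * (poch_ratio R j * q_correction R n j).
have qE' : q R n = poch (3 / 4) n * poch (1 / 2) n.*2 / n`!%:R / X * S.
  by rewrite q_expansion // -XE.
have rn := gt_eqF (poch_ratio_gt0 R n).
have sE : q_sum n X = S / poch_ratio R n * ((2 * n%:R + 1) / X) `^ (3 / 4).
  by rewrite /q_sum /S !mulr_suml; apply: eq_bigr => j _; ring.
have fE : (n.*2.+1)`!%:R = (2 * n%:R + 1) * (2 * n)`!%:R :> R.
  by rewrite factS natrM -(natr1 n.*2) -mul2n natrM.
have := pade_const_fact n; rewrite fE => kE.
have f0 : (2 * n)`!%:R != 0 :> R by rewrite pnatr_eq0 -lt0n fact_gt0.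
have n4 : 4 * n%:R + 1 != 0 :> R by rewrite gt_eqF //; lra.
have wE : ((2 * n%:R + 1) / X ^+ 2) `^ (3 / 4) =
   (2 * n%:R) `^ (- (3 / 4)) * X `^ (- (1 / 4)) * X * ((2 * n%:R + 1) / X) `^ (3 / 4).
  have -> : (2 * n%:R + 1) / X ^+ 2 = (2 * n%:R + 1) / X * X^-1.
    by field; rewrite gt_eqF.
  have hA : 0 <= (2 * n%:R + 1) / X by rewrite divr_ge0 ?(ltW X0) //; lra.
  have hB : 0 <= X^-1 by rewrite invr_ge0 ltW.
  rewrite (powRM _ hA hB).
  rewrite mulrC; congr (_ * _); rewrite -X2 -(powR_mulrn 2 (ltW X0)) -powRrM.
  rewrite -(powR_inv1 (ltW X0)) -powRrM -{4}(powRr1 (ltW X0)).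
  by rewrite -!powRD ?(gt_eqF X0) ?implybT //; congr (_ `^ _); field.
rewrite /q_scale /outer_weight qE' sE wE -XE.
have -> : pade_const (1 / 4) n = poch (3 / 4) n * poch (1 / 2) n.*2 / n`!%:R * poch_ratio R n * (4 * n%:R + 1) / (4 * ((2 * n%:R + 1) * (2 * n)`!%:R)).
  by rewrite -kE mulfK // !mulf_neq0 // gt_eqF //; lra.
have w1 : n`!%:R != 0 :> R by rewrite pnatr_eq0 -lt0n fact_gt0.
field; rewrite f0 w1 rn !gt_eqF //; lra.
Qed.

Lemma q_scale_bounds n (X : R) : (0 < n)%N -> X = Num.sqrt (2 * n%:R) ->
  `|2 * q_scale n X - 1| <= X^-1.
Proof.
move=> n0 XE; have X1 : 1 <= X by rewrite XE; exact: sqrt2n_ge1.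
have X2 : X ^+ 2 = 2 * n%:R by rewrite XE; exact: sqr_sqrt2n.
have n1 : 1 <= n%:R :> R by rewrite ler1n.
rewrite /q_scale X2; set x := _ / (2 * n%:R).
have x1 : 1 <= x by rewrite ler_pdivlMr; lra.
have t1 : 1 <= x `^ (3 / 4).
  have : 1 `^ (3 / 4) <= x `^ (3 / 4) by apply: ge0_ler_powR; rewrite ?nnegrE //; lra.
  by rewrite powR1.
have t2 : x `^ (3 / 4) <= x by apply: ler1_powR => //; lra.
set t := x `^ _ in t1 t2 *.
have xE : x - 1 = (2 * n%:R)^-1 by rewrite /x; field; rewrite gt_eqF //; lra.
pose d : R := (4 * n%:R + 2)^-1; have d0 : 0 < d by rewrite invr_gt0; lra.
have d1 : d <= x - 1 by rewrite xE lef_pV2 ?posrE; lra.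
have -> : 2 * ((4 * n%:R + 1) / (4 * (2 * n%:R + 1)) * t) - 1 = (1 - d) * t - 1.
  by rewrite /d; field; rewrite !gt_eqF //; lra.
have : x - 1 <= X^-1.
  rewrite xE -X2 expr2 invfM ler_piMl ?invr_ge0 ?invf_le1 //; lra.
have d2 : d <= 1 by rewrite invf_le1; lra.
by move=> h; rewrite ler_norml; apply/andP; split; nra.
Qed.

End DenominatorScale.

(** * Assembling the error of the quotient *)

Section ApproximationError.
Variable R : realType.

Lemma outer_weight_ge n (X : R) : (0 < n)%N -> X = Num.sqrt (2 * n%:R) ->
  (2 * n)`!%:R / X ^+ 2 <= outer_weight R n.
Proof.
move=> n0 XE; have X1 : 1 <= X by rewrite XE; exact: sqrt2n_ge1.
have X2 : X ^+ 2 = 2 * n%:R by rewrite XE; exact: sqr_sqrt2n.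
have X0 : 0 < X by lra.
rewrite /outer_weight -XE -X2 -mulrA ler_wpM2l // -(powR_mulrn 2 (ltW X0)) -powRrM -powRN.
rewrite -powRD ?(gt_eqF X0) ?implybT //; apply: ler_powR => //; lra.
Qed.

(* [(2n)!] beats [C^n] because [y^(2n) / (2n)! <= e^y] for a suitable constant [y]. *)
Lemma exp_le_pade_const : exists2 C : R, 0 < C & forall n (X : R), (0 < n)%N ->
  X = Num.sqrt (2 * n%:R) ->
  4 ^+ n.+1 * (X * expR X) <= C * (pade_const (1 / 4) n * outer_weight R n).
Proof.
pose E : R := expR 2; have E1 : 1 <= E by have := expR_ge1Dx (2 : R); rewrite /E; lra.
(* Chosen so that 15/16 y = 4 E: the 4^n, the exp(2n) that bounds exp(2X), and the lower bound
   (15/16)^n for c_n are all covered by y^n. *)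
pose y := 64 / 15 * E; have y1 : 1 <= y by rewrite /y; lra.
pose C0 : R := expR 1 * expR y.
have C00 : 0 < C0 by rewrite mulr_gt0 ?expR_gt0.
exists (96 * C0); first by rewrite mulr_gt0.
move=> n X n0 XE; have X1 : 1 <= X by rewrite XE; exact: sqrt2n_ge1.
have X2 : X ^+ 2 = 2 * n%:R by rewrite XE; exact: sqr_sqrt2n.
have X0 : 0 < X by lra.
have ow := outer_weight_ge n0 XE; have kg := pade_const_ge R n.
have k0 := pade_const_gt0 R n.
set W := outer_weight _ _ in ow *; set k := pade_const _ _ in kg k0 *; clearbody k.
set F : R := (2 * n)`!%:R in ow; have F0 : 0 < F by rewrite ltr0n fact_gt0.
apply: (@le_trans _ _ (96 * C0 * (k * (F / X ^+ 2)))); last first.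
  apply: ler_wpM2l; first by rewrite mulr_ge0 // ltW.
  by apply: ler_wpM2l => //; exact: ltW.
rewrite !mulrA ler_pdivlMr ?exprn_gt0 //.
have h1 : X * expR X * X ^+ 2 <= 6 * (expR 1 * E ^+ n).
  have a1 := exp_term_le_expR 3 (ltW X0).
  (* From 2X <= 1 + X^2 = 1 + 2n. *)
  have a2 : expR X * expR X <= expR 1 * E ^+ n.
    rewrite /E -expRM_natl -!expRD ler_expR.
    by have := sqr_ge0 (X - 1); rewrite expr2 in X2 *; nra.
  have {}a1 : X ^+ 3 <= 6 * expR X by rewrite (_ : 3`! = 6%N) // ler_pdivrMr // in a1; lra.
  have -> : X * expR X * X ^+ 2 = X ^+ 3 * expR X by ring.
  have e0 := expR_gt0 X.
  have : X ^+ 3 * expR X <= 6 * expR X * expR X by rewrite ler_pM2r.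
  by lra.
have h2 : (4 * E) ^+ n <= 4 * k * (expR y * F).
  have -> : 4 * E = 15 / 16 * y by rewrite /y; field.
  rewrite exprMn; apply: ler_pM; rewrite ?exprn_ge0 //; try lra.
  have := exp_term_le_expR (2 * n) (le_trans ler01 y1).
  rewrite ler_pdivrMr // -/F; apply: le_trans; apply: ler_weXn2l => //; lia.
have h3 : 4 ^+ n.+1 * (X * expR X * X ^+ 2) <= 4 ^+ n.+1 * (6 * (expR 1 * E ^+ n)).
  by rewrite ler_pM2l // exprn_gt0.
have h4 : 24 * expR 1 * (4 * E) ^+ n <= 24 * expR 1 * (4 * k * (expR y * F)).
  by rewrite ler_pM2l // mulr_gt0 // expR_gt0.
rewrite exprMn in h4; rewrite exprS in h3 *; rewrite /C0 /F in h4 *; lra.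
Qed.

(** Used with c = exp(-3/8) >= 1 - 3/8. The limit 1/16000 gives 2 |d2| <= 1/8 and keeps the
    denominator above 1/2. *)
Lemma quotient_estimate (c d1 d2 t Y : R) : 5 / 8 <= c <= 1 -> 0 < Y <= 1 / 16000%:R ->
  `|t - 1| <= Y -> `|d1| <= 10 ^+ 5 * Y -> `|d2| <= 1000 * Y ->
  `|t * (c + d1) / (c + 2 * d2) - 1| <= 10 ^+ 6 * Y.
Proof.
move=> /andP[c0 c1] /andP[Y0 Y1] ht hd1 hd2.
have [d2l d2u] : - (1000 * Y) <= d2 /\ d2 <= 1000 * Y by apply/andP; rewrite -ler_norml.
have D : 1 / 2 <= c + 2 * d2 by lra.
have D0 : 0 < c + 2 * d2 by lra.
have -> : t * (c + d1) / (c + 2 * d2) - 1 =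
   ((t - 1) * (c + d1) + (d1 - 2 * d2)) / (c + 2 * d2) by field; rewrite gt_eqF.
rewrite normrM normfV (gtr0_norm D0) ler_pdivrMr //.
have a1 : `|(t - 1) * (c + d1)| <= Y * (1 + 10 ^+ 5 * Y).
  rewrite normrM; apply: ler_pM => //; apply: le_trans (ler_normD _ _) _.
  by rewrite ger0_norm; lra.
have a2 : `|d1 - 2 * d2| <= 10 ^+ 5 * Y + 2 * (1000 * Y).
  by apply: le_trans (ler_normB _ _) _; rewrite normrM ger0_norm //; lra.
have := ler_normD ((t - 1) * (c + d1)) (d1 - 2 * d2).
have : Y * Y <= Y / 16000%:R by rewrite ler_pM2l //; lra.
have : 10 ^+ 6 * Y * (1 / 2) <= 10 ^+ 6 * Y * (c + 2 * d2) by rewrite ler_pM2l // mulr_gt0 // exprn_gt0.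
rewrite !exprS expr0 in a1 a2 *; nra.
Qed.

End ApproximationError.

Section ErrorEstimate.
Variable R : realType.

Lemma error_estimate : exists K : R, forall n (X : R), (3 <= n)%N ->
  X = Num.sqrt (2 * n%:R) -> 16000%:R <= X ->
  `|(EulerGamma (1 / 2) / EulerGamma (1 / 4) - p R n / q R n) * expR (2 * X)
    - Num.sqrt (2 * pi) / EulerGamma (1 / 4)| <= K / X.
Proof.
have [C C0 hC] := exp_le_pade_const R.
pose s : R := Num.sqrt (2 * pi); have s0 : 0 <= s by exact: sqrtr_ge0.
have G0 : 0 < EulerGamma (1 / 4 : R) by apply: EulerGamma_gt0; lra.
set G1 := EulerGamma (1 / 4) in G0 *; set G2 := EulerGamma (1 / 2).
exists ((s * 10 ^+ 6 + 4 * C) / G1) => n X n3 XE XL.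
have n0 : (0 < n)%N by apply: leq_trans n3.
have X0 : 0 < X by lra.
have [A /andP[A0 A1] [B /andP[B0 B1] eqAB]] := EulerGamma_remainder R n0.
have [v vE hv] := rem_integral_estimate R n3; rewrite -XE -/s in hv.
move: eqAB; rewrite vE -/G1 -/G2 -EFinM -EFinD => -[eqAB].
have kE := q_scale_sum n0 XE; have hT := q_scale_bounds n0 XE.
have hS := q_sum_estimate n0 XE; have {}hC := hC n X n0 XE.
have k0 := pade_const_gt0 R n.
have F0 : 0 < (2 * n)`!%:R :> R by rewrite ltr0n fact_gt0.
have W0 : 0 < outer_weight R n.
  by apply: lt_le_trans (outer_weight_ge n0 XE); rewrite divr_gt0 ?exprn_gt0.
set k := pade_const _ _ in eqAB kE hC k0; set W := outer_weight _ _ in hv kE hC W0.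
set S := q_sum _ _ in kE hS; set T := q_scale _ _ in kE hT.
clearbody k W S T.
have c1 : 5 / 8 <= expR (- (3 / 8) : R) <= 1.
  by rewrite expR_le1; have := expR_ge1Dx (- (3 / 8) : R); lra.
set c := expR (- (3 / 8)) in hv hS c1.
set e := expR X in hC hS; have e0 : 0 < e by exact: expR_gt0.
have eE : expR (- X) = e^-1 by rewrite expRN.
have e2 : expR (2 * X) = e ^+ 2 by rewrite -expRM_natl.
pose Y := X^-1; have Y0 : 0 < Y <= 1 / 16000%:R.
  by rewrite invr_gt0 X0 /= div1r lef_pV2 ?posrE //; lra.
have XY : X * Y = 1 by rewrite mulfV // gt_eqF.
have sp : 0 < s by rewrite sqrtr_gt0 mulr_gt0 // pi_gt0.
rewrite eE in hv; rewrite e2 -/s.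
clearbody c e s G1 G2.
(* The normalised errors of the remainder integral and of the sum; c + d1 and c + 2 d2 share the
   limit c, which drops out of their quotient. *)
pose d1 := v / (W * (s * e^-1)) - c; pose d2 := S / e - c / 2.
have m0 : 0 < W * (s * e^-1) by rewrite !mulr_gt0 ?invr_gt0.
have hd1 : `|d1| <= 10 ^+ 5 * Y.
  have -> : d1 = (v - W * (s * e^-1) * c) / (W * (s * e^-1)).
    by rewrite /d1; field; rewrite !gt_eqF.
  by rewrite normrM normfV (gtr0_norm m0) ler_pdivrMr // [leRHS]mulrC.
have hd2 : `|d2| <= 1000 * Y.
  have -> : d2 = (S - c * e / 2) / e by rewrite /d2; field; rewrite gt_eqF.
  by rewrite normrM normfV (gtr0_norm e0) ler_pdivrMr //; apply: le_trans hS _; rewrite /Y; lra.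
have main := quotient_estimate c1 Y0 hT hd1 hd2.
have /andP[Y0' Y1] := Y0; have /andP[c2 c3] := c1.
have Sg : e / 4 <= S.
  have SE : S = e * (c / 2 + d2) by rewrite /d2; field; rewrite gt_eqF.
  by rewrite SE ler_pM2l //; rewrite ler_norml in hd2; lra.
have T0 : 1 / 4 <= T <= 1.
  by move: hT; rewrite -/Y ler_norml; clear - Y1; lra.
have /andP[T1 T2] := T0.
have Tp : 0 < T by clear - T1; lra.
have Sp : 0 < S by apply: lt_le_trans Sg; rewrite divr_gt0.
have q0 : 0 < q R n by rewrite -(pmulr_rgt0 _ Tp) kE !mulr_gt0.
have qT : (q R n)^-1 = T / (k * W * S) by rewrite -kE; field; rewrite !gt_eqF.
(* The term in B - A comes from t <= 1 and is handled by [exp_le_pade_const]; the rest is the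
   quotient of the two asymptotic expressions, where all prefactors have cancelled. *)
have -> : (G2 / G1 - p R n / q R n) * e ^+ 2 - s / G1 =
    (s * (2 * T * (c + d1) / (c + 2 * d2) - 1) + (B - A) * (e ^+ 2 / q R n)) / G1.
  have -> : G2 / G1 - p R n / q R n = (k * v + (B - A)) / (G1 * q R n).
    have -> : k * v + (B - A) = G2 * q R n - G1 * p R n by clear - eqAB; lra.
    by field; rewrite !gt_eqF.
  have -> : 2 * T * (c + d1) / (c + 2 * d2) = k * v * e ^+ 2 / s / q R n.
    rewrite -mulrA qT.
    have -> : c + d1 = v / (W * (s * e^-1)) by rewrite /d1; ring.
    have -> : c + 2 * d2 = 2 * (S / e) by rewrite /d2; field; rewrite gt_eqF.
    by field; rewrite !gt_eqF.
  by field; rewrite !gt_eqF.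
rewrite normrM normfV (gtr0_norm G0) [leRHS]mulrAC ler_pM2r ?invr_gt0 //.
apply: le_trans (ler_normD _ _) _; rewrite [leRHS]mulrDl -/Y; apply: lerD.
  by rewrite normrM (gtr0_norm sp) -[leRHS]mulrA ler_pM2l.
have eq0 : 0 < e ^+ 2 / q R n by rewrite divr_gt0 ?exprn_gt0.
rewrite normrM (gtr0_norm eq0).
have BA : `|B - A| <= 4 ^+ n.+1 by rewrite ler_norml; clear - A0 A1 B0 B1; lra.
have h1 : e ^+ 2 / q R n <= 4 * e / (k * W).
  have -> : 4 * e / (k * W) = e ^+ 2 * (1 / (k * W * (e / 4))).
    by field; rewrite !gt_eqF.
  have kW : 0 < k * W by rewrite mulr_gt0.
  have e4 : 0 < e / 4 by rewrite divr_gt0.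
  apply: ler_wpM2l; first by rewrite exprn_ge0 // ltW.
  rewrite qT; apply: (@le_trans _ _ (1 / (k * W * S))).
    by apply: ler_wpM2r => //; rewrite invr_ge0 ltW // mulr_gt0.
  rewrite !div1r lef_pV2 ?posrE; last 2 first.
  - exact: mulr_gt0.
  - exact: mulr_gt0.
  by apply: ler_wpM2l => //; exact: ltW.
apply: (@le_trans _ _ (4 ^+ n.+1 * (4 * e / (k * W)))).
  by apply: ler_pM => //; exact: ltW.
rewrite /Y ler_pdivlMr // mulrA mulrAC ler_pdivrMr ?mulr_gt0 //.
have -> : 4 ^+ n.+1 * (4 * e) * X = 4 * (4 ^+ n.+1 * (X * e)) by ring.
have -> : 4 * C * (k * W) = 4 * (C * (k * W)) by ring.
by rewrite ler_pM2l.
Qed.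

End ErrorEstimate.

Theorem corollary2 (R : realType) :
  [/\ satisfies_recurrence (@p R) /\ satisfies_recurrence (@q R),
      [/\ p R 0 = 1, p R 1 = 37 / 64 & p R 2 = 50685%:R / 8192%:R],
      [/\ q R 0 = 1, q R 1 = 19 / 16 & q R 2 = 6525%:R / 512] &
      exists2 eps : nat -> R,
        eps =O_\oo (fun n : nat => n%:R `^ (- (1 / 2)) : R) &
        forall n : nat,
          EulerGamma (1 / 2) / EulerGamma (1 / 4) - p R n / q R n
          = expR (- 2 * Num.sqrt (2 * n%:R))
            * (Num.sqrt (2 * pi) / EulerGamma (1 / 4) + eps n)].
Proof.
split; [split; [exact: p_rec|exact: q_rec]|exact: p_init|exact: q_init|].
pose X n : R := Num.sqrt (2 * n%:R).
(* The equation, required for every [n], determines eps; only its order of growth is left to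
   prove. *)
exists (fun n => (EulerGamma (1 / 2) / EulerGamma (1 / 4) - p R n / q R n) * expR (2 * X n)
    - Num.sqrt (2 * pi) / EulerGamma (1 / 4)); last first.
  move=> n; rewrite [in RHS]addrC [in RHS]subrK mulrCA -expRD -/(X n).
  by rewrite (_ : - 2 * X n + 2 * X n = 0) ?expR0 ?mulr1 //; ring.
have [K hK] := error_estimate R.
apply/eqOP; near=> k; near=> n.
have n1 : 1 <= n%:R :> R by rewrite ler1n; near: n; exact: nbhs_infty_ge.
have n3 : (3 <= n)%N by near: n; exact: nbhs_infty_ge.
have nL : 16000%:R ^+ 2 <= n%:R :> R by near: n; exact: nbhs_infty_ger.
have X0 : 0 <= X n by exact: sqrtr_ge0.
have X2 : X n ^+ 2 = 2 * n%:R by exact: sqr_sqrt2n.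
have XL : 16000%:R <= X n.
  by rewrite -(@ler_pXn2r _ 2) ?nnegrE // X2; lra.
have {}hK := hK n (X n) n3 erefl XL.
rewrite [X in _ <= _ * X]ger0_norm ?powR_ge0 //; apply: le_trans hK _.
have h12 : 1 / 2 = 2^-1 :> R by field.
rewrite powRN h12 powR12_sqrt; last by lra.
have sq : 0 < Num.sqrt n%:R :> R by rewrite sqrtr_gt0; lra.
have kK : K <= k by near: k; apply: nbhs_pinfty_ge; exact: num_real.
have kp : 0 <= k by near: k; apply: nbhs_pinfty_ge; exact: num_real.
apply: (@le_trans _ _ (k / X n)).
  by rewrite ler_wpM2r // invr_ge0.
(* 1/X is at most n^(-1/2), since X is the root of 2n. *)
rewrite ler_wpM2l // lef_pV2 ?posrE //; last by lra.
by rewrite ler_sqrt; lra.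
Unshelve. all: by end_near. Qed.
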